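(* Let $T:K\to K$ be the shift map for a discrete and proper Iwasawa continued fraction algorithm that is incomplete with $n_0\ge1$ central symmetries. Then $T$ has at most $n_0$ ergodic components.
   Context: **Spaces.** $k$ is $\mathbb R$, $\mathbb C$ or the quaternions, $n\ge1$; $\mathrm{Im}(k)\subset k$ is the set of purely imaginary elements; $\|\cdot\|$ is the standard norm. The Iwasawa inversion space $\mathbb X=\mathbb X^n_k$ is $k^n\times\mathrm{Im}(k)$ with group law $(z,t)*(z',t')=(z+z',t+t'+2\,\mathrm{Im}\langle z,z'\rangle)$, $\langle z,z'\rangle=\sum_i\overline{z_i}z'_i$. The same formula defines a group law on $k^n\times k$, with gauge $|(z,w)|=\big\|\|z\|^2+\|\mathrm{Re}\,w\|+\mathrm{Im}\,w\big\|^{1/2}$ and $d((z,w),(z',w'))=|(-z,-w)*(z',w')|$; restricted to $\mathbb X$, $d$ is the Cygan metric. $\mathbb H=\{(z,w)\in k^n\times k:\mathrm{Re}\,w>0\}$, $\partial\mathbb H=\mathbb X$. Let $\phi(z,w)=(1,\sqrt2 z,w+\|z\|^2)\in k^{n+2}$, let $\infty$ correspond to $(0,0,1)$, and let $J=\begin{bmatrix}0&0&-1\\0&\mathrm{id}_n&0\\-1&0&0\end{bmatrix}$. Via $\phi$, $G=\mathbb PU(J)$ acts on $\mathbb H$ and on $\mathbb X\cup\{\infty\}$ (Möbius transformations). $\mathrm{Isom}(\mathbb X)$ denotes the isometries of $(\mathbb X,d)$ that are restrictions of elements of $\mathrm{Stab}_G(\infty)$, viewed as a subgroup of $G$. Measure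 on $\mathbb X$ is Haar (Lebesgue) measure. An inversion is a Möbius transformation $\iota:\mathbb X\setminus\{0\}\to\mathbb X\setminus\{0\}$ (exchanging $0$ and $\infty$) with $|\iota h|=1/|h|$ and $d(\iota h,\iota h')=\frac{d(h,h')}{|h||h'|}$ for all $h\in(\mathbb H\cup\mathbb X)\setminus\{0\}$, $h'\in\mathbb X\setminus\{0\}$. **Iwasawa CF algorithm.** Data: $k,n,\mathbb X$; an inversion $\iota$; a lattice $\mathcal Z\subset\mathrm{Isom}(\mathbb X)$ (discrete subgroup with finite-measure quotient); a fundamental domain $K\subset\mathbb X$ for $\mathcal Z$ (measurable, $\mathbb X=\bigcup_{a\in\mathcal Z}aK$, and $K\cap\bigcup_{a\in\mathcal Z\setminus\{\mathrm{id}\}}aK$ has measure $0$); and a rounding mapping $[\cdot]:\mathbb X\to\mathcal Z$ with $[y]^{-1}(y)\in K$ for all $y$. The modular group is $\mathcal M=\langle\iota,\mathcal Z\rangle\subset G$. The shift map is $T:K\to K$, $T(0)=0$ if $0\in K$, $T(x)=[\iota(x)]^{-1}(\iota(x))$ otherwise. **Properties.** *Discrete*: $\mathcal M$ is a discrete subgroup of $G$. *Proper*: $\sup\{|x|:x\in K\}<1$. *Incomplete with $n_0$ central symmetries*: there is a set $\mathcal R\subset\mathrm{Isom}(\mathbb X)$ with $n_0$ elements such that every element of $\mathcal R$ fixes $0$; the only element of $\mathcal Z$ fixing $0$ is the identity; $\mathrm{Stab}_{\mathcal M}(\infty)=\langle\mathcal Z,\mathcal R\rangle$; and every element of $\mathrm{Stab}_{\mathcal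 M}(\infty)$ can be written uniquely as $ra$ with $r\in\mathcal R$, $a\in\mathcal Z$, and uniquely as $a'r'$ with $a'\in\mathcal Z$, $r'\in\mathcal R$. **Ergodic components.** A measurable $A\subset K$ is invariant if $T^{-1}A\,\triangle\,A$ is Lebesgue-null. ''At most $n_0$ ergodic components'' means: up to null sets $K$ is a disjoint union of $m\le n_0$ invariant sets of positive measure, none of which contains an invariant subset $B$ such that both $B$ and its complement in that set have positive measure. *)

(* Defs.v *)
From HB Require Import structures.
From mathcomp Require Import all_boot all_order all_algebra ring complex.
From mathcomp Require Import all_classical all_reals all_analysis.

Set Implicit Arguments.
Unset Strict Implicit.
Unset Printing Implicit Defensive.

Import Order.TTheory GRing.Theory Num.Theory.

Local Open Scope classical_set_scope.
Local Open Scope ring_scope.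

(* [Quat a b c d] is the quaternion a + b i + c j + d k. *)
Record quat (R : Type) := Quat { qre : R; qi : R; qj : R; qk : R }.

Section QuatChoice.
Variable R : Type.
Definition tuple_of_quat (x : quat R) : R * R * R * R :=
  (qre x, qi x, qj x, qk x).
Definition quat_of_tuple (t : R * R * R * R) : quat R :=
  Quat t.1.1.1 t.1.1.2 t.1.2 t.2.
Lemma tuple_of_quatK : cancel tuple_of_quat quat_of_tuple.
Proof. by case. Qed.
End QuatChoice.

HB.instance Definition _ (R : eqType) :=
  Equality.copy (quat R) (can_type (@tuple_of_quatK R)).
HB.instance Definition _ (R : choiceType) :=
  Choice.copy (quat R) (can_type (@tuple_of_quatK R)).

Section QuatRing.
Variable R : comNzRingType.
Implicit Types x y : quat R.

Definition addq x y :=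
  Quat (qre x + qre y) (qi x + qi y) (qj x + qj y) (qk x + qk y).
Definition oppq x := Quat (- qre x) (- qi x) (- qj x) (- qk x).
Definition mulq x y := Quat
  (qre x * qre y - qi x * qi y - qj x * qj y - qk x * qk y)
  (qre x * qi y + qi x * qre y + qj x * qk y - qk x * qj y)
  (qre x * qj y - qi x * qk y + qj x * qre y + qk x * qi y)
  (qre x * qk y + qi x * qj y - qj x * qi y + qk x * qre y).
Definition conjq x := Quat (qre x) (- qi x) (- qj x) (- qk x).
Definition real_quat (a : R) := Quat a 0 0 0.

Lemma addqA : associative addq.
Proof. by move=> [????] [????] [????]; rewrite /addq /=; congr Quat; ring. Qed.
Lemma addqC : commutative addq.
Proof. by move=> [????] [????]; rewrite /addq /=; congr Quat; ring. Qed.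
Lemma add0q : left_id (real_quat 0) addq.
Proof. by move=> [????]; rewrite /addq /=; congr Quat; ring. Qed.
Lemma addNq : left_inverse (real_quat 0) oppq addq.
Proof.
by move=> [????]; rewrite /addq /real_quat /=; congr Quat; ring.
Qed.
HB.instance Definition _ :=
  GRing.isZmodule.Build (quat R) addqA addqC add0q addNq.

Lemma mulqA : associative mulq.
Proof. by move=> [????] [????] [????]; rewrite /mulq /=; congr Quat; ring. Qed.
Lemma mul1q : left_id (real_quat 1) mulq.
Proof. by move=> [????]; rewrite /mulq /=; congr Quat; ring. Qed.
Lemma mulq1 : right_id (real_quat 1) mulq.
Proof. by move=> [????]; rewrite /mulq /=; congr Quat; ring. Qed.
Lemma mulqDl : left_distributive mulq addq.
Proof.
by move=> [????] [????] [????]; rewrite /mulq /addq /=; congr Quat; ring.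
Qed.
Lemma mulqDr : right_distributive mulq addq.
Proof.
by move=> [????] [????] [????]; rewrite /mulq /addq /=; congr Quat; ring.
Qed.
Lemma oneq_neq0 : real_quat 1 != real_quat 0.
Proof. by apply/eqP => -[] /eqP; rewrite oner_eq0. Qed.
HB.instance Definition _ := GRing.Zmodule_isNzRing.Build (quat R)
  mulqA mul1q mulq1 mulqDl mulqDr oneq_neq0.
End QuatRing.

Inductive scalar_kind := RealK | ComplexK | QuaternionK.

Definition scalars (R : realType) (k : scalar_kind) : nzRingType :=
  match k with
  | RealK => R
  | ComplexK => R[i]
  | QuaternionK => quat R
  end.

Section Scalars.
Variable R : realType.

Definition kconj k : scalars R k -> scalars R k :=
  match k return scalars R k -> scalars R k with
  | RealK => fun x => x
  | ComplexK => fun x => conjc x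
  | QuaternionK => fun x => conjq x
  end.

Definition kre k : scalars R k -> R :=
  match k return scalars R k -> R with
  | RealK => fun x => x
  | ComplexK => fun x => complex.Re x
  | QuaternionK => fun x => qre x
  end.

Definition kreal k : R -> scalars R k :=
  match k return R -> scalars R k with
  | RealK => fun a => a
  | ComplexK => fun a => Complex a 0
  | QuaternionK => fun a => real_quat a
  end.

Definition kim k (x : scalars R k) : scalars R k := x - kreal k (kre x).

(* The real dimension of Im(k). *)
Definition imdim (k : scalar_kind) : nat :=
  match k with RealK => 0 | ComplexK => 1 | QuaternionK => 3 end%N.

Definition kimcoord k : scalars R k -> 'I_(imdim k) -> R :=
  match k return scalars R k -> 'I_(imdim k) -> R with
  | RealK => fun _ _ => 0
  | ComplexK => fun x _ => complex.Im x
  | QuaternionK => fun x j => [:: qi x; qj x; qk x]`_j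
  end.

Definition knorm k (x : scalars R k) : R := Num.sqrt (kre (kconj x * x)).

Lemma kre0 k : kre (0 : scalars R k) = 0.
Proof. by case: k. Qed.
End Scalars.

(* Infimum of the total volumes of countable covers by boxes; a measurable
   set is a Caratheodory measurable set for this outer measure. *)
Definition lebesgue_outer (R : realType) (I : finType) (A : set (I -> R))
    : \bar R :=
  ereal_inf [set s | exists a b : nat -> I -> R,
    [/\ forall m i, a m i <= b m i,
        A `<=` \bigcup_m [set x | forall i, a m i <= x i < b m i] &
        s = (\sum_(0 <= m <oo) (\prod_i (b m i - a m i))%:E)%E]].

Section Siegel.
Variables (R : realType) (k : scalar_kind) (n : nat).
Notation K1 := (scalars R k).

Definition hermdot (z z' : 'cV[K1]_n) : K1 := \sum_i kconj (z i 0) * z' i 0.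

Definition sqnorm (z : 'cV[K1]_n) : R := \sum_i knorm (z i 0) ^+ 2.

Definition iw_mul (p q : 'cV[K1]_n * K1) : 'cV[K1]_n * K1 :=
  (p.1 + q.1, p.2 + q.2 + kim (hermdot p.1 q.1) *+ 2).

Definition gauge (p : 'cV[K1]_n * K1) : R :=
  Num.sqrt (knorm (kreal k (sqnorm p.1 + `|kre p.2|) + kim p.2)).

Definition cygan (p q : 'cV[K1]_n * K1) : R := gauge (iw_mul (- p.1, - p.2) q).

(* The union of H and of its boundary X, without infinity. *)
Definition siegel := {p : 'cV[K1]_n * K1 | 0 <= kre p.2}.

Definition XX : set siegel := [set p | kre (\val p).2 = 0].

Lemma origin_subproof : 0 <= kre ((0, 0) : 'cV[K1]_n * K1).2.
Proof. by rewrite /= kre0. Qed.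
Definition origin : siegel := exist _ (0, 0) origin_subproof.

(* Real coordinates of (z, t) in X: the real ([None]) and imaginary
   coordinates of the z_i, then the imaginary coordinates of t. *)
Definition coordX (p : siegel)
    (c : ('I_n * option 'I_(imdim k) + 'I_(imdim k))%type) : R :=
  match c with
  | inl (i, None) => kre ((\val p).1 i 0)
  | inl (i, Some j) => kimcoord ((\val p).1 i 0) j
  | inr j => kimcoord (\val p).2 j
  end.

Definition muX (A : set siegel) : \bar R := lebesgue_outer (coordX @` A).

Definition measurableX (A : set siegel) : Prop :=
  A `<=` XX /\ (@lebesgue_outer R _).-caratheodory (coordX @` A).

(* [None] is the point at infinity. *)
Notation cpoint := (option siegel).
Notation transf := (cpoint -> cpoint).

Definition phi (p : cpoint) : 'cV[K1]_(1 + (n + 1)) :=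
  match p with
  | None => col_mx 0 (col_mx 0 1%:M)
  | Some h => col_mx 1%:M (col_mx (kreal k (Num.sqrt 2) *: (\val h).1)
                ((\val h).2 + kreal k (sqnorm (\val h).1))%:M)
  end.

Definition formJ : 'M[K1]_(1 + (n + 1)) :=
  block_mx 0 (row_mx 0 (- 1%:M)) (col_mx 0 (- 1%:M)) (block_mx 1%:M 0 0 0).

Definition unitaryJ (A : 'M[K1]_(1 + (n + 1))) : Prop :=
  map_mx (@kconj R k) A^T *m formJ *m A = formJ.

(* Projective points are classes of nonzero vectors up to scalars acting on
   the right, so that they are preserved by matrices acting on the left. *)
Definition induces (A : 'M[K1]_(1 + (n + 1))) (g : transf) : Prop :=
  forall p, exists2 c : K1, c != 0 & A *m phi p = phi (g p) *m c%:M.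

(* PU(J), seen as a group of transformations for the composition: two
   elements of U(J) induce the same map if and only if they differ by a
   central scalar. *)
Definition moebius : set transf :=
  [set g | exists2 A, unitaryJ A & induces A g].

(* Moebius transformations are bijective, hence the default is never used. *)
Definition minv (g : transf) : transf := 'pinv_idfun [set: cpoint] g.

(* g restricted to finite points; the default is never used below, since
   isometries fix infinity and inversions only send the origin to it. *)
Definition mapp (g : transf) (h : siegel) : siegel := odflt h (g (Some h)).

Definition is_subgroup (S : set transf) : Prop :=
  [/\ S `<=` moebius, S idfun, (forall g h, S g -> S h -> S (g \o h)) &
      (forall g, S g -> S (minv g))].

Definition generated (S : set transf) : set transf := smallest is_subgroup S.

Definition stab_infty (S : set transf) : set transf :=
  [set g | S g /\ g None = None].

Definition mx_open (O : set 'M[K1]_(1 + (n + 1))) : Prop :=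
  forall A, O A -> exists2 e : R, 0 < e &
    forall B : 'M[K1]_(1 + (n + 1)),
      (forall i j, knorm (B i j - A i j) < e) -> O B.

(* The quotient topology of PU(J), U(J) having the subspace topology. *)
Definition moebius_open (W : set transf) : Prop :=
  exists2 O, mx_open O &
    forall A g, unitaryJ A -> induces A g -> (W g <-> O A).

Definition discrete_subset (S : set transf) : Prop :=
  forall g, S g -> exists2 W, moebius_open W & W `&` S = [set g].

Definition isomX : set transf :=
  [set g | stab_infty moebius g /\
     forall h h', XX h -> XX h' ->
       cygan (\val (mapp g h)) (\val (mapp g h')) = cygan (\val h) (\val h')].

Definition is_inversion (iota : transf) : Prop :=
  [/\ moebius iota,
      iota (Some origin) = None /\ iota None = Some origin,
      forall h, h <> origin ->
        gauge (\val (mapp iota h)) = (gauge (\val h))^-1 &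
      forall h h', h <> origin -> XX h' -> h' <> origin ->
        cygan (\val (mapp iota h)) (\val (mapp iota h')) =
        cygan (\val h) (\val h') / (gauge (\val h) * gauge (\val h'))].

Definition fundamental_domain (Z : set transf) (D : set siegel) : Prop :=
  [/\ measurableX D,
      XX = \bigcup_(a in Z) (mapp a @` D) &
      muX (D `&` \bigcup_(a in Z `\ idfun) (mapp a @` D)) = 0%E].

(* The quotient measure of X by Z is the measure of a fundamental domain. *)
Definition is_lattice (Z : set transf) : Prop :=
  [/\ is_subgroup Z, Z `<=` isomX, discrete_subset Z &
      exists2 D, fundamental_domain Z D & (muX D < +oo)%E].

Record iwasawa_cf := IwasawaCF {
  cf_iota : transf;
  cf_Z : set transf;
  cf_K : set siegel;
  cf_round : siegel -> transf;
  cf_iotaP : is_inversion cf_iota;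
  cf_ZP : is_lattice cf_Z;
  cf_KP : fundamental_domain cf_Z cf_K;
  cf_roundZ : forall y, XX y -> cf_Z (cf_round y);
  cf_roundK : forall y, XX y -> cf_K (mapp (minv (cf_round y)) y)
}.

Definition modular_group (C : iwasawa_cf) : set transf :=
  generated (cf_iota C |` cf_Z C).

Definition shift_map (C : iwasawa_cf) (x : siegel) : siegel :=
  if x == origin then origin
  else let y := mapp (cf_iota C) x in mapp (minv (cf_round C y)) y.

Definition cf_discrete (C : iwasawa_cf) : Prop :=
  discrete_subset (modular_group C).

Definition cf_proper (C : iwasawa_cf) : Prop :=
  (ereal_sup [set (gauge (\val x))%:E | x in cf_K C] < 1)%E.

Definition cf_incomplete (C : iwasawa_cf) (n0 : nat) : Prop :=
  let stab := stab_infty (modular_group C) in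
  exists S : set transf,
    [/\ S `<=` isomX /\ (S #= `I_n0)%card,
        forall r, S r -> r (Some origin) = Some origin,
        forall a, cf_Z C a -> a (Some origin) = Some origin -> a = idfun,
        stab = generated (cf_Z C `|` S) &
        forall g, stab g ->
          (exists! ra : transf * transf,
             [/\ S ra.1, cf_Z C ra.2 & g = ra.1 \o ra.2]) /\
          (exists! ar : transf * transf,
             [/\ cf_Z C ar.1, S ar.2 & g = ar.1 \o ar.2])].

Definition invariant_set (K : set siegel) (T : siegel -> siegel)
    (A : set siegel) : Prop :=
  [/\ measurableX A, A `<=` K & muX ((K `&` T @^-1` A) `+` A) = 0%E].

Definition at_most_ergodic_components (K : set siegel) (T : siegel -> siegel)
    (n0 : nat) : Prop :=
  exists (m : nat) (E : 'I_m -> set siegel),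
    [/\ (m <= n0)%N,
        trivIset setT E,
        muX (K `\` \bigcup_i E i) = 0%E,
        forall i, invariant_set K T (E i) /\ (0 < muX (E i))%E &
        forall i (B : set siegel), B `<=` E i -> invariant_set K T B ->
          ~ ((0 < muX B)%E /\ (0 < muX (E i `\` B))%E)].

End Siegel.

(* Main.v *)
(* For almost every x in K, the branches m_n of the algorithm with
   m_n x = T^n x expand at x while m_n(infinity) stays away from T^n x, since K
   is proper. Zooming in on x by the m_n and using a density argument, one shows
   that the orbit under the modular group of an invariant set of positive measure
   contains almost all of K, and that almost every x has arbitrarily good
   approximations g^-1(infinity), in the sense that g x and g(infinity) are far
   apart. Discreteness bounds the distortion of the modular group at infinity,
   which yields an analogue of Legendre's theorem: such an approximation is a
   convergent, that is, g m_n^-1 fixes infinity for some n.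
   Given n0 + 1 disjoint invariant sets of positive measure, almost every x is
   equivalent to a point x_i of each of them. Applying the analogue of Legendre's
   theorem to all the x_i and to one good approximation of x gives n_i, a_i in Z
   and central symmetries r_i such that T^(n_i) x_i = a_i r_i g x. Two of the r_i
   coincide, hence two of the points T^(n_i) x_i of K are equivalent under Z, and
   thus equal: a contradiction. *)

Require Import Defs.
From HB Require Import structures.
From mathcomp Require Import all_boot all_order all_algebra all_classical all_reals all_analysis.
From mathcomp Require Import ring lra complex measurable_realfun.

Set Implicit Arguments.
Unset Strict Implicit.
Unset Printing Implicit Defensive.

Import Order.TTheory GRing.Theory Num.Theory.
Import numFieldNormedType.Exports.

Local Open Scope classical_set_scope.
Local Open Scope ring_scope.

(** * Lebesgue outer measure *)

Section Boxes.
Variables (R : realType) (I : finType).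
Implicit Types (a b x : I -> R) (A B : set (I -> R)).

(** All of the dynamics rests on one identity, d(g p, g q) = lam_g(p) lam_g(q) d(p, q) on the
    compactified boundary with d(u, infinity) = 1. It comes from the Hermitian form: its value on
    two boundary lifts has norm the squared Cygan distance. If g(h) = infinity, then lam_g(u) = r /
    d(u, h) with r = lam_g(infinity), the radius of the isometric sphere of g. Discreteness and the
    covering by Z bound all these radii. This proves the analogue of Legendre's theorem: as long as
    no branch sends the pole h of g to infinity, the radius of g m_n^-1 grows geometrically with n.
    The exceptional sets are only controlled by the outer measure, so density is used in a weak
    form: a set that is thin at arbitrarily small scales around each of its points is null. One
    approximation g of x serves all the points x_i = f_i x at once: g f_i^-1 keeps half of the
    quality of g at x_i as soon as the pole of g is twice closer to x than f_i^-1(infinity). This is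
    why poles arbitrarily close to x are required. *)

Definition box a b : set (I -> R) := [set x | forall i, a i <= x i < b i].
Definition vol a b : R := \prod_i (b i - a i).

Lemma vol_ge0 a b : (forall i, a i <= b i) -> 0 <= vol a b.
Proof. by move=> ab; apply: prodr_ge0 => i _; rewrite subr_ge0. Qed.

Lemma lebesgue_outer_le_cover A (a b : nat -> I -> R) :
  (forall m i, a m i <= b m i) -> A `<=` \bigcup_m box (a m) (b m) ->
  (lebesgue_outer A <= \sum_(0 <= m <oo) (vol (a m) (b m))%:E)%E.
Proof. by move=> ab AB; apply: ereal_inf_lbound; exists a, b. Qed.

Lemma lebesgue_outer_adherent A (e : R) : 0 < e -> (lebesgue_outer A < +oo)%E ->
  exists ab : nat -> (I -> R) * (I -> R),
    [/\ forall m i, (ab m).1 i <= (ab m).2 i,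
        A `<=` \bigcup_m box (ab m).1 (ab m).2 &
        (\sum_(0 <= m <oo) (vol (ab m).1 (ab m).2)%:E <= lebesgue_outer A + e%:E)%E].
Proof.
move=> e0; rewrite /lebesgue_outer; set S := (X in ereal_inf X) => Soo.
have S0 : (0 <= ereal_inf S)%E.
  apply: le_ereal_inf_tmp => x [a [b [ab _ ->]]].
  by apply: nneseries_ge0 => m _ _; rewrite lee_fin vol_ge0.
have fS : ereal_inf S \is a fin_num by rewrite ge0_fin_numE.
have [x [a [b [ab AB ->]]] /ltW le] := lb_ereal_inf_adherent e0 fS.
by exists (fun m => (a m, b m)).
Qed.

Lemma lebesgue_outer_ge0 A : (0 <= lebesgue_outer A)%E.
Proof.
apply: le_ereal_inf_tmp => x [a [b [ab _ ->]]].
by apply: nneseries_ge0 => m _ _; rewrite lee_fin vol_ge0.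
Qed.

Lemma le_lebesgue_outer : {homo @lebesgue_outer R I : A B / A `<=` B >-> (A <= B)%E}.
Proof.
move=> A B AB; apply: ereal_inf_le_tmp => x [a [b [ab BB ->]]].
by exists a, b; split => //; exact: subset_trans BB.
Qed.

Lemma lebesgue_outer_sigma_subadditive : sigma_subadditive (@lebesgue_outer R I).
Proof.
move=> A; have [[i ioo]|] := pselect (exists i, lebesgue_outer (A i) = +oo%E).
  rewrite (eseries_pinfty _ _ ioo) ?leey// => n _.
  by rewrite -ltNye (lt_le_trans _ (lebesgue_outer_ge0 _)).
rewrite -forallNE => Aoo.
apply/lee_addgt0Pr => e e0.
rewrite (le_trans _ (epsilon_trick _ _ (ltW e0)))//; last first.
  by move=> n; exact: lebesgue_outer_ge0.
pose P n (ab : nat -> (I -> R) * (I -> R)) :=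
  [/\ forall m i, (ab m).1 i <= (ab m).2 i,
        A n `<=` \bigcup_m box (ab m).1 (ab m).2 &
        (\sum_(0 <= m <oo) (vol (ab m).1 (ab m).2)%:E <=
           lebesgue_outer (A n) + (e / (2 ^ n.+1)%:R)%:E)%E].
have [G PG] : {G : nat -> nat -> (I -> R) * (I -> R) & forall n, P n (G n)}.
  apply: (@choice _ _ P) => n; apply: lebesgue_outer_adherent.
    by rewrite divr_gt0// ltr0n expn_gt0.
  by rewrite ltey; apply/eqP.
(* The covers of all the [A n] form one family indexed by pairs, enumerated along a bijection with
   [nat]; as the volumes are nonnegative, they may be summed in any order. *)
pose v (p : nat * nat) : \bar R := (vol (G p.1 p.2).1 (G p.1 p.2).2)%:E.
have v0 p : (0 <= v p)%E by rewrite lee_fin vol_ge0// => i; case: (PG p.1).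
apply: (@le_trans _ _ (\esum_(i in setT) v i)%E).
  have /card_esym/ppcard_eqP[f] := card_nat2.
  apply: (@le_trans _ _ (\sum_(0 <= m <oo) v (f m))%E).
    apply: lebesgue_outer_le_cover => [m i|t [i _]]; first by case: (PG (f m).1).
    case: (PG i) => _ + _ => /[apply] -[j _ Bijt].
    by exists (f^-1%FUN (i, j)) => //=; rewrite invK ?inE.
  rewrite nneseries_esumT//.
  by rewrite -(reindex_esum setT setT f)//.
rewrite (_ : esum _ _ = \sum_(i <oo) \sum_(j <oo) v (i, j))%E; last first.
  rewrite nneseries_esumT; last by move=> n; apply: nneseries_ge0.
  rewrite (eq_esum (b := fun i => (\esum_(j in setT) v (i, j))%E)); last first.
    by move=> i _; rewrite nneseries_esumT.
  rewrite esum_esum//; congr esum.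
  by rewrite predeqE => -[a b]; split.
apply: lee_nneseries => [i _ _|i _]; first exact: nneseries_ge0.
by case: (PG i).
Qed.

End Boxes.

(** * The volume of a box bounds its outer measure from below *)

Section LowerBound.
Variables (R : realType) (I : finType).
Implicit Types (a b x : I -> R).

Definition upd x i (t : R) : I -> R := fun j => if j == i then t else x j.

(* The indicator of [box a b], integrated over the coordinates in [s]. *)
Definition partial_vol (s : seq I) a b x : R :=
  \prod_j (if j \in s then b j - a j else \1_(`[a j, b j[) (x j)).

Lemma partial_vol_ge0 s a b x : (forall i, a i <= b i) -> 0 <= partial_vol s a b x.
Proof.
move=> ab; apply: prodr_ge0 => i _; case: ifP => _; first by rewrite subr_ge0.
by rewrite indicE ler0n.
Qed.

Lemma integral_partial_vol (s : seq I) a b x i : i \notin s -> a i <= b i ->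
  (forall i, a i <= b i) ->
  (\int[lebesgue_measure]_t (partial_vol s a b (upd x i t))%:E =
   (partial_vol (i :: s) a b x)%:E)%E.
Proof.
move=> si abi ab.
pose c := \prod_(j | j != i)
  (if j \in s then b j - a j else \1_(`[a j, b j[) (x j)) : R.
have c0 : 0 <= c.
  apply: prodr_ge0 => j _; case: ifP => _; first by rewrite subr_ge0.
  by rewrite indicE ler0n.
have -> : partial_vol (i :: s) a b x = c * (b i - a i).
  rewrite /partial_vol (bigD1 i)//= mem_head mulrC; congr (_ * _).
  by apply: eq_bigr => j ji; rewrite inE (negbTE ji).
under eq_integral => t _.
  have -> : partial_vol s a b (upd x i t) = c * \1_(`[a i, b i[) t.
    rewrite /partial_vol (bigD1 i)//= (negbTE si) mulrC /upd eqxx; congr (_ * _).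
    by apply: eq_bigr => j ji; rewrite (negbTE ji).
  rewrite EFinM.
  over.
rewrite ge0_integralZl_EFin//.
  rewrite integral_indic// setIT.
  transitivity (c%:E * (if (a i < b i)%R then (b i)%:E - (a i)%:E else 0))%E.
    by congr (_ * _)%E; have := @lebesgue_measure_itv R `[a i, b i[;
      rewrite /= lte_fin.
  case: ltP => ba; first by rewrite EFinM.
  have -> : b i = a i by apply: le_anti; rewrite ba.
  by rewrite subrr mulr0 mule0.
by apply/measurable_EFinP; exact: measurable_indic.
Qed.

Lemma measurable_partial_vol (s : seq I) a b x i :
  measurable_fun setT (fun t => (partial_vol s a b (upd x i t))%:E).
Proof.
apply/measurable_EFinP; apply: measurable_prod => j _.
case: (j \in s) => //; rewrite /upd; case: (j == i) => //.
exact: measurable_indic.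
Qed.

(** Fubini one coordinate at a time. Before any integration the claim compares indicators at the
    point [x]; integrating one more coordinate preserves it, by monotone convergence for the series.
    When all coordinates are integrated, both sides are volumes. *)
Lemma le_vol_series a b (a' b' : nat -> I -> R) : (forall i, a i <= b i) ->
  (forall m i, a' m i <= b' m i) ->
  box a b `<=` \bigcup_m box (a' m) (b' m) ->
  ((vol a b)%:E <= \sum_(0 <= m <oo) (vol (a' m) (b' m))%:E)%E.
Proof.
move=> ab ab' sub.
suff H s x : uniq s -> ((partial_vol s a b x)%:E <=
    \sum_(0 <= m <oo) (partial_vol s (a' m) (b' m) x)%:E)%E.
  have E u v : vol u v = partial_vol (enum I) u v a.
    by apply: eq_bigr => i _; rewrite mem_enum.
  rewrite E; under eq_eseriesr do rewrite E.
  by apply: H; exact: enum_uniq.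
elim: s x => [x _|i s IH x /= /andP[si us]].
  have E u v : partial_vol [::] u v x = \1_(box u v) x.
    rewrite /partial_vol indicE; case: (boolP (x \in box u v)) => [|xN].
      rewrite inE => xuv; apply: big1 => i _; rewrite indicE mem_set//=.
      by rewrite in_itv/=; exact: xuv.
    have /existsNP[i xi] : ~ box u v x by move=> xB; rewrite mem_set in xN.
    rewrite (bigD1 i)//= indicE memNset ?mul0r//= in_itv/=.
  under eq_eseriesr do rewrite E.
  rewrite E indicE; case: (boolP (x \in box a b)) => [|_]; last first.
    by apply: nneseries_ge0 => m _ _; rewrite lee_fin indicE ler0n.
  rewrite inE => /sub[m _ xm].
  apply: le_trans (nneseries_lim_ge m.+1 _); last first.
    by move=> ? _ _; rewrite lee_fin indicE ler0n.
  rewrite big_nat_recr//= indicE mem_set//= leeDr//.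
  by apply: sume_ge0 => ? _; rewrite lee_fin indicE ler0n.
rewrite -integral_partial_vol//.
under eq_eseriesr do rewrite -integral_partial_vol//.
rewrite -integral_nneseries//; last 2 first.
- by move=> m; exact: measurable_partial_vol.
- by move=> m t _; rewrite lee_fin partial_vol_ge0.
apply: ge0_le_integral => //.
- by move=> t _; rewrite lee_fin partial_vol_ge0.
- exact: measurable_partial_vol.
- apply: (ge0_emeasurable_sum (P := xpredT)) => [m t _ _|m _].
    by rewrite lee_fin partial_vol_ge0.
  exact: measurable_partial_vol.
- by move=> t _; exact: IH.
Qed.

End LowerBound.

(** * Caratheodory measurability of boxes; translations and shears *)

Section LebesgueMeasure.
Variables (R : realType) (I : finType) (i0 : I).
Implicit Types (a b x : I -> R) (A B : set (I -> R)).

(* The index keeps [I] nonempty: otherwise every box has volume 1 and the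
   outer measure of the empty set is not 0. *)
Definition leb (_ : I) A : \bar R := lebesgue_outer A.
Local Notation louter := (leb i0).

Lemma vol_cst0 : vol (fun _ : I => 0 : R) (fun=> 0) = 0.
Proof. by rewrite /vol (bigD1 i0)//= subrr mul0r. Qed.

Lemma louter_box_le a b : (forall i, a i <= b i) -> (louter (box a b) <= (vol a b)%:E)%E.
Proof.
move=> ab; pose c m : (I -> R) * (I -> R) := if m is 0%N then (a, b) else (fun=> 0, fun=> 0).
apply: (le_trans (@lebesgue_outer_le_cover _ _ _ (fun m => (c m).1) (fun m => (c m).2) _ _)).
- by case.
- by move=> x xab; exists 0%N.
rewrite nneseries_recl//; last first.
  by case=> [|m] _; rewrite lee_fin; [exact: (vol_ge0 ab)|rewrite /= vol_cst0].
rewrite eseries_cond eseries0 ?adde0// => -[//|m] _ _ /=; by rewrite vol_cst0.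
Qed.

Lemma louter0 : louter set0 = 0%E.
Proof.
apply/eqP; rewrite eq_le lebesgue_outer_ge0 andbT.
apply: (@le_trans _ _ (louter (box (fun _ : I => 0 : R) (fun=> 0)))).
  exact: le_lebesgue_outer.
by rewrite (le_trans (louter_box_le _))// vol_cst0.
Qed.

HB.instance Definition _ := isOuterMeasure.Build R (I -> R) (leb i0)
  louter0 (@lebesgue_outer_ge0 _ _) (@le_lebesgue_outer _ _)
  (@lebesgue_outer_sigma_subadditive _ _).

Lemma louter_box a b : (forall i, a i <= b i) -> louter (box a b) = (vol a b)%:E.
Proof.
move=> ab; apply/eqP; rewrite eq_le louter_box_le//=.
apply: le_ereal_inf_tmp => x [a' [b' [ab' sub ->]]].
exact: le_vol_series.
Qed.

Lemma vol_upd_split a b i (c : R) :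
  vol a (upd b i c) + vol (upd a i c) b = vol a b.
Proof.
rewrite /vol (bigD1 i)//= [X in _ + X](bigD1 i)//= [RHS](bigD1 i)//=.
rewrite /upd eqxx (eq_bigr (fun j => b j - a j)); last by move=> j /negbTE ->.
rewrite [X in _ + _ * X](eq_bigr (fun j => b j - a j)); last by move=> j /negbTE ->.
by rewrite -mulrDl; congr (_ * _); ring.
Qed.

(** The hyperplane cuts each box of an almost optimal cover of [X] into two boxes whose volumes add
    up, and the two families cover the two parts of [X]. *)
Lemma caratheodory_lt i (c : R) : louter.-caratheodory [set x | x i < c].
Proof.
apply: le_caratheodory_measurable => X.
have [Xoo|] := ltP (louter X) +oo%E; last first.
  by rewrite leye_eq => /eqP E; apply: le_trans (leey _) _; rewrite -E.
apply/lee_addgt0Pr => e e0.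
have [ab [le sub leX]] := lebesgue_outer_adherent e0 Xoo.
apply: le_trans _ leX.
(* The cut [c] is clamped to the side of the box, so that both pieces are boxes even when the
   hyperplane misses it. *)
pose c' m := Num.max ((ab m).1 i) (Num.min c ((ab m).2 i)).
have E m : (vol (ab m).1 (ab m).2)%:E = ((vol (ab m).1 (upd (ab m).2 i (c' m)))%:E
    + (vol (upd (ab m).1 i (c' m)) (ab m).2)%:E)%E.
  by rewrite -EFinD vol_upd_split.
have le1 m j : (ab m).1 j <= upd (ab m).2 i (c' m) j.
  by rewrite /upd; case: eqP => [->|_] //; rewrite /c' le_max lexx.
have le2 m j : upd (ab m).1 i (c' m) j <= (ab m).2 j.
  by rewrite /upd; case: eqP => [->|_] //; rewrite /c' ge_max le ge_min lexx orbT.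
under eq_eseriesr do rewrite E.
rewrite nneseriesD; last 2 first.
- by move=> m _ _; rewrite lee_fin vol_ge0.
- by move=> m _ _; rewrite lee_fin vol_ge0.
apply: leeD; apply: lebesgue_outer_le_cover => // x [Xx xc].
- have [m _ xm] := sub _ Xx; exists m => // j.
  have /andP[x1 x2] := xm j; rewrite x1 /= /upd; case: eqP => // ->.
  by rewrite /c' lt_max lt_min xc /=; have /andP[_ ->] := xm i; rewrite orbT.
- have [m _ xm] := sub _ Xx; exists m => // j.
  have /andP[x1 x2] := xm j; rewrite x2 andbT /upd; case: eqP => // ji.
  by rewrite /c' ge_max -ji x1 /= ge_min ji leNgt; move/negP: xc => ->.
Qed.

Lemma caratheodory_box a b : louter.-caratheodory (box a b).
Proof.
suff H (s : seq I) : louter.-caratheodory [set x | forall i, i \in s -> a i <= x i < b i].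
  rewrite (_ : box a b = [set x | forall i, i \in enum I -> a i <= x i < b i]) //.
  by apply/seteqP; split => x /= H' i; [move=> _|]; apply: H'; rewrite ?mem_enum.
elim: s => [|i s IH].
  rewrite (_ : [set _ | _] = ~` set0).
    exact/caratheodory_measurable_setC/caratheodory_measurable_set0.
  by rewrite setC0; apply/seteqP; split.
rewrite (_ : [set _ | _] = (~` [set x | x i < a i] `&` [set x | x i < b i])
    `&` [set x | forall i, i \in s -> a i <= x i < b i]).
  apply: caratheodory_measurable_setI => //; apply: caratheodory_measurable_setI.
    exact/caratheodory_measurable_setC/caratheodory_lt.
  exact: caratheodory_lt.
apply/seteqP; split => x /= H'.
  have /andP[h1 h2] := H' i (mem_head _ _); split; last first.
    by move=> j js; apply: H'; rewrite inE js orbT.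
  by split => //; apply/negP; rewrite -leNgt.
case: H' => -[/negP]; rewrite -leNgt => h1 h2 h3 j; rewrite inE => /orP[/eqP ->|/h3//].
by rewrite h1 h2.
Qed.

(** By countable subadditivity, a map that does not increase the measure of boxes does not increase
    the measure of any set. *)
Lemma louter_image_le (f : (I -> R) -> I -> R) :
  (forall a b, (forall i, a i <= b i) -> (louter (f @` box a b) <= (vol a b)%:E)%E) ->
  forall A, (louter (f @` A) <= louter A)%E.
Proof.
move=> H A.
have [Aoo|] := ltP (louter A) +oo%E; last first.
  by rewrite leye_eq => /eqP E; apply: le_trans (leey _) _; rewrite -E.
apply/lee_addgt0Pr => e e0.
have [ab [le sub leA]] := lebesgue_outer_adherent e0 Aoo.
apply: le_trans _ leA.
apply: (@le_trans _ _ (louter (\bigcup_m (f @` box (ab m).1 (ab m).2)))).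
  apply: le_outer_measure => _ [x Ax <-]; have [m _ xm] := sub _ Ax.
  by exists m => //; exists x.
apply: le_trans (outer_measure_sigma_subadditive _ _) _.
by apply: lee_nneseries => [m _ _|m _]; [exact: outer_measure_ge0|exact: H].
Qed.

Definition translate (c x : I -> R) : I -> R := fun i => c i + x i.

Lemma louter_translate_le c A : (louter (translate c @` A) <= louter A)%E.
Proof.
apply: louter_image_le => a b ab.
apply: (@le_trans _ _ (louter (box (translate c a) (translate c b)))).
  apply: le_outer_measure => _ [x xab <-] i.
  by rewrite /translate lerD2l ltrD2l.
rewrite louter_box; last by move=> i; rewrite lerD2l.
by rewrite lee_fin /vol le_eqVlt; apply/orP; left; apply/eqP; apply: eq_bigr => i _;
  rewrite /translate; ring.
Qed.

Definition shear (i j : I) (t : R) x : I -> R := upd x i (x i + t * x j).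

(** Cut the box into m + 1 slabs of width [h m] across axis [j]. On a slab the shift [t * x j]
    varies by at most [|t| * h m], so the sheared slab fits in a box widened by that amount at both
    ends of axis [i]. The total excess is of order 1 / (m + 1). *)
Lemma louter_shear_le i j t A : i != j -> (louter (shear i j t @` A) <= louter A)%E.
Proof.
move=> ij; apply: louter_image_le => a b ab.
pose rest := \prod_(l | (l != i) && (l != j)) (b l - a l).
have rest0 : 0 <= rest by apply: prodr_ge0 => l _; rewrite subr_ge0.
have volE : vol a b = (b i - a i) * (b j - a j) * rest.
  by rewrite /vol (bigD1 i)//= (bigD1 j)//= 1?eq_sym// mulrA.
pose h m : R := (b j - a j) / m.+1%:R.
have h0 m : 0 <= h m by rewrite divr_ge0// ?subr_ge0// ler0n.
have key m : (louter (shear i j t @` box a b) <=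
    (vol a b + 2 * `|t| * (b j - a j) ^+ 2 * rest / m.+1%:R)%:E)%E.
  pose c (p : nat) := a j + p%:R * h m.
  (* Box around the image of the slab whose lower end on axis [j] is [c p]. *)
  pose a' p := upd (upd a i (a i + t * c p - `|t| * h m)) j (c p).
  pose b' p := upd (upd b i (b i + t * c p + `|t| * h m)) j (c p + h m).
  pose F p := box (a' p) (b' p).
  have ab' p l : a' p l <= b' p l.
    rewrite /a' /b' /upd; case: eqP => _; first by rewrite lerDl.
    case: eqP => // _; have := ab i.
    by have : 0 <= `|t| * h m; [rewrite mulr_ge0|lra].
  have volF p : vol (a' p) (b' p) = (b i - a i + 2 * `|t| * h m) * h m * rest.
    rewrite /vol (bigD1 i)//= (bigD1 j)//= 1?eq_sym// mulrA.
    rewrite /a' /b' /upd !eqxx (negbTE ij); congr (_ * _); first by ring.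
    by apply: eq_bigr => l /andP[/negbTE -> /negbTE ->].
  apply: (@le_trans _ _ (\sum_(p < m.+1) louter (F p))%E).
    apply: (le_trans _ (outer_measure_subadditive louter F m.+1)).
    apply: le_outer_measure => _ [x xab <-].
    rewrite -bigcup_mkord.
    have /andP[xj1 xj2] := xab j; have /andP[xi1 xi2] := xab i.
    have hgt0 : 0 < h m by rewrite divr_gt0// ?ltr0n// subr_gt0 (le_lt_trans xj1).
    have mh : m.+1%:R * h m = b j - a j by rewrite mulrC divfK// pnatr_eq0.
    set q := (x j - a j) / h m.
    have qh : q * h m = x j - a j by rewrite divfK// gt_eqF.
    have q0 : 0 <= q by rewrite divr_ge0// ?subr_ge0// ltW.
    have /andP[p1 p2] := truncn_itv q0; set p := Num.truncn q in p1 p2.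
    have c1 : c p <= x j by rewrite /c -lerBrDl -qh ler_pM2r.
    have c2 : x j < c p + h m.
      rewrite /c -addrA -ltrBlDl -qh.
      by rewrite -[X in _ + X]mul1r -mulrDl natr1 ltr_pM2r.
    exists p.
      rewrite /= -(ltr_nat R); apply: le_lt_trans p1 _.
      by rewrite -(ltr_pM2r hgt0) mh qh ltrD2r.
    have tx : `|t * x j - t * c p| <= `|t| * h m.
      rewrite -mulrBr normrM ler_wpM2l// ger0_norm ?subr_ge0//.
      by rewrite lerBlDl ltW.
    move: tx; rewrite ler_norml => /andP[tx1 tx2].
    move=> l; rewrite /a' /b' /shear /upd.
    have [->|lj] := eqVneq l j; first by rewrite eq_sym (negbTE ij) c1.
    have [_|_] := eqVneq l i; last exact: xab.
    by apply/andP; split; lra.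
  under eq_bigr do rewrite louter_box// volF.
  have S (y : R) : \sum_(p < m.+1) y = m.+1%:R * y.
    by rewrite sumr_const card_ord mulr_natl.
  rewrite sumEFin lee_fin S volE /h.
  rewrite le_eqVlt; apply/orP; left; apply/eqP.
  have : m.+1%:R != 0 :> R by rewrite pnatr_eq0.
  by move: (m.+1%:R : R) => q q0; field.
apply/lee_addgt0Pr => e e0; set M := 2 * `|t| * (b j - a j) ^+ 2 * rest in key.
have M0 : 0 <= M by rewrite !mulr_ge0// subr_ge0.
(* Enough slabs for the excess M / (m + 1) to be at most e. *)
apply: (le_trans (key (Num.truncn (M / e)))).
rewrite -EFinD lee_fin lerD2l ler_pdivrMr ?ltr0n//.
rewrite -ler_pdivrMl// mulrC; apply: ltW.
by have /andP[] := truncn_itv (divr_ge0 M0 (ltW e0)).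
Qed.

End LebesgueMeasure.

(** * Affine maps of unipotent type; outer regularity *)

Section AffineShears.
Variables (R : realType) (I : finType) (i0 : I).
Implicit Types (a b x : I -> R) (A B : set (I -> R)).
Notation mu := (leb i0 : set (I -> R) -> \bar R).

Lemma louter_image_comp_le (f g : (I -> R) -> I -> R) :
  (forall A, (mu (f @` A) <= mu A)%E) -> (forall A, (mu (g @` A) <= mu A)%E) ->
  forall A, (mu ((f \o g) @` A) <= mu A)%E.
Proof. by move=> hf hg A; rewrite -image_comp; exact: le_trans (hf _) (hg _). Qed.

Definition affine (c : I -> R) (al : I -> I -> R) x : I -> R :=
  fun i => c i + (x i + \sum_j al i j * x j).

(** [T] marks the coordinates that change. They are fed by unmarked coordinates only, so adding the
    terms [al i j * x j] one pair at a time is a succession of shears: the value of [x j] that a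
    shear reads is still the original one. *)
Lemma louter_affine_le c al (T : pred I) :
  (forall i j, al i j != 0 -> T i /\ ~~ T j) ->
  forall A, (mu (affine c al @` A) <= mu A)%E.
Proof.
move=> alT.
pose P (s : seq (I * I)) x i := x i + \sum_(p <- s | p.1 == i) al i p.2 * x p.2.
have PT s x j : ~~ T j -> P s x j = x j.
  move=> Tj; rewrite /P big1 ?addr0// => p _.
  have [->|/alT[]] := eqVneq (al j p.2) 0; first by rewrite mul0r.
  by rewrite (negbTE Tj).
have H s A : (mu (P s @` A) <= mu A)%E.
  elim: s A => [|[i j] s IH] A.
    rewrite (_ : P [::] = id) ?image_id//.
    by apply/funext => x; apply/funext => i; rewrite /P big_nil addr0.
  have [al0|al0] := eqVneq (al i j) 0.
    rewrite (_ : P _ = P s) //.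
    apply/funext => x; apply/funext => l; rewrite /P big_cons/=.
    by case: eqP => // <-; rewrite al0 mul0r add0r.
  have [Ti Tj] := alT _ _ al0.
  rewrite (_ : P _ = shear i j (al i j) \o P s).
    apply: louter_image_comp_le => // B; apply: louter_shear_le.
    by apply: contraNneq Tj => <-.
  apply/funext => x; apply/funext => l; rewrite /= /shear (PT s x j)// /upd /P big_cons/=.
  rewrite (eq_sym l); case: eqP => // <-.
  by rewrite -addrA; congr (_ + _); rewrite addrC.
move=> A; rewrite (_ : affine c al = translate c \o P (enum {: I * I})).
  by apply: louter_image_comp_le => // B; exact: louter_translate_le.
apply/funext => x; apply/funext => i; rewrite /= /translate /affine /P.
congr (_ + (_ + _)); rewrite big_enum_cond/=.
rewrite (reindex_onto (fun j => (i, j)) snd) => [|[i' j] /eqP /= <-//].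
by apply: eq_bigl => j; rewrite /= !eqxx.
Qed.

Section Bijection.
Variables (f f' : (I -> R) -> I -> R).
Hypotheses (fK : cancel f f') (f'K : cancel f' f).
Hypothesis hf : forall A, (mu (f @` A) <= mu A)%E.
Hypothesis hf' : forall A, (mu (f' @` A) <= mu A)%E.

Lemma image_cancel A : f' @` (f @` A) = A.
Proof.
apply/seteqP; split => [_ [_ [x Ax <-] <-]|x Ax]; first by rewrite fK.
by exists (f x); [exists x|rewrite fK].
Qed.

Lemma louter_image_eq A : mu (f @` A) = mu A.
Proof.
by apply/eqP; rewrite eq_le hf/= -{1}(image_cancel A); exact: hf'.
Qed.

Lemma caratheodory_image A : mu.-caratheodory A -> mu.-caratheodory (f @` A).
Proof.
move=> mA X.
have fX : f @` (f' @` X) = X.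
  apply/seteqP; split => [_ [_ [x Ax <-] <-]|x Ax]; first by rewrite f'K.
  by exists (f' x); [exists x|rewrite f'K].
have inj : injective f by exact: can_inj fK.
have E B : f @` (f' @` X `&` B) = X `&` f @` B.
  by rewrite -[in RHS]fX; apply/seteqP; split => [_ [x [Xx Bx] <-]|
    _ [[x Xx <-] [y By /inj xy]]]; [split; exists x|exists x => //; split => //;
    rewrite -xy].
have CE : f @` (~` A) = ~` (f @` A).
  apply/seteqP; split => [_ [x Ax <-] [y Ay /inj xy]|x Ax]; first by apply: Ax; rewrite -xy.
  exists (f' x); rewrite ?f'K// => Afx; apply: Ax; exists (f' x) => //.
by rewrite -CE -!E !louter_image_eq -[in LHS]fX louter_image_eq; exact: mA.
Qed.

End Bijection.

(** Meant for the volume of a box whose sides are lengthened by [d]. Restricting to [d <= 1] absorbs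
    the quadratic terms of the induction into the linear one. *)
Lemma prod_add_le (l : I -> R) (s : seq I) : (forall i, 0 <= l i) ->
  exists2 C : R, 0 <= C & forall d, 0 <= d <= 1 ->
    \prod_(i <- s) (l i + d) <= \prod_(i <- s) l i + C * d.
Proof.
move=> l0; elim: s => [|i s [C C0 H]].
  by exists 0 => // d _; rewrite !big_nil mul0r addr0.
have P0 : 0 <= \prod_(j <- s) l j by apply: prodr_ge0.
exists (l i * C + \prod_(j <- s) l j + C) => [|d /[dup] d01 /andP[d0 d1]].
  by rewrite !addr_ge0// mulr_ge0.
rewrite !big_cons; have := H d d01; set P := \prod_(j <- s) l j in P0 *.
set Q := \prod_(j <- s) _ => QP.
apply: (@le_trans _ _ ((l i + d) * (P + C * d))).
  by rewrite ler_wpM2l// addr_ge0.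
have : C * d * d <= C * d by rewrite ler_piMr// mulr_ge0.
by rewrite mulrDl !mulrDr !mulrDl; lra.
Qed.

Definition open_boxes (ab : nat -> (I -> R) * (I -> R)) : set (I -> R) :=
  [set x | exists m, forall i, (ab m).1 i < x i < (ab m).2 i].

(** Half of [e] pays for an almost optimal cover by half-open boxes, the other half, split
    geometrically, for pushing the closed faces outwards. *)
Lemma louter_open_cover A (e : R) : 0 < e -> (mu A < +oo)%E ->
  exists ab : nat -> (I -> R) * (I -> R),
    A `<=` open_boxes ab /\ (mu (open_boxes ab) <= mu A + e%:E)%E.
Proof.
move=> e0 Aoo; have e20 : 0 < e / 2 by rewrite divr_gt0.
have [ab [le sub leA]] := lebesgue_outer_adherent e20 Aoo.
have D m : exists d : R, 0 < d /\
    vol (fun i => (ab m).1 i - d) (ab m).2 <=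
    vol (ab m).1 (ab m).2 + (e / 2) / (2 ^ m.+1)%:R.
  have l0 i : 0 <= (ab m).2 i - (ab m).1 i by rewrite subr_ge0.
  have [C C0 H] := prod_add_le (index_enum I) l0.
  have q0 : 0 < (e / 2) / (2 ^ m.+1)%:R by rewrite divr_gt0// ltr0n expn_gt0.
  (* [q] is the volume that may be added to box [m]: at most [C * d] is added, and [C + 1] keeps the
     denominator positive when [C] vanishes. *)
  set q := (e / 2) / _ in q0 *; set d := Num.min 1 (q / (C + 1)).
  have C1 : 0 < C + 1 by lra.
  have d0 : 0 < d by rewrite lt_min ltr01 divr_gt0.
  exists d; split => //; rewrite /vol.
  rewrite (eq_bigr (fun i => (ab m).2 i - (ab m).1 i + d)); last by move=> i _; ring.
  apply: le_trans (H d _) _; first by rewrite ltW//= ge_min lexx.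
  rewrite lerD2l; apply: (@le_trans _ _ ((C + 1) * d)).
    by rewrite ler_wpM2r ?(ltW d0)//; lra.
  by rewrite mulrC -ler_pdivlMr// ge_min lexx orbT.
have [d /all_and2[d0 dle]] := choice D.
exists (fun m => (fun i => (ab m).1 i - d m, (ab m).2)); split.
  move=> x /sub[m _ xm]; exists m => i /=; have /andP[x1 ->] := xm i.
  by rewrite andbT (lt_le_trans _ x1)// ltrBlDr ltrDl.
apply: (@le_trans _ _ (\sum_(0 <= m <oo)
   (vol (fun i => ((ab m).1 i - d m)%R) (ab m).2)%:E)%E).
  apply: lebesgue_outer_le_cover => [m i|x [m xm]].
    by rewrite lerBlDr (le_trans (le m i))// lerDl ltW.
  by exists m => // i; have /andP[/ltW -> ->] := xm i.
apply: (@le_trans _ _ (\sum_(0 <= m <oo) ((vol (ab m).1 (ab m).2)%:E +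
    ((e / 2) / (2 ^ m.+1)%:R)%:E))%E).
  apply: lee_nneseries => [m _ _|m _]; rewrite lee_fin//.
  by apply: vol_ge0 => i; rewrite lerBlDr (le_trans (le m i))// lerDl ltW.
apply: le_trans (epsilon_trick _ _ (ltW e20)) _ => [m|].
  by rewrite lee_fin vol_ge0.
apply: le_trans (leeD2r _ leA) _; rewrite -addeA -EFinD; apply: leeD => //.
by rewrite lee_fin; lra.
Qed.

End AffineShears.

(** * Densities in regular measure spaces *)

(* [Q x s] is a measurable substitute for the ball of center [x] and radius
   [s], with which it is comparable. *)
Record regular_measure (R : realType) (S : Type) (d : S -> S -> R)
    (mu : {outer_measure set S -> \bar R}) (Q : S -> R -> set S)
    (w c : R) (N : nat) : Prop := RegularMeasure {
  rm_d0 : forall x, d x x = 0;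
  rm_dC : forall x y, d x y = d y x;
  rm_dD : forall x y z, d x z <= d x y + d y z;
  rm_deq : forall x y, d x y = 0 -> x = y;
  rm_w : 0 < w;
  rm_c : 1 <= c;
  rm_Q0 : forall x, Q x 0 = set0;
  rm_mQ : forall x s, mu.-caratheodory (Q x s);
  rm_muQ : forall x s, 0 <= s -> mu (Q x s) = (w * s ^+ N)%:E;
  rm_ballQ : forall x y s, d x y < s -> Q x s y;
  rm_Qball : forall x y s, Q x s y -> d x y <= c * s;
  rm_open : forall A (e : R), 0 < e -> (mu A < +oo)%E -> exists O : set S,
    [/\ A `<=` O, (mu O <= mu A + e%:E)%E &
        forall x, O x -> exists2 s : R, 0 < s & forall y, d x y < s -> O y]
}.

(** * Vitali coverings, Lipschitz images, density and finite nets *)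

Section CoveringArguments.
Variables (R : realType) (S : Type) (d : S -> S -> R).
Variables (mu : {outer_measure set S -> \bar R}) (Q : S -> R -> set S).
Variables (w c : R) (N : nat) (o : S).
Hypothesis RM : regular_measure d mu Q w c N.

Let d0 := rm_d0 RM.
Let dC := rm_dC RM.
Let dD := rm_dD RM.
Let w0 := rm_w RM.
Let c1 := rm_c RM.
Let c0 : 0 < c := lt_le_trans ltr01 c1.

Lemma rm_d_ge0 x y : 0 <= d x y.
Proof. by have := dD x y x; rewrite d0 (dC y); lra. Qed.

Lemma series_disjoint_le (F : nat -> set S) O : (forall n, mu.-caratheodory (F n)) ->
  trivIset setT F -> (forall n, F n `<=` O) ->
  (\sum_(0 <= n <oo) mu (F n) <= mu O)%E.
Proof.
move=> mF tF FO; apply: le_trans (caratheodory_lime_le mF tF O).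
rewrite [X in (X <= _)%E](_ : _ = \sum_(0 <= n <oo) mu (O `&` F n))%E.
  by rewrite leeDl// outer_measure_ge0.
by apply: eq_eseriesr => n _; rewrite setIidr.
Qed.

Lemma sum_disjoint_le (F : nat -> set S) O m : (forall n, mu.-caratheodory (F n)) ->
  trivIset setT F -> (forall n, F n `<=` O) ->
  (\sum_(0 <= n < m) mu (F n) <= mu O)%E.
Proof.
move=> mF tF FO; apply: le_trans (series_disjoint_le mF tF FO).
by apply: nneseries_lim_ge => n _ _; exact: outer_measure_ge0.
Qed.

(** Greedy choice: among the points whose cell misses all the chosen cells, take one whose radius is
    at least half of every competing radius. As [mu O] is finite, a point cannot remain a candidate
    forever, since infinitely many disjoint cells of radius at least [s x / 2] would be chosen. So
    the cell of [x] meets some chosen cell with [s x <= 2 * t n], and then [x] is within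
    [3 * c * t n] of its center. *)
Lemma vitali_cover (A O : set S) (s : S -> R) : (mu O < +oo)%E ->
  (forall x, A x -> 0 < s x <= 1 /\ Q x (s x) `<=` O) ->
  exists (y : nat -> S) (t : nat -> R),
    [/\ forall n, 0 <= t n /\ (0 < t n -> A (y n) /\ t n = s (y n)),
        trivIset setT (fun n => Q (y n) (t n)),
        forall n, Q (y n) (t n) `<=` O &
        forall x, A x -> exists n, 0 < t n /\ d (y n) x < 4 * c * t n].
Proof.
move=> Ofin sA.
pose cand := fix cand (l : seq S) (x : S) : Prop :=
  if l is z :: l' then Q x (s x) `&` Q z (s z) = set0 /\ cand l' x else A x.
have candA l x : cand l x -> A x by elim: l => //= z l IH [_ /IH].
have next_ex l : exists p : option S,
    if p is Some x then cand l x /\ forall x', cand l x' -> s x' <= 2 * s x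
    else forall x, ~ cand l x.
  have [[x0 cx0]|nc] := pselect (exists x, cand l x); last first.
    by exists None => x cx; apply: nc; exists x.
  pose E := [set s x | x in cand l].
  have supE : has_sup E.
    split; first by exists (s x0), x0.
    by exists 1 => _ [x cx <-]; have [/andP[]] := sA _ (candA _ _ cx).
  have sup0 : 0 < sup E.
    have [/andP[s0 _] _] := sA _ (candA _ _ cx0).
    by apply: lt_le_trans s0 _; apply: ub_le_sup; [case: supE|exists x0].
  have [_ [x cx <-] xs] := sup_adherent (divr_gt0 sup0 (@ltr0n R 2)) supE.
  exists (Some x); split => // x' cx'.
  have : s x' <= sup E by apply: ub_le_sup; [case: supE|exists x'].
  by lra.
have [next nextP] := choice next_ex.
pose L n := iter n (fun l => if next l is Some x then x :: l else l) [::].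
(* If no candidate is left, the sequence is padded by cells of radius 0, which are empty. *)
pose y n := if next (L n) is Some x then x else o.
pose t n := if next (L n) is Some x then s x else 0.
have LS n : L n.+1 = if next (L n) is Some x then x :: L n else L n by [].
have cand_le m n x : (m <= n)%N -> cand (L n) x -> cand (L m) x.
  elim: n => [|n IH]; first by rewrite leqn0 => /eqP ->.
  rewrite leq_eqVlt => /orP[/eqP -> //|]; rewrite ltnS => /IH {}IH.
  by rewrite LS; case: (next _) => [z [_]|]; exact: IH.
have dis m n : (m < n)%N -> Q (y n) (t n) `&` Q (y m) (t m) = set0.
  move=> mn; rewrite /y /t.
  have := nextP (L n); case: (next (L n)) => [b [cb _]|_]; last first.
    by rewrite (rm_Q0 RM) set0I.
  have := cand_le _ _ _ mn cb; rewrite LS; case: (next (L m)) => [a []//|_].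
  by rewrite (rm_Q0 RM) setI0.
have tQ : trivIset setT (fun n => Q (y n) (t n)).
  apply/trivIsetP => i j _ _ ij; have [lt|lt|eq] := ltngtP i j.
  - by rewrite setIC; exact: dis.
  - exact: dis.
  - by rewrite eq eqxx in ij.
have QO n : Q (y n) (t n) `<=` O.
  rewrite /y /t; have := nextP (L n); case: (next (L n)) => [b [/candA cb _]|_].
    by have [] := sA _ cb.
  by rewrite (rm_Q0 RM).
have tP n : 0 <= t n /\ (0 < t n -> A (y n) /\ t n = s (y n)).
  rewrite /y /t; have := nextP (L n); case: (next (L n)) => [b [/candA cb _]|_].
    by split => //; have [/andP[/ltW]] := sA _ cb.
  by rewrite ltxx.
exists y, t; split => // x Ax.
have [/andP[sx0 _] _] := sA _ Ax.
have [all_cand|/existsNP[n0 nc0]] := pselect (forall n, cand (L n) x).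
  have tbig n : s x / 2 <= t n.
    rewrite /t; have := nextP (L n); case: (next (L n)) => [b [_ /(_ x (all_cand n))]|]; first by lra.
    by move=> /(_ x (all_cand n)).
  pose v := w * (s x / 2) ^+ N.
  have v0 : 0 < v by rewrite mulr_gt0// exprn_gt0// divr_gt0.
  (* [M] disjoint cells of measure at least [v] would exceed [mu O]. *)
  pose M := (Num.truncn (fine (mu O) / v)).+1.
  have fO : mu O \is a fin_num by rewrite ge0_fin_numE// outer_measure_ge0.
  have := sum_disjoint_le M (fun n => rm_mQ RM (y n) (t n)) tQ QO.
  rewrite leNgt => /negP; case.
  apply: (@lt_le_trans _ _ (\sum_(0 <= n < M) v%:E)%E); last first.
    apply: lee_sum => n _; rewrite (rm_muQ RM); last by case: (tP n).
    rewrite lee_fin /v ler_pM2l// lerXn2r// nnegrE; first by rewrite divr_ge0// ltW.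
    by case: (tP n).
  rewrite sumEFin -[X in (X < _)%E](fineK fO) lte_fin big_mkord sumr_const card_ord.
  rewrite -mulr_natl -ltr_pdivrMr//.
  exact: truncnS_gt.
have [n [cn cnS]] : exists n, cand (L n) x /\ ~ cand (L n.+1) x.
  elim: n0 nc0 => [nc|n IH nc]; first by case: nc.
  by have [cn|/IH//] := pselect (cand (L n) x); exists n.
exists n; have [tn0 _] := tP n.
move: cnS tn0; rewrite /t /y LS; have := nextP (L n).
case: (next (L n)) => [b [/candA cb /(_ x cn) le] nn _|//].
have [/andP[sb0 _] _] := sA _ cb; split => //.
have /eqP/set0P[z [zx zb]] : Q x (s x) `&` Q b (s b) <> set0 by move=> E0; apply: nn.
have := rm_Qball RM zx; have := rm_Qball RM zb; have := dD b z x; rewrite (dC z x).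
have : c * s x <= c * (2 * s b) by rewrite ler_pM2l.
have : 0 < c * s b by rewrite mulr_gt0.
by lra.
Qed.

Lemma open_radius (A O : set S) :
  (forall x, O x -> exists2 s : R, 0 < s & forall y, d x y < s -> O y) -> forall x, O x ->
  exists2 r : R, 0 < r <= 1 & forall s, s <= r -> Q x s `<=` O.
Proof.
move=> oO x /oO[s s0 sO]; exists (Num.min 1 (s / (2 * c))).
  by rewrite lt_min ltr01 ge_min lexx divr_gt0// mulr_gt0.
move=> s' s's y /(rm_Qball RM) xy; apply: sO; apply: le_lt_trans xy _.
have : s' <= s / (2 * c) by apply: le_trans s's _; rewrite ge_min lexx orbT.
rewrite ler_pdivlMr ?mulr_gt0// => H.
by lra.
Qed.

(** Apply the Vitali covering inside an open set barely larger than [A]. The points of [A] within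
    [4 * c * t] of a chosen center have their images in a cell of radius [8 * c * L * t], the 8
    leaving room for a strict inequality; the chosen cells being disjoint, their measures add up to
    at most that of the open set. *)
Lemma mu_lipschitz_image (f : S -> S) (A : set S) (L : R) : 0 < L ->
  (forall u v, A u -> A v -> d (f u) (f v) <= L * d u v) ->
  (mu (f @` A) <= ((8 * c * L) ^+ N)%:E * mu A)%E.
Proof.
move=> L0 fL.
have K0 : 0 < (8 * c * L) ^+ N by rewrite exprn_gt0// !mulr_gt0.
have [Aoo|] := ltP (mu A) +oo%E; last first.
  by rewrite leye_eq => /eqP ->; rewrite mulry gtr0_sg// mul1e leey.
apply/lee_addgt0Pr => e e0.
have ep : 0 < e / (8 * c * L) ^+ N by rewrite divr_gt0.
have [ O [AO OA oO]] := rm_open RM ep Aoo.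
have Ofin : (mu O < +oo)%E.
  by apply: le_lt_trans OA _; rewrite lte_add_pinfty// ltry.
have rad x : exists r, A x -> 0 < r <= 1 /\ Q x r `<=` O.
  have [Ax|] := pselect (A x); last by exists 0.
  by have [r r01 rO] := open_radius A oO (AO _ Ax); exists r => _; split => //; exact: rO.
have [s sP] := choice rad.
have [y [t [tP tQ QO cov]]] := vitali_cover Ofin sP.
apply: (@le_trans _ _ (\sum_(0 <= n <oo) mu (Q (f (y n)) (8 * c * L * t n)))%E).
  apply: (le_trans _ (outer_measure_sigma_subadditive mu _)).
  apply: le_outer_measure => _ [x Ax <-]; have [n [tn0 yx]] := cov _ Ax.
  exists n => //; apply: (rm_ballQ RM); have [_ /(_ tn0)[Ay _]] := tP n.
  apply: le_lt_trans (fL _ _ Ay Ax) _.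
  apply: (@lt_le_trans _ _ (L * (4 * c * t n))); first by rewrite ltr_pM2l.
  have : 0 < c * L * t n by rewrite !mulr_gt0.
  by lra.
rewrite [X in (X <= _)%E](_ : _ =
    (((8 * c * L) ^+ N)%:E * \sum_(0 <= n <oo) mu (Q (y n) (t n)))%E); last first.
  rewrite -nneseriesZl; last by move=> n _; exact: outer_measure_ge0.
  apply: eq_eseriesr => n _; have [tn0 _] := tP n.
  by rewrite !(rm_muQ RM)// ?mulr_ge0// ?ltW// -EFinM exprMn mulrCA.
apply: (@le_trans _ _ (((8 * c * L) ^+ N)%:E * (mu A + (e / (8 * c * L) ^+ N)%:E))%E).
  apply: lee_wpmul2l; first by rewrite lee_fin ltW.
  apply: le_trans _ OA.
  by apply: series_disjoint_le => // n; exact: rm_mQ RM _ _.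
rewrite ge0_muleDr ?outer_measure_ge0// ?lee_fin; last exact: ltW.
by rewrite -EFinM [_ * (e / _)]mulrC divfK// lt0r_neq0.
Qed.

(** Suppose [A] has positive measure. Disjoint thin cells chosen in an open set [O] containing [A]
    have total measure at least [mu A / K], and [A] misses a proportion [eps] of each. Hence [O]
    exceeds [A] by at least [eps * mu A / K], which is impossible for an [O] close enough to [A]. *)
Lemma density_null (A : set S) (eps : R) : (mu A < +oo)%E -> 0 < eps <= 1 ->
  (forall x, A x -> forall e, 0 < e ->
    exists s, 0 < s < e /\ (mu (A `&` Q x s) <= ((1 - eps) * (w * s ^+ N))%:E)%E) ->
  mu A = 0%E.
Proof.
move=> Aoo /andP[eps0 eps1] thin.
have fA : mu A \is a fin_num by rewrite ge0_fin_numE// outer_measure_ge0.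
set a := fine (mu A); have aE : mu A = a%:E by rewrite fineK.
have a0 : 0 <= a by rewrite fine_ge0// outer_measure_ge0.
rewrite aE; congr EFin; apply: le_anti; rewrite a0 andbT leNgt; apply/negP => {}a0.
pose K := (8 * c) ^+ N; have K0 : 0 < K by rewrite exprn_gt0// mulr_gt0.
(* Half of the excess that the thin cells impose. *)
pose e := eps * a / (2 * K); have e0 : 0 < e by rewrite !divr_gt0 ?mulr_gt0.
have [ O [AO OA oO]] := rm_open RM e0 Aoo.
have Ofin : (mu O < +oo)%E.
  by apply: le_lt_trans OA _; rewrite lte_add_pinfty// ltry.
have fO : mu O \is a fin_num by rewrite ge0_fin_numE// outer_measure_ge0.
have rad x : exists r, A x -> [/\ 0 < r <= 1, Q x r `<=` O &
    (mu (A `&` Q x r) <= ((1 - eps) * (w * r ^+ N))%:E)%E].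
  have [Ax|] := pselect (A x); last by exists 0.
  have [r /andP[r0 r1] rO] := open_radius A oO (AO _ Ax).
  have [s [/andP[s0 sr] sthin]] := thin _ Ax _ r0.
  exists s => _; split => //; last by apply: rO; exact: ltW.
  by rewrite s0 (le_trans (ltW sr)).
have [s sP] := choice rad.
have sP' x : A x -> 0 < s x <= 1 /\ Q x (s x) `<=` O by move=> /sP[].
have [y [t [tP tQ QO cov]]] := vitali_cover Ofin sP'.
have mQ n : mu.-caratheodory (Q (y n) (t n)) by exact: rm_mQ RM _ _.
pose U := \bigcup_n Q (y n) (t n).
have mU : mu.-caratheodory U by exact: caratheodory_measurable_bigcup.
have UO : U `<=` O by move=> z [n _]; exact: QO.
pose sg := (\sum_(0 <= n <oo) mu (Q (y n) (t n)))%E.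
have sgU : (sg <= mu U)%E.
  by apply: series_disjoint_le => // n z zn; exists n.
have sg0 : (0 <= sg)%E by apply: nneseries_ge0 => n _ _; exact: outer_measure_ge0.
have fsg : sg \is a fin_num.
  rewrite ge0_fin_numE//; apply: le_lt_trans Ofin.
  by apply: le_trans sgU _; exact: le_outer_measure.
have h1 : (mu (A `&` U) <= (1 - eps)%:E * sg)%E.
  rewrite setI_bigcupr -nneseriesZl; last by move=> n _; exact: outer_measure_ge0.
  apply: le_trans (outer_measure_sigma_subadditive mu _) _.
  apply: lee_nneseries => [n _ _|n _]; first exact: outer_measure_ge0.
  have [tn0 tA] := tP n; rewrite (rm_muQ RM)// -EFinM.
  move: tn0; rewrite le_eqVlt => /orP[/eqP t0|/tA[/sP[_ _ h] ->]] //.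
  rewrite -t0 (rm_Q0 RM) setI0 outer_measure0 lee_fin mulr_ge0// ?subr_ge0//.
  by rewrite mulr_ge0 ?exprn_ge0// ltW.
have h2 : (mu A <= mu (A `&` U) + mu (O `\` U))%E.
  rewrite [X in (X <= _)%E]mU; apply: leeD => //.
  by apply: le_outer_measure => z [/AO].
have h3 : mu O = (mu U + mu (O `\` U))%E.
  by rewrite [LHS]mU -setDE setIidr.
have h4 : (mu A <= K%:E * sg)%E.
  rewrite -nneseriesZl; last by move=> n _; exact: outer_measure_ge0.
  apply: (@le_trans _ _ (\sum_(0 <= n <oo) mu (Q (y n) (8 * c * t n)))%E).
    apply: (le_trans _ (outer_measure_sigma_subadditive mu _)).
    apply: le_outer_measure => x Ax; have [n [tn0 yx]] := cov _ Ax.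
    exists n => //; apply: (rm_ballQ RM); apply: lt_le_trans yx _.
    have : 0 < c * t n by rewrite mulr_gt0.
    by lra.
  apply: lee_nneseries => [n _ _|n _]; first exact: outer_measure_ge0.
  have [tn0 _] := tP n.
  have ct0 : 0 <= 8 * c * t n by rewrite !mulr_ge0// ltW.
  by rewrite !(rm_muQ RM)// -EFinM exprMn mulrCA.
have fU : mu U \is a fin_num.
  by rewrite ge0_fin_numE ?outer_measure_ge0//; apply: le_lt_trans Ofin; exact: le_outer_measure.
have fOU : mu (O `\` U) \is a fin_num.
  by rewrite ge0_fin_numE ?outer_measure_ge0//; apply: le_lt_trans Ofin; apply: le_outer_measure => z [].
have fAU : mu (A `&` U) \is a fin_num.
  by rewrite ge0_fin_numE ?outer_measure_ge0//; apply: le_lt_trans Aoo; apply: le_outer_measure => z [].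
move: h1 h2 h3 h4 OA sgU; rewrite aE.
rewrite -(fineK fO) -(fineK fU) -(fineK fOU) -(fineK fAU) -(fineK fsg).
rewrite -!EFinM -!EFinD !lee_fin => h1 h2 [h3] h4 OA sgU.
have : eps * fine sg <= e by lra.
have : K * (eps * fine sg) >= eps * a.
  by rewrite mulrCA ler_pM2l.
have : K * e = eps * a / 2 by rewrite /e; field; exact/lt0r_neq0.
have : 0 < eps * a by rewrite mulr_gt0.
move=> p1 p2 p3 p4.
have : K * (eps * fine sg) <= K * e by rewrite ler_pM2l.
by lra.
Qed.

(** Otherwise there are [r]-separated families of any size in the ball. Their cells of radius
    [r / (3 * c)] are disjoint and contained in [Q o (M + r)], which bounds their number. *)
Lemma finite_net (M r : R) : 0 <= M -> 0 < r -> exists (m : nat) (z : nat -> S),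
  (forall i, (i < m)%N -> d o (z i) <= M) /\
  forall x, d o x <= M -> exists i, (i < m)%N /\ d (z i) x < r.
Proof.
move=> M0 r0; apply: contrapT => nonet.
pose sep m (z : nat -> S) := (forall i, (i < m)%N -> d o (z i) <= M) /\
  (forall i j, (i < j < m)%N -> r <= d (z i) (z j)).
have sepE m : exists z, sep m z.
  elim: m => [|m [z [zM zr]]]; first by exists (fun=> o); split=> // i j; rewrite ltn0 andbF.
  have /existsNP[x nx] : ~ forall x, d o x <= M -> exists i, (i < m)%N /\ d (z i) x < r.
    by move=> H; apply: nonet; exists m, z.
  have /not_implyP[xM far] := nx.
  exists (fun i => if (i < m)%N then z i else x); split.
    by move=> i _; case: ifP => // im; exact: zM.
  move=> i j /andP[ij]; rewrite ltnS leq_eqVlt => /orP[/eqP jm|jm].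
    rewrite jm ltnn; rewrite jm in ij; rewrite ij leNgt; apply/negP => lt.
    by apply: far; exists i.
  by rewrite jm (ltn_trans ij jm) zr// ij.
pose q := r / (3 * c); have q0 : 0 < q by rewrite divr_gt0// mulr_gt0.
have qc : c * q = r / 3 by rewrite /q; field; exact/lt0r_neq0.
pose v := w * q ^+ N; have v0 : 0 < v by rewrite mulr_gt0// exprn_gt0.
pose V := w * (M + r) ^+ N.
pose m := (Num.truncn (V / v)).+1.
have [z [zM zr]] := sepE m.
pose F n := Q (z n) (if (n < m)%N then q else 0).
have mF n : mu.-caratheodory (F n) by exact: rm_mQ RM _ _.
have tF : trivIset setT F.
  have D i j : (i < j)%N -> F i `&` F j = set0.
    move=> ij; rewrite /F; case: ifPn => im; last by rewrite (rm_Q0 RM) set0I.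
    case: ifPn => jm; last by rewrite (rm_Q0 RM) setI0.
    rewrite -subset0 => u [/(rm_Qball RM) h1 /(rm_Qball RM) h2].
    have := zr i j; rewrite ij jm => /(_ isT).
    by have := dD (z i) u (z j); rewrite (dC u); lra.
  apply/trivIsetP => i j _ _ ij; have [lt|lt|eq] := ltngtP i j.
  - exact: D.
  - by rewrite setIC; exact: D.
  - by rewrite eq eqxx in ij.
have FO n : F n `<=` Q o (M + r).
  rewrite /F; case: ifPn => nm; last by rewrite (rm_Q0 RM).
  move=> u /(rm_Qball RM) h; apply: (rm_ballQ RM).
  by have := dD o (z n) u; have := zM n nm; lra.
have := sum_disjoint_le m mF tF FO.
rewrite leNgt => /negP; case.
rewrite (rm_muQ RM); last by lra.
rewrite big_mkord (eq_bigr (fun=> v%:E)); last first.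
  by move=> i _; rewrite /F ltn_ord (rm_muQ RM)// ltW.
rewrite sumEFin lte_fin sumr_const card_ord -mulr_natl -ltr_pdivrMr//.
exact: truncnS_gt.
Qed.

End CoveringArguments.

(** * Conformal dynamics *)

Section ConformalDynamics.
Variables (R : realType) (S : Type) (d : S -> S -> R).
Variables (mu : {outer_measure set S -> \bar R}) (Q : S -> R -> set S).
Variables (w c : R) (N : nat) (o : S).
Hypothesis RM : regular_measure d mu Q w c N.
Hypothesis N0 : (0 < N)%N.

(* The chordal convention d(u, infinity) = 1 makes every Moebius map conformal
   on the whole of the compactification. *)
Definition dh (p q : option S) : R :=
  match p, q with
  | Some u, Some v => d u v
  | None, None => 0
  | _, _ => 1
  end.

Variables (Ga : Type) (G : set Ga) (mul : Ga -> Ga -> Ga) (inv : Ga -> Ga).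
Variables (act : Ga -> option S -> option S) (lam : Ga -> option S -> R).
Variable enumG : nat -> Ga.
Hypothesis GM : forall g h, G g -> G h -> G (mul g h).
Hypothesis GV : forall g, G g -> G (inv g).
Hypothesis actM : forall g h p, G g -> G h -> act (mul g h) p = act g (act h p).
Hypothesis actK : forall g p, G g -> act (inv g) (act g p) = p.
Hypothesis actVK : forall g p, G g -> act g (act (inv g) p) = p.
Hypothesis lam_gt0 : forall g p, G g -> 0 < lam g p.
(** [lam g p] is thus the square root of the conformal factor of [g] at [p]; the convention on [dh]
    lets the same rule hold at infinity and at poles. *)
Hypothesis lamP : forall g p q, G g ->
  dh (act g p) (act g q) = lam g p * lam g q * dh p q.
Hypothesis enumGP : forall g, G g -> exists n, enumG n = g.
Hypothesis stab_lam : forall g p, G g -> act g None = None -> lam g p = 1.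
Hypothesis far : forall h, exists q, d h q = 10.
(** With the enumeration of [G], this is the form that discreteness takes here: the elements that
    keep the unit ball within a bounded distance, without contracting it too much, will turn out to
    be finitely many. *)
Hypothesis bounded_lam : forall L : R, 0 < L -> exists C : R, forall g, G g ->
  (forall u, d o u <= 1 -> exists u',
    [/\ act g (Some u) = Some u', d o u' <= L & L^-1 <= lam g (Some u)]) ->
  lam g None <= C.

Variables (Z : set Ga) (iota : Ga) (K : set S) (rho : R) (T : S -> S).
Hypothesis ZG : Z `<=` G.
Hypothesis ZM : forall a b, Z a -> Z b -> Z (mul a b).
Hypothesis ZV : forall a, Z a -> Z (inv a).
Hypothesis Zoo : forall a, Z a -> act a None = None.
Hypothesis Giota : G iota.
Hypothesis iota_o : act iota (Some o) = None.
Hypothesis iota_oo : act iota None = Some o.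
Hypothesis lam_iota : lam iota None = 1.
Hypothesis rho01 : 0 < rho < 1.
Hypothesis Krho : forall x, K x -> d o x <= rho.
Hypothesis Zcover : forall x, exists a x',
  [/\ Z a, K x' & act a (Some x') = Some x].
Hypothesis TP : forall x, K x -> x <> o ->
  K (T x) /\ exists2 a, Z a & act a (Some (T x)) = act iota (Some x).

Let dd0 := rm_d0 RM.
Let dC := rm_dC RM.
Let dD := rm_dD RM.
Let deq := rm_deq RM.
Let d_ge0 := rm_d_ge0 RM.
Let w0 := rm_w RM.
Let c1 := rm_c RM.
Let c0 : 0 < c := lt_le_trans ltr01 c1.

Lemma d_gt0 x y : x <> y -> 0 < d x y.
Proof. by move=> xy; rewrite lt_neqAle d_ge0 andbT eq_sym; apply/eqP => /deq. Qed.

Lemma act_inj g p q : G g -> act g p = act g q -> p = q.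
Proof. by move=> Gg E; rewrite -(actK p Gg) E actK. Qed.

Lemma act_finite g h u : G g -> act g (Some h) = None -> u <> h ->
  exists u', act g (Some u) = Some u'.
Proof.
move=> Gg gh uh; case E : (act g (Some u)) => [u'|]; first by exists u'.
by move: E; rewrite -gh => /(act_inj Gg) [].
Qed.

Lemma pole_noo g h : G g -> act g (Some h) = None -> act g None <> None.
Proof. by move=> Gg gh goo; have := act_inj Gg (etrans goo (esym gh)). Qed.

Lemma pole_ex g : G g -> act g None <> None -> exists h, act g (Some h) = None.
Proof.
move=> Gg goo; case E : (act (inv g) None) => [h|].
  by exists h; rewrite -E actVK.
by case: goo; rewrite -[X in act g X]E actVK.
Qed.

(** For three distinct points p, q, s, the square of L(p) is the product of the values of the pairs
    pq and ps divided by that of qs. The points [o] and infinity together with one given by [far]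
    always provide the two companions of p. This uniqueness yields the cocycle rules for [lam]. *)
Lemma lam_uniq (L1 L2 : option S -> R) : (forall p, 0 < L1 p) -> (forall p, 0 < L2 p) ->
  (forall p q, L1 p * L1 q * dh p q = L2 p * L2 q * dh p q) -> forall p, L1 p = L2 p.
Proof.
move=> p1 p2 E; have [e oe10] := far o.
have oe0 : d o e != 0 by rewrite oe10.
have E3 p q s : dh p q != 0 -> dh p s != 0 -> dh q s != 0 -> L1 p = L2 p.
  move=> pq ps qs.
  have Epq := mulIf pq (E p q); have Eps := mulIf ps (E p s).
  have Eqs := mulIf qs (E q s).
  have E2 : L1 p ^+ 2 = L2 p ^+ 2.
    apply: (@mulIf _ (L1 q * L1 s)); first by rewrite gt_eqF// mulr_gt0.
    rewrite {2}Eqs; transitivity ((L1 p * L1 q) * (L1 p * L1 s)); first by ring.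
    by rewrite Epq Eps; ring.
  by apply/eqP; rewrite -(eqrXn2 (n := 2))// ?ltW// E2.
have oe : o <> e by move=> oe; move: oe0; rewrite -oe dd0 eqxx.
case=> [u|]; last by apply: (@E3 None (Some o) (Some e)); rewrite /= ?oner_neq0.
have [->|uo] := pselect (u = o).
  by apply: (@E3 (Some o) (Some e) None); rewrite /= ?oner_neq0.
apply: (@E3 (Some u) (Some o) None); rewrite /= ?oner_neq0//.
by rewrite gt_eqF// d_gt0.
Qed.

Lemma lamM g h p : G g -> G h -> lam (mul g h) p = lam g (act h p) * lam h p.
Proof.
move=> Gg Gh; have Ggh := GM Gg Gh.
apply: (lam_uniq (L1 := lam (mul g h)) (L2 := fun p => lam g (act h p) * lam h p)).
- by move=> q; exact: lam_gt0.
- by move=> q; rewrite mulr_gt0 ?lam_gt0.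
move=> q s; rewrite -(lamP q s Ggh) !actM// (lamP _ _ Gg) (lamP _ _ Gh).
by ring.
Qed.

Lemma lamV g p : G g -> lam (inv g) (act g p) = (lam g p)^-1.
Proof.
move=> Gg; have GVg := GV Gg.
have : lam (mul (inv g) g) p = 1.
  apply: (lam_uniq (L1 := lam (mul (inv g) g)) (L2 := fun=> 1)) => //.
    by move=> q; apply: lam_gt0; exact: GM.
  move=> q s; rewrite -(lamP q s (GM GVg Gg)) !actM// !actK//.
  by rewrite !mul1r.
rewrite lamM// => /(congr1 (fun x => x * (lam g p)^-1)).
by rewrite mulfK ?mul1r// gt_eqF// lam_gt0.
Qed.

(** As g h is infinity, both g u and g(infinity) are at distance 1 from it. Comparing the two
    instances of [lamP] and cancelling [lam g (Some h)] shows that [lam g None] is the radius of the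
    isometric sphere of [g], centered at the pole [h]. *)
Lemma lam_pole g h u : G g -> act g (Some h) = None -> lam g (Some u) * d u h = lam g None \/ u = h.
Proof.
move=> Gg gh; have [->|uh] := pselect (u = h); [by right|left].
have [u' gu] := act_finite Gg gh uh.
have hoo := pole_noo Gg gh.
have := lamP (Some u) (Some h) Gg; rewrite gu gh /=.
have := lamP None (Some h) Gg; rewrite gh /=.
case: (act g None) hoo => // y _ /=.
have := lam_gt0 (Some h) Gg; move: (lam g (Some h)) => t t0.
rewrite mulr1 => E1 E2; apply: (@mulIf _ t); first by rewrite gt_eqF.
by rewrite -E1 E2; ring.
Qed.

Lemma lam_finite g h u : G g -> act g (Some h) = None -> u <> h ->
  lam g (Some u) = lam g None / d u h.
Proof.
move=> Gg gh uh; have [<-|//] := lam_pole u Gg gh.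
by rewrite mulfK// gt_eqF// d_gt0.
Qed.

Lemma lam_pole_inv g h : G g -> act g (Some h) = None -> lam g (Some h) = (lam g None)^-1.
Proof.
move=> Gg gh.
have hoo := pole_noo Gg gh.
have := lamP None (Some h) Gg; rewrite gh /=.
case: (act g None) hoo => // y _ /=; rewrite mulr1 => E.
have l0 := lam_gt0 None Gg.
by apply: (@mulfI _ (lam g None)); rewrite ?gt_eqF// -E mulfV// gt_eqF.
Qed.

Lemma lamZ a p : Z a -> lam a p = 1.
Proof. by move=> Za; apply: stab_lam; [exact: ZG|exact: Zoo]. Qed.

Lemma d_act g u v u' v' : G g -> act g (Some u) = Some u' -> act g (Some v) = Some v' ->
  d u' v' = lam g (Some u) * lam g (Some v) * d u v.
Proof. by move=> Gg gu gv; have := lamP (Some u) (Some v) Gg; rewrite gu gv. Qed.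

Lemma d_act_oo g u u' y : G g -> act g (Some u) = Some u' -> act g None = Some y ->
  d u' y = lam g (Some u) * lam g None.
Proof. by move=> Gg gu gv; have := lamP (Some u) None Gg; rewrite gu gv /= mulr1. Qed.

Lemma d_actZ a u v u' v' : Z a -> act a (Some u) = Some u' -> act a (Some v) = Some v' ->
  d u' v' = d u v.
Proof. by move=> Za au av; rewrite (d_act (ZG Za) au av) !lamZ// !mul1r. Qed.

Lemma actV_eq g p q : G g -> act g p = q -> act (inv g) q = p.
Proof. by move=> Gg <-; rewrite actK. Qed.

Lemma actZ_finite a u : Z a -> exists u', act a (Some u) = Some u'.
Proof.
move=> Za; case E : (act a (Some u)) => [u'|]; first by exists u'.
by move: E; rewrite -(Zoo Za) => /(act_inj (ZG Za)).
Qed.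

(* Conjugating a bounded element z of the lattice by g yields an element whose
   derivative at g(infinity) is 1 and whose radius is about (lam g oo)^2: if
   that is large, the conjugate is nearly isometric near the origin. *)
Lemma radius_bounded : exists2 C : R, 0 < C & forall g, G g -> act g None <> None ->
  lam g None <= C.
Proof.
have [rho0 rho1] := andP rho01.
(* A generous value: if its radius exceeds 40, the conjugate below sends the unit ball within
   distance 5 of [o], with factors at least 40 / 42. *)
have [C0 HC0] := @bounded_lam 20 (@ltr0n R 20).
(* The conjugate has radius rf at most 40 + |C0|, and r^2 <= 12 rf; the 1 covers the case r <= 1. *)
pose C := 1 + 12 * (40 + `|C0|).
have C1 : 1 <= C by rewrite lerDl mulr_ge0// addr_ge0.
exists C => [|g0 Gg0 goo0]; first exact: lt_le_trans C1.
have [p0 g0oo] : exists p0, act g0 None = Some p0 by case: (act g0 None) goo0 => // p0; exists p0.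
(* Composing with the lattice brings g(infinity) into [K] and keeps the radius. *)
have [a [p [Za Kp ap]]] := Zcover p0; have GZa := ZG Za.
have GVa := GV GZa; have ZVa := ZV Za.
pose g := mul (inv a) g0.
have Gg : G g by exact: GM.
have goo : act g None = Some p by rewrite actM// g0oo; exact: actV_eq.
have <- : lam g None = lam g0 None by rewrite lamM// lamZ// mul1r.
set r := lam g None; have r0 : 0 < r by exact: lam_gt0.
have [h gh] : exists h, act g (Some h) = None by apply: pole_ex => //; rewrite goo.
(* A lattice element that moves [h] by a definite but bounded amount: it carries [h] to the tile of
   a point at distance 10, and two points of a tile are at distance at most 2. *)
have [q hq] := far h.
have [b [k' [Zb Kk' bq]]] := Zcover q; have [b' [k'' [Zb' Kk'' bh]]] := Zcover h.
have [h' bh'] := actZ_finite k'' Zb.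
pose z := mul b (inv b').
have Zz : Z z by apply: ZM => //; exact: ZV.
have GZb := ZG Zb; have GZb' := ZG Zb'; have GVb' := GV GZb'.
have zh : act z (Some h) = Some h' by rewrite actM// (actV_eq _ bh).
have h'q : d h' q <= 2.
  rewrite (d_actZ Zb bh' bq); apply: le_trans (dD _ o _) _.
  by have := Krho Kk'; have := Krho Kk''; rewrite (dC k''); lra.
have hh'1 : 8 <= d h' h by have := dD h h' q; rewrite (dC h h'); lra.
have hh'2 : d h' h <= 12 by have := dD h' q h; rewrite (dC q h); lra.
have h'h : h' <> h by move=> E; move: hh'1; rewrite E dd0; lra.
pose f := mul g (mul z (inv g)).
have GVg := GV Gg; have Gz := ZG Zz; have Gzg := GM Gz GVg; have Gf : G f by exact: GM.
have fE u : act f u = act g (act z (act (inv g) u)).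
  by rewrite (actM _ Gg Gzg) (actM _ Gz GVg).
have flam u : lam f u = lam g (act z (act (inv g) u)) * lam (inv g) u.
  by rewrite (lamM _ Gg Gzg) (lamM _ Gz GVg) (lamZ _ Zz) mul1r actM.
have fp : act f (Some p) = Some p by rewrite fE (actV_eq Gg goo) Zoo.
have flamp : lam f (Some p) = 1.
  rewrite flam (actV_eq Gg goo) Zoo//= -goo lamV//.
  by rewrite mulfV// gt_eqF.
have foo : lam f None = r ^+ 2 / d h' h.
  rewrite flam (actV_eq Gg gh) zh (lam_finite Gg gh h'h) -[X in lam (inv g) X]gh.
  by rewrite lamV// (lam_pole_inv Gg gh) invrK -/r expr2 mulrAC.
have foo' : act f None <> None.
  rewrite fE (actV_eq Gg gh) zh; by have [? ->] := act_finite Gg gh h'h.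
set rf := lam f None in foo.
have rf12 : r ^+ 2 <= 12 * rf.
  have -> : r ^+ 2 = d h' h * rf by rewrite foo mulrC divfK// gt_eqF// d_gt0.
  by rewrite ler_pM2r// lam_gt0.
suff : rf <= 40 + `|C0|.
  move=> rfC; have [r1|r1] := leP r 1; first exact: le_trans C1.
  have : r <= r ^+ 2 by rewrite expr2 ler_peMr// ltW.
  by rewrite /C; lra.
have [rf40|rf40] := leP rf 40; first by have := normr_ge0 C0; lra.
have [hf fhf] := pole_ex Gf foo'.
have phf : p <> hf by move=> E; move: fp; rewrite E fhf.
have dphf : d p hf = rf.
  by have [|] := lam_pole p Gf fhf; [rewrite flamp mul1r|].
suff : rf <= C0 by have := ler_norm C0; lra.
apply: HC0 => // u ou.
have pu : d p u <= 2.
  by have := dD p o u; have := Krho Kp; rewrite (dC p o); lra.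
have uhf1 : rf - 2 <= d u hf by have := dD p u hf; lra.
have uhf2 : d u hf <= rf + 2 by have := dD u p hf; rewrite (dC u p); lra.
have uhf : u <> hf by move=> E; move: uhf1; rewrite E dd0; lra.
have d0 : 0 < d u hf by exact: d_gt0.
have [u' fu] := act_finite Gf fhf uhf.
have lu := lam_finite Gf fhf uhf; rewrite -/rf in lu.
have lu2 : lam f (Some u) <= 2 by rewrite lu ler_pdivrMr//; lra.
exists u'; split => //.
  have := d_act Gf fp fu; rewrite flamp mul1r => E.
  have : d p u' <= 2 * 2 by rewrite E ler_pM//; exact/ltW/lam_gt0.
  by have := dD o p u'; have := Krho Kp; lra.
by rewrite lu ler_pdivlMr// ler_pdivrMl//; lra.
Qed.

Definition irrational x := forall g, G g -> act g (Some x) <> None.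

Lemma irr_act x g y : irrational x -> G g -> act g (Some x) = Some y -> irrational y.
Proof.
move=> ix Gg gx h Gh hy; apply: (ix (mul h g)); first exact: GM.
by rewrite actM// gx.
Qed.

Lemma irr_neq_o x : irrational x -> x <> o.
Proof. by move=> ix xo; apply: (ix _ Giota); rewrite xo. Qed.

Lemma lam_iotaE u : u <> o -> lam iota (Some u) = (d u o)^-1.
Proof. by move=> uo; rewrite (lam_finite Giota iota_o uo) lam_iota mul1r. Qed.

Let D0 := rho^-1 - rho.

Let rho0 : 0 < rho. Proof. by case/andP: rho01. Qed.
Let rho1 : rho < 1. Proof. by case/andP: rho01. Qed.

Lemma D0_gt0 : 0 < D0.
Proof. by rewrite subr_gt0; apply: lt_trans rho1 _; rewrite invf_gt1. Qed.

Definition away x (p : option S) := p = None \/ exists2 y, p = Some y & D0 <= d x y.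

Lemma shift_step x : K x -> irrational x -> exists a, [/\ Z a, K (T x),
  act (mul (inv a) iota) (Some x) = Some (T x),
  lam (mul (inv a) iota) (Some x) = (d x o)^-1 &
  forall p, away x p -> away (T x) (act (mul (inv a) iota) p)].
Proof.
move=> Kx ix; have xo := irr_neq_o ix.
have [KT [a Za aT]] := TP Kx xo; exists a.
have GZa := ZG Za; have GVa := GV GZa; have ZVa := ZV Za.
set m := mul (inv a) iota; have Gm : G m by exact: GM.
have mx : act m (Some x) = Some (T x) by rewrite actM// -aT actK.
have lm p : lam m p = lam iota p by rewrite lamM// lamZ// mul1r.
have lmx : lam m (Some x) = (d x o)^-1 by rewrite lm lam_iotaE.
split => // p.
have t0 : 0 < d x o by exact: d_gt0.
have trho : d x o <= rho by rewrite dC Krho.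
case=> [->|[y -> xy]].
  right; case E : (act m None) => [y|]; last first.
    by move: E; rewrite actM// iota_oo -(Zoo ZVa) => /(act_inj GVa).
  exists y => //; rewrite (d_act_oo Gm mx E) lmx lm lam_iota mulr1.
  apply: (@le_trans _ _ rho^-1); first by rewrite gerBl ltW.
  by rewrite lef_pV2.
case E : (act m (Some y)) => [y'|]; [right|by left].
have yo : y <> o.
  by move=> yo; move: E; rewrite yo actM// iota_o Zoo.
exists y' => //; rewrite (d_act Gm mx E) lmx lm lam_iotaE//.
have s0 : 0 < d y o by exact: d_gt0.
have E0 : D0 * rho = 1 - rho ^+ 2 by rewrite /D0; field; rewrite gt_eqF.
have sle : d y o <= d x y + rho by have := dD y x o; rewrite (dC y x); lra.
rewrite -invfM mulrC ler_pdivlMr ?mulr_gt0//.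
apply: (@le_trans _ _ (D0 * (rho * (d x y + rho)))).
  by rewrite ler_pM2l ?D0_gt0// ler_pM// ltW.
rewrite mulrA E0.
have : rho ^+ 2 * D0 <= rho ^+ 2 * d x y by rewrite ler_pM2l// exprn_gt0.
have -> : rho ^+ 2 * D0 = rho * (D0 * rho) by ring.
by rewrite E0; lra.
Qed.

(** [mul (inv iota) iota] plays the role of the identity, as the abstract group is given without a
    unit. *)
Lemma act1E p : act (mul (inv iota) iota) p = p.
Proof. by rewrite actM ?actK//; exact: GV. Qed.

Lemma lam1E p : lam (mul (inv iota) iota) p = 1.
Proof. by rewrite lamM ?lamV// ?mulVf// ?gt_eqF// ?lam_gt0//; exact: GV. Qed.

Lemma orbit_away x n : K x -> irrational x -> exists m, [/\ G m,
  act m (Some x) = Some (iter n T x), K (iter n T x),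
  rho^-1 ^+ n <= lam m (Some x) & away (iter n T x) (act m None)].
Proof.
move=> Kx ix; elim: n => [|n [m [Gm mx Kn lm am]]].
  have G1 : G (mul (inv iota) iota) by apply: GM => //; exact: GV.
  exists (mul (inv iota) iota); split => //; rewrite ?act1E ?lam1E//.
  by left.
have ixn := irr_act ix Gm mx.
have [a [Za KT aT la aw]] := shift_step Kn ixn.
set m' := mul (inv a) iota in aT la aw.
have Gm' : G m' by apply: GM => //; exact/GV/ZG.
exists (mul m' m); split => //.
- exact: GM.
- by rewrite actM// mx aT.
- rewrite lamM// mx la exprS; apply: ler_pM => //.
  + by rewrite invr_ge0 ltW.
  + by rewrite exprn_ge0// invr_ge0 ltW.
  + by rewrite lef_pV2 ?posrE ?rho0 ?d_gt0//; [rewrite dC Krho|exact: irr_neq_o].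
- by rewrite actM//; exact: aw.
Qed.

(* At time n >= 1 the point m_n(infinity) is finite: otherwise m_n would be an
   isometry, whereas it expands at x. *)
Lemma orbit_finite x n : K x -> irrational x -> exists m y, [/\ G m,
  act m (Some x) = Some (iter n.+1 T x), K (iter n.+1 T x),
  rho^-1 ^+ n.+1 <= lam m (Some x) & act m None = Some y /\ D0 <= d (iter n.+1 T x) y].
Proof.
move=> Kx ix; have [m [Gm mx Kn lm [moo|[y moo xy]]]] := orbit_away n.+1 Kx ix.
  have := stab_lam (Some x) Gm moo; move: lm => /[swap] ->.
  by rewrite leNgt exprn_egt1// invf_gt1.
by exists m, y.
Qed.

Section Distortion.
Variables (m : Ga) (x x' y : S).
Hypotheses (Gm : G m) (mx : act m (Some x) = Some x') (moo : act m None = Some y).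
Let la := lam m (Some x).

(** The only singularity of [m] is its pole [h]. On the scale magnified by [la ^+ 2], the conformal
    factor at [x], it lies at distance [d x' y] from [x]; hence m is nearly a similarity on the
    scale [d x' y / la ^+ 2], and estimates below only need a lower bound on [d x' y]. *)
Lemma distortion_pole : exists h, [/\ act m (Some h) = None, x <> h,
  la * d x h = lam m None & la ^+ 2 * d x h = d x' y].
Proof.
have [h mh] : exists h, act m (Some h) = None by apply: pole_ex => //; rewrite moo.
have xh : x <> h by move=> E; move: mx; rewrite E mh.
have [E|//] := lam_pole x Gm mh.
exists h; split => //.
by rewrite (d_act_oo Gm mx moo) -/la -E mulrA expr2.
Qed.

(** Such a [v] lies within an eighth of the distance from [x] to the pole, so its own distance to
    the pole is at least 7 / 8 of that distance, and [lam] is inversely proportional to it. The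
    Lipschitz constant 2 of the next lemma bounds (8 / 7)^2. *)
Lemma expand_bound v : 8 * (la ^+ 2 * d x v) <= d x' y ->
  (exists v', act m (Some v) = Some v') /\ lam m (Some v) <= 8 / 7 * la.
Proof.
have [h [mh xh E1 E2]] := distortion_pole.
have la0 : 0 < la by exact: lam_gt0.
rewrite -E2 mulrCA ler_pM2l ?exprn_gt0// => vx.
have xh0 : 0 < d x h by exact: d_gt0.
have vh : 7 / 8 * d x h <= d v h by have := dD x v h; lra.
have vh' : v <> h by move=> E; move: vh; rewrite E dd0; lra.
split; first exact: act_finite mh vh'.
have [Ev|//] := lam_pole v Gm mh.
have lv0 : 0 < lam m (Some v) by exact: lam_gt0.
have : lam m (Some v) * (7 / 8 * d x h) <= lam m (Some v) * d v h by rewrite ler_pM2l.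
rewrite Ev -E1 => H; rewrite -(@ler_pM2r _ (d x h))//; lra.
Qed.

Lemma expand_lipschitz u v : 8 * (la ^+ 2 * d x u) <= d x' y ->
  8 * (la ^+ 2 * d x v) <= d x' y -> exists u' v',
  [/\ act m (Some u) = Some u', act m (Some v) = Some v' &
      d u' v' <= 2 * la ^+ 2 * d u v].
Proof.
have la0 : 0 < la by exact: lam_gt0.
move=> /expand_bound[[u' mu'] lu] /expand_bound[[v' mv'] lv].
exists u', v'; split => //; rewrite (d_act Gm mu' mv') ler_wpM2r//.
apply: (@le_trans _ _ ((8 / 7 * la) * (8 / 7 * la))).
  by rewrite ler_pM// ltW// lam_gt0.
have : 0 <= la ^+ 2 by rewrite sqr_ge0.
by rewrite -mulrA (mulrCA la) -expr2; lra.
Qed.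

(** The same estimate for the inverse of [m], whose pole is [y]. *)
Lemma contract_bound u : 8 * d x' u <= d x' y ->
  exists2 v, act m (Some v) = Some u & la ^+ 2 * d x v <= 2 * d x' u.
Proof.
have [h [mh xh E1 E2]] := distortion_pole.
have la0 : 0 < la by exact: lam_gt0.
have xh0 : 0 < d x h by exact: d_gt0.
have xy0 : 0 < d x' y by rewrite -E2 mulr_gt0// exprn_gt0.
move=> ux; have uy : 7 / 8 * d x' y <= d u y by have := dD x' u y; lra.
have uy' : u <> y by move=> E; move: uy; rewrite E dd0; lra.
have GVm := GV Gm.
have iy : act (inv m) (Some y) = None by exact: actV_eq.
have [v iv] := act_finite GVm iy uy'.
have ix := actV_eq Gm mx.
exists v; first by rewrite -iv actVK.
have x'y : x' <> y by move=> E; move: xy0; rewrite E dd0; lra.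
have [Ex|//] := lam_pole x' GVm iy.
have [Eu|//] := lam_pole u GVm iy.
have lx : lam (inv m) (Some x') = la^-1 by rewrite -mx lamV.
have lu0 : 0 < lam (inv m) (Some u) by exact: lam_gt0.
rewrite (d_act GVm ix iv) lx expr2.
have lula : lam (inv m) (Some u) * la <= 2.
  have : lam (inv m) (Some u) * (7 / 8 * d x' y) <= lam (inv m) (Some u) * d u y.
    by rewrite ler_pM2l.
  rewrite Eu -Ex lx -(ler_pM2r la0) [_^-1 * _ * _]mulrAC mulVf ?gt_eqF// mul1r => H.
  by rewrite -(ler_pM2r xy0); lra.
have -> : la * la * (la^-1 * lam (inv m) (Some u) * d x' u) =
    lam (inv m) (Some u) * la * d x' u by field; rewrite gt_eqF.
by rewrite ler_wpM2r.
Qed.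

End Distortion.

Lemma geometric_small (q C e : R) : 0 < q < 1 -> 0 <= C -> 0 < e ->
  exists n, C * q ^+ n.+1 < e.
Proof.
case/andP=> q0 q1; rewrite le_eqVlt => /orP[/eqP <- e0|C0 e0]; first by exists 0%N; rewrite mul0r.
have := @cvg_geometric R C q; rewrite gtr0_norm// => /(_ q1).
move=> /cvgrPdist_lt /(_ _ e0)[n _ /(_ n.+1)] /=; rewrite leqnSn => /(_ isT).
rewrite sub0r normrN gtr0_norm; last by rewrite mulr_gt0// exprn_gt0.
by exists n.
Qed.

(** For irrational [x], moved into [K] by the lattice, the pole of the n-th branch is at distance
    [lam m None / lam m (Some x')] from it: the numerator is a bounded radius, the denominator grows
    geometrically. *)
Lemma cusps_dense x (e : R) : 0 < e -> exists g h,
  [/\ G g, act g (Some h) = None & d x h < e].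
Proof.
move=> e0.
have [ix|] := pselect (irrational x); last first.
  move=> /existsNP[g /not_implyP[Gg /contrapT gx]].
  by exists g, x; rewrite dd0.
have [a [x' [Za Kx' ax']]] := Zcover x; have GZa := ZG Za; have GVa := GV GZa.
have ix' : irrational x' by apply: (irr_act ix GVa); exact: actV_eq.
have [C C0 rC] := radius_bounded.
have [n rn] := geometric_small rho01 (ltW C0) e0.
have [m [y [Gm mx Kn lm [moo xy]]]] := orbit_finite n Kx' ix'.
have [h [mh xh E1 E2]] := distortion_pole Gm mx moo.
have [h' ah'] := actZ_finite h Za.
exists (mul m (inv a)), h'; split; [exact: GM|by rewrite actM// (actV_eq _ ah')|].
rewrite (d_actZ Za ax' ah'); apply: le_lt_trans rn.
have -> : d x' h = lam m None / lam m (Some x').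
  by rewrite -E1 mulrC mulKf// gt_eqF// lam_gt0.
apply: ler_pM; rewrite ?invr_ge0 ?(ltW (lam_gt0 _ _))//.
  by apply: rC => //; rewrite moo.
by rewrite -[rho ^+ _]invrK -exprVn lef_pV2// posrE ?lam_gt0// exprn_gt0// invr_gt0.
Qed.

(** Compactness of the unit ball: one cusp near each point of a finite net, and [ka] is the least of
    their radii. *)
Lemma cusps_uniform (e : R) : 0 < e -> exists2 ka : R, 0 < ka & forall x, d o x <= 1 ->
  exists g h, [/\ G g, act g (Some h) = None, d x h < e & ka <= lam g None].
Proof.
move=> e0; have e20 : 0 < e / 2 by rewrite divr_gt0.
have [M [z [_ net]]] := finite_net o RM ler01 e20.
have cz i : exists gh : Ga * S,
    [/\ G gh.1, act gh.1 (Some gh.2) = None & d (z i) gh.2 < e / 2].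
  by have [g [h]] := cusps_dense (z i) e20; exists (g, h).
have [gh ghP] := choice cz.
have [ka ka0 kaP] : exists2 ka : R, 0 < ka & forall i, (i < M)%N -> ka <= lam (gh i).1 None.
  elim: M {net} => [|M [ka ka0 kaP]]; first by exists 1.
  have l0 : 0 < lam (gh M).1 None by apply: lam_gt0; case: (ghP M).
  exists (Num.min ka (lam (gh M).1 None)); first by rewrite lt_min ka0.
  move=> i; rewrite ltnS leq_eqVlt => /orP[/eqP ->|/kaP le]; first by rewrite ge_min lexx orbT.
  by rewrite ge_min le.
exists ka => // x /net[i [iM zx]]; have [Gg gh0 zh] := ghP i.
exists (gh i).1, (gh i).2; split => //; last exact: kaP.
by have := dD x (z i) (gh i).2; rewrite (dC x (z i)); lra.
Qed.

Lemma mu_subset0 A B : A `<=` B -> mu B = 0%E -> mu A = 0%E.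
Proof.
move=> AB B0; apply/eqP; rewrite eq_le outer_measure_ge0 andbT -B0.
exact: le_outer_measure.
Qed.

Lemma mu_bigcup0 (F : nat -> set S) : (forall n, mu (F n) = 0%E) ->
  mu (\bigcup_n F n) = 0%E.
Proof.
move=> F0; apply/eqP; rewrite eq_le outer_measure_ge0 andbT.
apply: le_trans (outer_measure_sigma_subadditive mu F) _.
by rewrite eseries0.
Qed.

Lemma mu_setU0 A B : mu A = 0%E -> mu B = 0%E -> mu (A `|` B) = 0%E.
Proof.
move=> A0 B0; apply/eqP; rewrite eq_le outer_measure_ge0 andbT.
by apply: le_trans (outer_measureU2 mu A B) _; rewrite A0 B0 adde0.
Qed.

Lemma mu_point x : mu [set x] = 0%E.
Proof.
apply/eqP; rewrite eq_le outer_measure_ge0 andbT.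
apply/lee_addgt0Pr => e e0; rewrite add0e.
pose s := Num.min 1 (e / w).
have s0 : 0 < s by rewrite lt_min ltr01 divr_gt0.
apply: (@le_trans _ _ (mu (Q x s))).
  by apply: le_outer_measure => _ ->; apply: (rm_ballQ RM); rewrite dd0.
rewrite (rm_muQ RM); last exact: ltW.
rewrite lee_fin; apply: (@le_trans _ _ (w * s)).
  rewrite ler_pM2l// -(prednK N0) exprS ler_piMr ?(ltW s0)//.
  by rewrite exprn_ile1 ?(ltW s0)// ge_min lexx.
by rewrite mulrC -ler_pdivlMr// ge_min lexx orbT.
Qed.

Lemma mu_rational : mu [set x | ~ irrational x] = 0%E.
Proof.
apply: (@mu_subset0 _ (\bigcup_n [set x | G (enumG n) /\ act (enumG n) (Some x) = None])).
  move=> x /existsNP[g /not_implyP[Gg /contrapT gx]].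
  by have [n ng] := enumGP Gg; exists n => //=; rewrite ng.
apply: mu_bigcup0 => n.
have [[x0 [Gn x0n]]|nex] := pselect (exists x0, G (enumG n) /\ act (enumG n) (Some x0) = None).
  apply: mu_subset0 (mu_point x0) => x [_ xn].
  by have [] := act_inj Gn (etrans xn (esym x0n)).
by apply: mu_subset0 (outer_measure0 mu) => x xn; apply: nex; exists x.
Qed.

(** [g] is not Lipschitz near its pole, so [A] is cut into the countably many pieces where [lam] is
    at most j + 1, on which [g] has Lipschitz constant (j + 1)^2. *)
Lemma null_act g A : G g -> mu A = 0%E ->
  mu [set v | exists2 u, A u & act g (Some u) = Some v] = 0%E.
Proof.
move=> Gg A0; pose f u := odflt o (act g (Some u)).
pose B j := [set u | [/\ A u, act g (Some u) <> None & lam g (Some u) <= j.+1%:R]].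
apply: (@mu_subset0 _ (\bigcup_j (f @` B j))).
  move=> v [u Au gu]; exists (Num.truncn (lam g (Some u))) => //.
  exists u; last by rewrite /f gu.
  by split; rewrite ?gu//; apply/ltW/truncnS_gt.
apply: mu_bigcup0 => j; have j0 : 0 < j.+1%:R ^+ 2 :> R by rewrite exprn_gt0// ltr0n.
apply/eqP; rewrite eq_le outer_measure_ge0 andbT.
apply: le_trans (mu_lipschitz_image o RM j0 _) _ => [u v [_ gu lu] [_ gv lv]|].
  rewrite /f; case gu' : (act g (Some u)) gu => [u'|//] _.
  case gv' : (act g (Some v)) gv => [v'|//] _ /=.
  rewrite (d_act Gg gu' gv') ler_wpM2r// expr2 ler_pM// ltW//; exact: lam_gt0.
by rewrite (@mu_subset0 _ A)// ?mule0// => u [].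
Qed.

Lemma null_saturation A : mu A = 0%E ->
  mu [set v | exists g u, [/\ G g, A u & act g (Some u) = Some v]] = 0%E.
Proof.
move=> A0; pose F n := [set v | G (enumG n) /\ exists2 u, A u & act (enumG n) (Some u) = Some v].
apply: (@mu_subset0 _ (\bigcup_n F n)).
  move=> v [g [u [Gg Au gu]]]; have [n ng] := enumGP Gg.
  by exists n => //=; rewrite /F/= ng; split => //; exists u.
apply: mu_bigcup0 => n; have [Gn|nG] := pselect (G (enumG n)).
  by apply: mu_subset0 (null_act Gn A0) => v [].
by apply: mu_subset0 (outer_measure0 mu) => v [].
Qed.

Lemma muK_fin A : A `<=` K -> (mu A < +oo)%E.
Proof.
move=> AK; apply: (@le_lt_trans _ _ (mu (Q o 1))); last by rewrite (rm_muQ RM)// ltry.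
apply: le_outer_measure => x /AK Kx; apply: (rm_ballQ RM).
exact: le_lt_trans (Krho Kx) _.
Qed.

(* The vertical geodesic to [x] makes an excursion of height at least [D] in
   the cusp at a point within [e] of [x]. *)
Definition excursion (D e : R) x := exists g h gx gy,
  [/\ G g, act g (Some h) = None & d x h < e] /\
  [/\ act g (Some x) = Some gx, act g None = Some gy & D <= d gx gy].

(* Zooming in on [x] by [m_n], one sees near [T^n x] a cusp of bounded size,
   hence a definite proportion of points with an excursion. *)
Lemma excursion_ae (D e : R) : 0 < D -> 0 < e ->
  mu [set x | [/\ K x, irrational x & ~ excursion D e x]] = 0%E.
Proof.
move=> Dpos e0; set F := (X in mu X).
have D0p := D0_gt0.
(* Radius of the window around T^n x in the magnified picture: as m_n(infinity) is at distance at
   least 16 [r0], the distortion estimates, which need a factor 8, hold throughout the window. *)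
pose r0 := D0 / 16; have r0p : 0 < r0 by rewrite divr_gt0.
have [ka ka0 kaP] := cusps_uniform (divr_gt0 r0p (@ltr0n R 4)).
(* For u within [ta] of a cusp p of radius r >= [ka], with y = m_n(infinity) far from p, one has d(g
   u, g y) = r^2 d(u, y) / (d(u, p) d(y, p)) >= ka^2 / (2 ta) >= D. The bound by [r0] keeps these
   points in the window. *)
pose ta := Num.min (r0 / 4) (ka ^+ 2 / (2 * D)).
have ta0 : 0 < ta.
  by rewrite lt_min !divr_gt0// ?mulr_gt0// ?exprn_gt0.
have ta1 : ta <= r0 / 4 by rewrite ge_min lexx.
have ta2 : ta * (2 * D) <= ka ^+ 2.
  by rewrite -ler_pdivlMr ?mulr_gt0// ge_min lexx orbT.
(* The ratio t / s of the radii of the pulled-back cell and of the window; its [N]-th power is the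
   proportion of the window filled by points with an excursion. *)
pose th := ta / (4 * c * r0).
have th0 : 0 < th by rewrite divr_gt0// !mulr_gt0.
have th1 : th <= 1.
  rewrite ler_pdivrMr ?mulr_gt0// mul1r.
  have : r0 <= c * r0 by rewrite ler_peMl// ltW.
  by lra.
apply: (@density_null _ _ _ _ _ _ _ _ o RM _ (th ^+ N)).
- by apply: muK_fin => x [].
- by rewrite exprn_gt0//= exprn_ile1// (ltW th0).
move=> x [Kx ix nx] e' e'0.
(* Wait until the window, pulled back to [x], is smaller than both [e], which limits the distance to
   the cusp, and [e'], the scale at which density is tested. *)
have [n rn] := geometric_small rho01 (ltW r0p) (divr_gt0 e0 ltr01).
have [n' rn'] := geometric_small rho01 (ltW r0p) e'0.
have [m [y [Gm mx Kn lm [moo xy]]]] := orbit_finite (n + n') Kx ix.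
set x' := iter _ T x in mx Kn xy; set la := lam m (Some x) in lm.
have la0 : 0 < la by exact: lam_gt0.
have rhoV : 1 <= rho^-1 by rewrite invf_ge1// ltW.
have la1 : 1 <= la by apply: le_trans lm; exact: exprn_ege1.
have la2 : la <= la ^+ 2 by rewrite expr2 ler_peMr// ltW.
have lann k : (k <= n + n')%N -> r0 / la ^+ 2 <= r0 * rho ^+ k.+1.
  move=> kn; rewrite ler_pM2l// -[rho ^+ _]invrK -(exprVn rho).
  rewrite lef_pV2 ?posrE ?exprn_gt0 ?invr_gt0//; apply: le_trans la2.
  by apply: le_trans lm; rewrite ler_weXn2l.
have se : r0 / la ^+ 2 < e.
  by apply: le_lt_trans (lann n (leq_addr _ _)) _; rewrite divr1 in rn.
have se' : r0 / la ^+ 2 < e'.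
  by apply: le_lt_trans (lann n' (leq_addl _ _)) _.
set s := r0 / la ^+ 2 in se se'.
have las0 : 0 < la ^+ 2 by rewrite exprn_gt0.
have s0 : 0 < s by rewrite divr_gt0.
have sla : la ^+ 2 * s = r0 by rewrite mulrC divfK// gt_eqF.
exists s; split; first by rewrite s0.
have x1 : d o x' <= 1 by apply: le_trans (Krho Kn) (ltW rho1).
have [g [p [Gg gp xp kg]]] := kaP _ x1.
have x'p : 8 * d x' p <= d x' y by rewrite /r0 in xp; lra.
have [h' mh' xh'] := contract_bound Gm mx moo x'p; rewrite -/la in xh'.
pose t := ta / (2 * la ^+ 2 * (2 * c)).
have t0 : 0 < t by rewrite divr_gt0// !mulr_gt0.
have ct : la ^+ 2 * (c * t) = ta / 4 by rewrite /t; field; rewrite !gt_eqF.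
have near v : Q h' t v -> la ^+ 2 * d h' v <= ta / 4.
  by move=> /(rm_Qball RM); rewrite -ct ler_pM2l.
have far' v : Q h' t v -> la ^+ 2 * d x v < r0 /\ ~ F v.
  move=> hv; have hv' := near _ hv.
  have xv : la ^+ 2 * d x v <= la ^+ 2 * d x h' + la ^+ 2 * d h' v.
    by rewrite -mulrDr ler_pM2l.
  split; first by lra.
  case=> Kv iv; apply.
  have D16 : D0 = 16 * r0 by rewrite /r0; field.
  have hx' : 8 * (la ^+ 2 * d x h') <= d x' y by lra.
  have vx' : 8 * (la ^+ 2 * d x v) <= d x' y by lra.
  have [u [p' [mv]]] := expand_lipschitz Gm mx moo vx' hx'.
  rewrite mh' => -[<-]; rewrite -/la (dC v) => up.
  have {}up : d u p <= ta / 2 by lra.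
  have Ggm : G (mul g m) by exact: GM.
  have ump : act (mul g m) (Some h') = None by rewrite actM// mh'.
  have upn : u <> p.
    by move=> E; apply: (iv _ Ggm); rewrite actM// mv E.
  have py : 15 / 16 * D0 <= d p y.
    by have := dD x' p y; rewrite /r0 in xp; lra.
  have yp : y <> p by move=> E; move: py; rewrite E dd0; lra.
  have [gu Egu] := act_finite Gg gp upn.
  have [gy Egy] := act_finite Gg gp yp.
  exists (mul g m), h', gu, gy; split; first split=> //.
    rewrite -(ltr_pM2l las0); apply: (@le_lt_trans _ _ (ta / 4)).
      by rewrite dC; exact: near.
    apply: (@le_lt_trans _ _ (la ^+ 2 * s)); first by lra.
    by rewrite ltr_pM2l.
  split; [by rewrite actM// mv|by rewrite actM// moo|].
  rewrite (d_act Gg Egu Egy).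
  have [E1|//] := lam_pole u Gg gp; have [E2|//] := lam_pole y Gg gp.
  set r := lam g None in kg E1 E2.
  have up0 : 0 < d u p by exact: d_gt0.
  have yp0 : 0 < d y p by exact: d_gt0.
  rewrite -(ler_pM2r up0) -(ler_pM2r yp0).
  have -> : lam g (Some u) * lam g (Some y) * d u y * d u p * d y p =
      r * r * d u y by rewrite -{1}E1 -E2; ring.
  have uy : d y p / 2 <= d u y by have := dD p u y; rewrite (dC p u) (dC p y) in py *; lra.
  apply: (@le_trans _ _ (ka ^+ 2 * (d y p / 2))); last first.
    apply: ler_pM => //; [exact: sqr_ge0|by rewrite divr_ge0// ltW|].
    by rewrite expr2 ler_pM// ltW.
  apply: (@le_trans _ _ (D * (ta / 2) * d y p)).
    by rewrite ler_pM2r// ler_pM2l.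
  have : ta * (2 * D) * d y p <= ka ^+ 2 * d y p by rewrite ler_pM2r.
  have : 0 < ta * D * d y p by rewrite !mulr_gt0.
  by lra.
have sub : Q h' t `<=` Q x s.
  move=> v /far'[xv _]; apply: (rm_ballQ RM).
  by rewrite -(ltr_pM2l las0) sla.
(* [F] avoids the cell [Q h' t] contained in the window, so it is contained in the difference. *)
apply: (@le_trans _ _ (mu (Q x s `\` Q h' t))).
  by apply: le_outer_measure => v [Fv Qv]; split => // /far'[].
have := rm_mQ RM h' t (Q x s); rewrite setIidr// -setDE.
have s0' := ltW s0; have t0' := ltW t0; rewrite !(rm_muQ RM)//.
have fin : mu (Q x s `\` Q h' t) \is a fin_num.
  rewrite ge0_fin_numE ?outer_measure_ge0//.
  apply: (@le_lt_trans _ _ (mu (Q x s))); first by apply: le_outer_measure => v [].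
  by rewrite (rm_muQ RM)// ltry.
rewrite -(fineK fin) -EFinD => -[E]; rewrite lee_fin.
have ts : t = th * s by rewrite /t /th /s; field; rewrite !gt_eqF.
by rewrite ts (exprMn N th s) in E *; lra.
Qed.

(** Let [P] be the set of points of [K] whose orbits miss [A]. Around almost every point x of [A], a
    deep excursion provides a group element that maps arbitrarily small windows around x, with
    bounded distortion, over all of [K]. The preimage of [P] in a window lies outside [A] and, if
    [P] is not null, takes up a fixed proportion: this makes [A] thin at almost all of its points,
    hence null. *)
Lemma saturation_conull A : A `<=` K -> mu.-caratheodory A -> mu A <> 0%E ->
  mu [set u | K u /\ forall g v, G g -> act g (Some u) = Some v -> ~ A v] = 0%E.
Proof.
move=> AK mA A0; set P := (X in mu X).
apply: contrapT => P0; apply: A0.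
have fP : mu P \is a fin_num.
  by rewrite ge0_fin_numE ?outer_measure_ge0//; apply: muK_fin => u [].
pose b := fine (mu P); have bE : mu P = b%:E by rewrite fineK.
have b0 : 0 < b.
  rewrite lt_neqAle fine_ge0 ?outer_measure_ge0// andbT eq_sym.
  by apply/eqP => E; apply: P0; rewrite bE E.
(* The window [Q x s] chosen below has magnified radius at most 5 [c], and the distortion estimates
   ask for 8 times that radius. *)
pose D := 40 * c.
have D1 : 40 <= D by have := c1; rewrite /D; lra.
have D0' : 0 < D by lra.
pose A' := [set x | [/\ A x, irrational x & forall j, excursion D (j.+1%:R)^-1 x]].
suff A'0 : mu A' = 0%E.
  pose F j := [set x | [/\ K x, irrational x & ~ excursion D (j.+1%:R)^-1 x]].
  apply: (@mu_subset0 _ (A' `|` [set x | ~ irrational x] `|` \bigcup_j F j)).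
    move=> x Ax; have [ix|nix] := pselect (irrational x); last by left; right.
    have [ex|/existsNP[j nj]] := pselect (forall j, excursion D (j.+1%:R)^-1 x).
      by left; left.
    by right; exists j => //; split => //; exact: AK.
  apply: mu_setU0; first by apply: mu_setU0 => //; exact: mu_rational.
  by apply: mu_bigcup0 => j; apply: excursion_ae => //; rewrite invr_gt0 ltr0n.
(* With L = 2 la^2 and s = 5 / la^2, the factor (8 c L)^N of the Lipschitz estimate times s^N is (80
   c)^N, whatever the scale. *)
pose kk := b / (w * (80 * c) ^+ N).
have kden : 0 < w * (80 * c) ^+ N by rewrite mulr_gt0// exprn_gt0// mulr_gt0.
have kk0 : 0 < kk by rewrite divr_gt0.
pose eps := Num.min 1 kk.
have eps0 : 0 < eps by rewrite lt_min ltr01.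
apply: (@density_null _ _ _ _ _ _ _ _ o RM _ eps).
- by apply: muK_fin => x [/AK].
- by rewrite eps0 ge_min lexx.
move=> x [Ax ix ex] e e0.
have [g0 [h [gx0 [gy0 [[Gg0 gh0 xh] [Egx0 Egy0 Dg0]]]]]] := ex (Num.truncn e^-1).
have {}xh : d x h < e.
  apply: lt_trans xh _; rewrite -[ltRHS]invrK ltf_pV2 ?posrE ?invr_gt0 ?ltr0n//.
  exact: truncnS_gt.
have [a [x' [Za Kx' ax']]] := Zcover gx0.
have GZa := ZG Za; have GVa := GV GZa; have ZVa := ZV Za.
pose m := mul (inv a) g0.
have Gm : G m by exact: GM.
have mx : act m (Some x) = Some x' by rewrite actM// Egx0; exact: actV_eq.
have [y Ey] := actZ_finite gy0 ZVa.
have moo : act m None = Some y by rewrite actM// Egy0.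
have Dm : D <= d x' y.
  have ax : act (inv a) (Some gx0) = Some x' by exact: actV_eq.
  by rewrite (d_actZ ZVa ax Ey).
have [h' [mh' xh' E1 E2]] := distortion_pole Gm mx moo.
have hh' : h = h'.
  have mh : act m (Some h) = None by rewrite actM// gh0 Zoo.
  by have [] := act_inj Gm (etrans mh (esym mh')).
rewrite -{}hh' {h'} in mh' xh' E1 E2.
set la := lam m (Some x) in E1 E2.
have la0 : 0 < la by exact: lam_gt0.
have las0 : 0 < la ^+ 2 by rewrite exprn_gt0.
(* Points of [K] are within 2 of [x'], so their preimages are within 4 / la^2 of [x]; 5 makes this
   strict. *)
pose s := 5 / la ^+ 2.
have s0 : 0 < s by rewrite divr_gt0.
have sla : la ^+ 2 * s = 5 by rewrite mulrC divfK// gt_eqF.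
have se : s < e.
  apply: le_lt_trans xh; rewrite -(ler_pM2l las0) sla E2; lra.
exists s; split; first by rewrite s0.
pose L := 2 * la ^+ 2.
have L0 : 0 < L by rewrite mulr_gt0.
have inQ v : Q x s v -> 8 * (la ^+ 2 * d x v) <= d x' y.
  move=> /(rm_Qball RM); rewrite -(ler_pM2l las0) mulrCA sla.
  by rewrite /D in Dm; lra.
pose f v := odflt o (act m (Some v)).
have lip : (mu (f @` (Q x s `\` A)) <= ((8 * c * L) ^+ N)%:E * mu (Q x s `\` A))%E.
  apply: (mu_lipschitz_image o RM L0) => u v [/inQ uQ _] [/inQ vQ _].
  have [u' [v' [mu' mv' le]]] := expand_lipschitz Gm mx moo uQ vQ.
  by rewrite /f mu' mv'.
have sub : P `<=` f @` (Q x s `\` A).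
  move=> u [Ku nA].
  have ux : d x' u <= 2.
    apply: le_trans (dD x' o u) _; rewrite (dC x').
    by have := Krho Ku; have := Krho Kx'; have := rho1; lra.
  have ux' : 8 * d x' u <= d x' y by lra.
  have [v mv xv] := contract_bound Gm mx moo ux'.
  exists v; last by rewrite /f mv.
  split; last first.
    by apply: (nA (inv m)); [exact: GV|exact: actV_eq].
  apply: (rm_ballQ RM); rewrite -(ltr_pM2l las0) sla.
  by apply: le_lt_trans xv _; have := rho1; lra.
have bQ : (b%:E <= ((8 * c * L) ^+ N)%:E * mu (Q x s `\` A))%E.
  by rewrite -bE; apply: le_trans lip; exact: le_outer_measure.
apply: (@le_trans _ _ (mu (Q x s `&` A))).
  by apply: le_outer_measure => v [[]].
have := mA (Q x s); rewrite -setDE (rm_muQ RM); last exact: ltW.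
have fin B : B `<=` Q x s -> mu B \is a fin_num.
  move=> BQ; rewrite ge0_fin_numE ?outer_measure_ge0//.
  apply: (@le_lt_trans _ _ (mu (Q x s))); first exact: le_outer_measure.
  by rewrite (rm_muQ RM) ?(ltW s0)// ltry.
have f1 : mu (Q x s `&` A) \is a fin_num by apply: fin => v [].
have f2 : mu (Q x s `\` A) \is a fin_num by apply: fin => v [].
move: bQ; rewrite -(fineK f1) -(fineK f2) -EFinM -EFinD !lee_fin => bQ [E].
have : eps * (w * s ^+ N) <= fine (mu (Q x s `\` A)).
  apply: (@le_trans _ _ (kk * (w * s ^+ N))).
    rewrite ler_wpM2r ?ge_min ?lexx ?orbT//.
    by rewrite mulr_ge0 ?(ltW w0)// exprn_ge0// ltW.
  have K0 : 0 < (8 * c * L) ^+ N by rewrite exprn_gt0// !mulr_gt0.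
  rewrite -(ler_pM2l K0); apply: le_trans _ bQ.
  have -> : (8 * c * L) ^+ N * (kk * (w * s ^+ N)) = kk * (w * (8 * c * L * s) ^+ N).
    by rewrite [in RHS]exprMn; ring.
  have -> : 8 * c * L * s = 80 * c by rewrite /L -mulrA -[2 * _ * s]mulrA sla; ring.
  by rewrite /kk divfK// gt_eqF.
by lra.
Qed.

(* An analogue of Legendre's theorem: good approximations are convergents. *)
Lemma excursion_convergent : exists2 D : R, 0 < D & forall x g gx gy,
  K x -> irrational x -> G g -> act g (Some x) = Some gx -> act g None = Some gy ->
  D <= d gx gy -> exists n m h, [/\ G m, act m (Some x) = Some (iter n T x),
    act g (Some h) = None & act m (Some h) = None].
Proof.
have [C C0 rC] := radius_bounded.
have D0p := D0_gt0.
(* The distance allowed between T^n x and the transported pole. The first bound leaves the pole at a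
   distance from m_n(infinity) at least half that of T^n x; the second one keeps it within [q] < 1
   of the origin. *)
pose eta := Num.min (D0 / 2) ((1 - rho) / 2).
have eta0 : 0 < eta by rewrite lt_min !divr_gt0// subr_gt0.
have eta1 : eta <= D0 / 2 by rewrite ge_min lexx.
have eta2 : eta <= (1 - rho) / 2 by rewrite ge_min lexx orbT.
pose q := (1 + rho) / 2.
have q0 : 0 < q by rewrite divr_gt0// addr_gt0.
have q1 : q < 1 by have := rho1; rewrite /q; lra.
have Dp : 0 < 4 * C ^+ 2 / eta by rewrite divr_gt0// mulr_gt0// exprn_gt0.
exists (4 * C ^+ 2 / eta) => // x g gx gy Kx ix Gg Egx Egy.
set H := d gx gy; rewrite ler_pdivrMr// => HC.
have H0 : 0 < H.
  by rewrite -(pmulr_lgt0 _ eta0); apply: lt_le_trans HC; rewrite mulr_gt0// exprn_gt0.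
have [h gh] : exists h, act g (Some h) = None by apply: pole_ex => //; rewrite Egy.
apply: contrapT => no.
have {}no n m : G m -> act m (Some x) = Some (iter n T x) -> act m (Some h) <> None.
  by move=> Gm mx mh; apply: no; exists n, m, h.
(* Here gn = g m_n^-1 and hn = m_n h is its pole. As the pole is supposed never to reach infinity,
   the radius of gn gains a factor 1 / q at each step and ends up above the bound [C]. *)
have key n : exists m gn hn, [/\ G m, G gn, act m (Some x) = Some (iter n T x),
    K (iter n T x) & away (iter n T x) (act m None)] /\
  [/\ forall p, act g p = act gn (act m p), act m (Some h) = Some hn,
    d (iter n T x) hn <= eta & lam g None * q^-1 ^+ n <= lam gn None].
  elim: n => [|n [m [gn [hn [[Gm Ggn mx Kn aw] [gE mh dn rn]]]]]].
    have G1 : G (mul (inv iota) iota) by apply: GM => //; exact: GV.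
    exists (mul (inv iota) iota), g, h; split; split => //.
    - by rewrite act1E.
    - by rewrite act1E; left.
    - by move=> p; rewrite act1E.
    - by rewrite act1E.
    - have xh : x <> h by move=> E; move: Egx; rewrite E gh.
      have [E|//] := lam_pole x Gg gh.
      have := d_act_oo Gg Egx Egy; rewrite -/H => E'.
      have rc : lam g None <= C by apply: rC => //; rewrite Egy.
      rewrite /= -(ler_pM2l H0) {1}E' mulrAC E -expr2.
      have : lam g None ^+ 2 <= C ^+ 2 by rewrite lerXn2r ?nnegrE// ltW// lam_gt0.
      by have := sqr_ge0 C; lra.
    - by rewrite expr0 mulr1.
  set xn := iter n T x in mx Kn aw dn.
  have gnhn : act gn (Some hn) = None by rewrite -mh -gE.
  have gnx : act gn (Some xn) = Some gx by rewrite -mx -gE.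
  have xhn : xn <> hn by move=> E; move: gnx; rewrite E gnhn.
  have [lx|//] := lam_pole xn Ggn gnhn.
  set r := lam gn None in lx rn.
  have de0 : 0 < d xn hn by exact: d_gt0.
  have r0 : 0 < r by exact: lam_gt0.
  (* With y = m_n(infinity), [H] equals d(gn xn, gn y) = r^2 d(xn, y) / (d(xn, hn) d(y, hn)), and
     the last ratio of distances to y is at most 2. If y is infinity, the ratio disappears. *)
  have Hd : H * d xn hn <= 2 * r ^+ 2.
    case: aw => [moo|[y moo xy]].
      have gnoo : act gn None = Some gy by rewrite -moo -gE.
      rewrite /H (d_act_oo Ggn gnx gnoo) -/r mulrAC lx -expr2.
      by have := sqr_ge0 r; lra.
    have gny : act gn (Some y) = Some gy by rewrite -moo -gE.
    have yhn : y <> hn by move=> E; move: gny; rewrite E gnhn.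
    have yh0 : 0 < d y hn by exact: d_gt0.
    have [ly|//] := lam_pole y Ggn gnhn; rewrite -/r in ly.
    rewrite /H (d_act Ggn gnx gny) -(ler_pM2r yh0).
    have -> : lam gn (Some xn) * lam gn (Some y) * d xn y * d xn hn * d y hn =
      r ^+ 2 * d xn y by rewrite expr2 -{1}lx -ly; ring.
    have xy2 : d xn y <= 2 * d y hn by have := dD xn hn y; rewrite (dC hn y); lra.
    by have := ler_wpM2l (sqr_ge0 r) xy2; lra.
  have ixn : irrational xn by exact: irr_act mx.
  have [a [Za KT aT la aw']] := shift_step Kn ixn.
  set m1 := mul (inv a) iota in aT la aw'.
  have GZa := ZG Za; have GVa := GV GZa; have ZVa := ZV Za.
  have Gm1 : G m1 by exact: GM.
  have Gm1m : G (mul m1 m) by exact: GM.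
  have m1mx : act (mul m1 m) (Some x) = Some (T xn) by rewrite actM// mx.
  have m1mh := no n.+1 _ Gm1m m1mx; rewrite actM// mh in m1mh.
  have m1o : act m1 (Some o) = None by rewrite actM// iota_o Zoo.
  have hno : hn <> o by move=> E; apply: m1mh; rewrite E m1o.
  have [hn' m1h] : exists hn', act m1 (Some hn) = Some hn'.
    by case: (act m1 _) m1mh => // v; exists v.
  have lm1 p : lam m1 p = lam iota p by rewrite lamM// lamZ// mul1r.
  have lh : lam m1 (Some hn) = (d hn o)^-1 by rewrite lm1 lam_iotaE.
  have GVm1 := GV Gm1; have Ggn' := GM Ggn GVm1.
  have Voo : act (inv m1) None = Some o by exact: actV_eq.
  have lo : lam m1 (Some o) = 1 by rewrite lm1 (lam_pole_inv Giota iota_o) lam_iota invr1.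
  (* The next radius is r / s, where s is the distance from the pole to the origin. It is at least r
     / q, and being at most [C] it also gives r <= C s. *)
  have r' : lam (mul gn (inv m1)) None = lam gn (Some o).
    by rewrite lamM// Voo -[X in lam (inv m1) X]m1o lamV// lo invr1 mulr1.
  have gn'h : act (mul gn (inv m1)) (Some hn') = None.
    by rewrite actM// (actV_eq Gm1 m1h).
  have [lo'|E] := lam_pole o Ggn gnhn; last by case: hno.
  have rC' : lam gn (Some o) <= C.
    by rewrite -r'; apply: rC => //; exact: pole_noo gn'h.
  rewrite -/r (dC o) in lo'.
  set rr := lam gn (Some o) in r' lo' rC'.
  have rr0 : 0 < rr by exact: lam_gt0.
  set s := d hn o in lh lo'.
  have s0 : 0 < s by exact: d_gt0.
  have xo0 : 0 < d xn o by apply: d_gt0; exact: irr_neq_o.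
  have xorho : d xn o <= rho by rewrite dC Krho.
  have sle : s <= d xn o + d xn hn by have := dD hn xn o; rewrite (dC hn xn) -/s; lra.
  have r1 := rho1; have r0p := rho0; have sq : s <= q by rewrite /q; lra.
  have s2 : s ^+ 2 <= s by rewrite expr2 ler_piMr ?(ltW s0)//; lra.
  (* Sharpening through r <= C s: the gain s^2 compensates the expansion 1 / (d(xn, o) s) of the
     next branch, so the bound [eta] propagates. *)
  have de1 : d xn hn <= eta * s ^+ 2 / 2.
    rewrite -(ler_pM2l H0); apply: le_trans Hd _.
    have : r ^+ 2 <= C ^+ 2 * s ^+ 2.
      by rewrite -lo' exprMn ler_pM2r ?exprn_gt0// lerXn2r ?nnegrE// ltW.
    have : 4 * C ^+ 2 * s ^+ 2 <= H * eta * s ^+ 2 by rewrite ler_pM2r// exprn_gt0.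
    by lra.
  have es : eta * s ^+ 2 <= s / 2.
    have : eta * s ^+ 2 <= 1 / 2 * s ^+ 2 by rewrite ler_pM2r ?exprn_gt0//; lra.
    by lra.
  have xs : s / 2 <= d xn o by lra.
  exists (mul m1 m), (mul gn (inv m1)), hn'; split; split => //.
  - by rewrite actM//; exact: aw'.
  - by move=> p; rewrite (actM _ Ggn GVm1) (actM _ Gm1 Gm) actK.
  - by rewrite actM// mh.
  - rewrite [iter _ _ _]/= (d_act Gm1 aT m1h) la lh.
    have xs0 : 0 < d xn o * s by rewrite mulr_gt0.
    rewrite -invfM mulrC ler_pdivrMr//; apply: le_trans de1 _.
    rewrite -mulrA ler_pM2l// expr2 mulrAC.
    by rewrite ler_pM2r.
  - rewrite r' exprSr mulrA ler_pdivrMr//; apply: le_trans rn _.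
    by rewrite -lo' ler_pM2l.
have lg0 : 0 < lam g None by exact: lam_gt0.
have q01 : 0 < q < 1 by rewrite q0.
have [n] := geometric_small q01 (ltW C0) lg0.
have [m [gn [hn [[Gm Ggn mx Kn aw] [gE mh dn rn]]]]] := key n.+1.
have : lam gn None <= C.
  by apply: rC => //; apply: (pole_noo (h := hn)); rewrite // -mh -gE.
move=> rC'; rewrite ltNge => /negP; apply.
have qn0 : 0 < q ^+ n.+1 by rewrite exprn_gt0.
rewrite -ler_pdivrMr//; apply: le_trans _ rC'.
by rewrite -exprVn.
Qed.

(* For almost every [x] in [K], each [A i] contains a point of the orbit of
   [x]. Apply the previous lemma at all these points to one high excursion of
   [x]: some iterates of them coincide up to one of [n0] central symmetries
   and up to [Z], hence two of the iterates coincide up to [Z]. *)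
Theorem few_invariant_sets (n0 : nat) (sym : 'I_n0 -> option S -> option S)
    (A : 'I_n0.+1 -> set S) :
  mu [set x | K x /\ exists a x', [/\ Z a, K x', act a (Some x) = Some x' & x' <> x]] = 0%E ->
  (forall g, G g -> act g None = None -> exists a r, Z a /\
    forall p, act g p = act a (sym r p)) ->
  (forall i, A i `<=` K) -> (forall i, mu.-caratheodory (A i)) ->
  (forall i, mu (A i) <> 0%E) ->
  (forall i, mu ((K `&` T @^-1` A i) `+` A i) = 0%E) ->
  (forall i j, i != j -> A i `&` A j = set0) -> False.
Proof.
set B2 := [set x | _]; move=> B20 dec AK mA A0 invA disA.
have [D Dpos leg] := excursion_convergent.
pose nth i := nat_of_ord i.
pose bigU (F : 'I_n0.+1 -> set S) := \bigcup_n (if insub n is Some i then F i else set0).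
have bigU0 F : (forall i, mu (F i) = 0%E) -> mu (bigU F) = 0%E.
  by move=> F0; apply: mu_bigcup0 => n; case: insubP => [i _ _|_].
have bigUP F i : F i `<=` bigU F.
  by move=> x Fx; exists i => //; rewrite valK.
pose B1 := bigU (fun i => (K `&` T @^-1` A i) `+` A i).
(* Saturated under [G], so that the whole orbit of [x] avoids the points where some [A i] fails to
   be invariant and those equivalent under [Z] to another point of [K]. *)
pose B := [set v | exists g u, [/\ G g, (B1 `|` B2) u & act g (Some u) = Some v]].
have B0 : mu B = 0%E by apply: null_saturation; apply: mu_setU0 => //; exact: bigU0.
pose E := bigU (fun i => [set u | K u /\ forall g v, G g -> act g (Some u) = Some v -> ~ A i v]).
have E0 : mu E = 0%E by apply: bigU0 => i; exact: saturation_conull.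
(* Twice the threshold [D]: half of the height may be lost when infinity is replaced by
   f_i^-1(infinity). *)
pose F := \bigcup_j [set x | [/\ K x, irrational x & ~ excursion (2 * D) (j.+1%:R)^-1 x]].
have F0 : mu F = 0%E.
  apply: mu_bigcup0 => j; apply: excursion_ae; first by rewrite mulr_gt0.
  by rewrite invr_gt0 ltr0n.
have [x [A0x nBx nEx nFx ix]] : exists x, [/\ A ord0 x, ~ B x, ~ E x, ~ F x & irrational x].
  apply: contrapT => nx; apply: (A0 ord0).
  apply: (@mu_subset0 _ (B `|` E `|` F `|` [set x | ~ irrational x])).
    move=> x Ax; apply: contrapT => nU; apply: nx; exists x.
    split => //; [by move=> H; apply: nU; left; left; left|
      by move=> H; apply: nU; left; left; right|by move=> H; apply: nU; left; right|].
    by apply: contrapT => H; apply: nU; right.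
  by do 3?[apply: mu_setU0 => //]; exact: mu_rational.
have Kx := AK _ _ A0x.
have fv i : exists fv : Ga * S, [/\ G fv.1, A i fv.2 & act fv.1 (Some x) = Some fv.2].
  apply: contrapT => nfv; apply: nEx; apply: (bigUP _ i); split => // g v Gg gx Av.
  by apply: nfv; exists (g, v).
have [f /all_and3[Gf Af fx]] := choice fv.
(* How close to [x] the pole of g must be for g f_i^-1 to remain a good approximation at f_i x. If
   f_i fixes infinity there is no constraint, and 1 will do. *)
have ep_ex i : exists e : R, 0 < e /\ forall y, act (inv (f i).1) None = Some y ->
    2 * e <= d x y.
  case Ey : (act (inv (f i).1) None) => [y|]; last by exists 1.
  have xy : x <> y.
    move=> xy; have := fx i; rewrite xy -Ey actVK//; exact: Gf.
  exists (d x y / 2); split; first by rewrite divr_gt0// d_gt0.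
  by move=> _ [<-]; lra.
have [ep /all_and2[ep0 epP]] := choice ep_ex.
have [j jP] : exists j : nat, forall i, j.+1%:R^-1 <= ep i.
  pose M := \max_(i < n0.+1) Num.truncn (ep i)^-1.
  exists M => i; rewrite -[ep i]invrK lef_pV2 ?posrE ?invr_gt0 ?ltr0n//.
  apply: le_trans (ltW (truncnS_gt _)) _; rewrite ler_nat ltnS.
  exact: (leq_bigmax (F := fun i => Num.truncn (ep i)^-1)).
have [g [h [gx [gy [[Gg gh xh] [Egx Egy Dg]]]]]] : excursion (2 * D) j.+1%:R^-1 x.
  by apply: contrapT => ne; apply: nFx; exists j.
have conv i : exists t : nat * S * 'I_n0 * Ga, [/\ t.1.1.2 = iter t.1.1.1 T (f i).2,
    Z t.2, act t.2 (sym t.1.2 (Some gx)) = Some t.1.1.2 &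
    exists m, G m /\ act m (Some x) = Some t.1.1.2].
  have Gi := Gf i; have GVi := GV Gi; have Ggi : G (mul g (inv (f i).1)) by exact: GM.
  have gix : act (mul g (inv (f i).1)) (Some (f i).2) = Some gx.
    by rewrite actM// (actV_eq Gi (fx i)).
  have [gy' [Egy' Dgy']] : exists gy', act (mul g (inv (f i).1)) None = Some gy' /\
      D <= d gx gy'.
    rewrite actM//; case Ey : (act (inv (f i).1) None) => [y|]; last first.
      by exists gy; split => //; lra.
    have xy := epP i y Ey; have xe := lt_le_trans xh (jP i).
    have xy0 : 0 < d x y by have := ep0 i; lra.
    have yh : y <> h by move=> yh; move: xy xe (ep0 i); rewrite yh; lra.
    have [gy' Egy'] := act_finite Gg gh yh.
    exists gy'; split => //.
    rewrite (d_act Gg Egx Egy').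
    have [ly|//] := lam_pole y Gg gh.
    have yh0 : 0 < d y h by exact: d_gt0.
    have := d_act_oo Gg Egx Egy; set H := d gx gy in Dg * => HE.
    have HE' : lam g (Some x) * lam g (Some y) * d x y * d y h = H * d x y.
      by rewrite HE -ly; ring.
    rewrite -(ler_pM2r yh0) HE'.
    have yh2 : d y h <= 2 * d x y.
      by have := dD y x h; have := ep0 i; rewrite (dC y x); lra.
    apply: (@le_trans _ _ (D * (2 * d x y))); first by rewrite ler_pM2l.
    by rewrite mulrA (mulrC D) ler_pM2r.
  have iv : irrational (f i).2 by exact: irr_act (fx i).
  have [n [m [hi [Gm mv gihi mhi]]]] := leg _ _ _ _ (AK _ _ (Af i)) iv Ggi gix Egy' Dgy'.
  have GVgi := GV Ggi.
  (* This element fixes infinity, because both factors share a pole, and it sends g x to the iterate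
     of x_i. *)
  have Gs : G (mul m (inv (mul g (inv (f i).1)))) by exact: GM.
  have [|a [r [Za sE]]] := dec _ Gs.
    by rewrite actM// (actV_eq Ggi gihi).
  exists (n, iter n T (f i).2, r, a); split => //=.
    by rewrite -sE actM// (actV_eq Ggi gix).
  by exists (mul m (f i).1); split; [exact: GM|rewrite actM// fx].
have [t /all_and4[tE Zt tsym torb]] := choice conv.
have itA i n : A i (iter n T (f i).2) /\
    exists m, G m /\ act m (Some x) = Some (iter n T (f i).2).
  elim: n => [|n [IHA [m [Gm mx]]]].
    by split; [exact: Af|exists (f i).1; split; [exact: Gf|exact: fx]].
  have iv : irrational (iter n T (f i).2) by exact: irr_act mx.
  have [a [Za KT aT _ _]] := shift_step (AK _ _ IHA) iv.
  have GZa := ZG Za; have GVa := GV GZa; have Gm1 : G (mul (inv a) iota) by exact: GM.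
  split; last first.
    by exists (mul (mul (inv a) iota) m); split; [exact: GM|rewrite actM// mx].
  apply: contrapT => nA; apply: nBx.
  exists (inv m), (iter n T (f i).2); split; [exact: GV| |exact: actV_eq].
  by left; apply: (bigUP _ i); right; split => // -[].
have [i [j' [ij rij]]] : exists i j', i != j' /\ (t i).1.2 = (t j').1.2.
  apply: contrapT => nij.
  have inj : injective (fun i => (t i).1.2).
    move=> i j' E'; apply/eqP/negP => /negP ij; apply: nij; exists i, j'.
    by split.
  by have := leq_card _ inj; rewrite !card_ord ltnn.
have Ai : A i (t i).1.1.2 by rewrite tE; case: (itA i (t i).1.1.1).
have Aj : A j' (t j').1.1.2 by rewrite tE; case: (itA j' (t j').1.1.1).
have GZi := ZG (Zt i); have GZj := ZG (Zt j'); have GVi := GV GZi.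
pose a := mul (t j').2 (inv (t i).2).
have Za : Z a by apply: ZM => //; exact: ZV.
have at_ : act a (Some (t i).1.1.2) = Some (t j').1.1.2.
  by rewrite actM// (actV_eq GZi (tsym i)) rij tsym.
have tij : (t j').1.1.2 = (t i).1.1.2.
  apply: contrapT => ne; apply: nBx; have [m [Gm mx]] := torb i.
  exists (inv m), (t i).1.1.2; split; [exact: GV| |exact: actV_eq].
  right; split; first exact: AK Ai.
  by exists a, (t j').1.1.2; split => //; exact: AK Aj.
rewrite tij in Aj.
have : (A i `&` A j') (t i).1.1.2 by split.
by rewrite disA.
Qed.

End ConformalDynamics.

(** * Real, complex and quaternionic scalars *)

Section ScalarAlgebra.
Variable R : realType.

Lemma quat_eq (x y : quat R) : qre x = qre y -> qi x = qi y -> qj x = qj y ->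
  qk x = qk y -> x = y.
Proof. by case: x y => [????] [????] /= -> -> -> ->. Qed.

Variable k : scalar_kind.
Notation K1 := (scalars R k).
Implicit Types (x y : K1) (a b : R).

Definition kcoord x (c : option 'I_(imdim k)) : R :=
  if c is Some j then kimcoord x j else kre x.

Definition ksq x : R := kre (kconj x * x).

Lemma kreD x y : kre (x + y) = kre x + kre y.
Proof. by move: x y; case: k => [//|[? ?] [? ?]//|[????] [????]]. Qed.

Lemma kreN x : kre (- x) = - kre x.
Proof. by move: x; case: k => [//|[? ?]//|[????]]. Qed.

Lemma kcoordD x y c : kcoord (x + y) c = kcoord x c + kcoord y c.
Proof.
rewrite /kcoord; case: c => [j|]; last exact: kreD.
move: x y j; rewrite /kimcoord; case: k => /= [? ? []//|[? ?] [? ?] j//|].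
by move=> [????] [????] [[|[|[|j]]] ij].
Qed.

Lemma kcoordZ a x c : kcoord (kreal k a * x) c = a * kcoord x c.
Proof.
rewrite /kcoord /kimcoord; move: x c; case: k => /=.
- by move=> x [[]|].
- by move=> [? ?] [j|] /=; ring.
- by move=> [????] [[[|[|[|j]]] ij]|] //=; ring.
Qed.

Lemma kcoord_ext x y : kcoord x =1 kcoord y -> x = y.
Proof.
rewrite /kcoord /kimcoord; move: x y; case: k => /=.
- by move=> x y /(_ None).
- by move=> [? ?] [? ?] /= H; have := H None; have := H (Some ord0) => /= -> ->.
- move=> [????] [????] /= H.
  have := H None; have /= := H (Some (@Ordinal 3 0 isT)).
  have /= := H (Some (@Ordinal 3 1 isT)); have /= := H (Some (@Ordinal 3 2 isT)).
  by move=> -> -> -> ->.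
Qed.

Definition kmk (f : option 'I_(imdim k) -> R) : K1 :=
  match k return (option 'I_(imdim k) -> R) -> scalars R k with
  | RealK => fun f => f None
  | ComplexK => fun f => Complex (f None) (f (Some ord0))
  | QuaternionK => fun f => Quat (f None) (f (Some (@Ordinal 3 0 isT)))
      (f (Some (@Ordinal 3 1 isT))) (f (Some (@Ordinal 3 2 isT)))
  end f.

Lemma kmkK f c : kcoord (kmk f) c = f c.
Proof.
rewrite /kcoord /kimcoord /kmk; move: f c; case: k => /=.
- by move=> f [[]|].
- by move=> f [j|] //; rewrite (ord1 j).
- by move=> f [[[|[|[|j]]] ij]|] //=; congr (f (Some _)); apply: val_inj.
Qed.

Lemma kconjD x y : kconj (x + y) = kconj x + kconj y.
Proof.
move: x y; case: k => /= [//|[? ?] [? ?]|[????] [????]].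
  by congr Complex; rewrite opprD.
by apply: quat_eq => /=; ring.
Qed.

Lemma kconjM x y : kconj (x * y) = kconj y * kconj x.
Proof.
move: x y; case: k => /= [? ?|[? ?] [? ?]|[????] [????]]; first by rewrite mulrC.
  by congr Complex; ring.
by apply: quat_eq => /=; ring.
Qed.

Lemma kconjK x : kconj (kconj x) = x.
Proof.
move: x; case: k => /= [//|[? ?]|[????]] /=; first by rewrite opprK.
by rewrite /conjq /= !opprK.
Qed.

Lemma kconj_kreal a : kconj (kreal k a) = kreal k a.
Proof. by case: k => //=; rewrite ?oppr0// /conjq/real_quat/= !oppr0. Qed.

Lemma kre_kconj x : kre (kconj x) = kre x.
Proof. by move: x; case: k => //= -[]. Qed.

Lemma kre_kreal a : kre (kreal k a) = a.
Proof. by case: k. Qed.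

Lemma krealD a b : kreal k (a + b) = kreal k a + kreal k b.
Proof.
case: k => //=; first by congr Complex; rewrite addr0.
by apply: quat_eq => /=; ring.
Qed.

Lemma krealM a b : kreal k (a * b) = kreal k a * kreal k b.
Proof.
case: k => //=; first by congr Complex; ring.
by apply: quat_eq => /=; ring.
Qed.

Lemma kreal_comm a x : kreal k a * x = x * kreal k a.
Proof.
move: x; case: k => /= [?|[? ?]|[????]]; first by rewrite mulrC.
  by congr Complex; ring.
by apply: quat_eq => /=; ring.
Qed.

Lemma kreal0 : @kreal R k 0 = 0.
Proof. by case: k. Qed.

Lemma kreal1 : @kreal R k 1 = 1.
Proof. by case: k. Qed.

Lemma kconj_mul x : kconj x * x = kreal k (ksq x).
Proof.
rewrite /ksq; move: x; case: k => /= [//|[? ?]|[????]].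
  by congr Complex => /=; ring.
by apply: quat_eq => /=; ring.
Qed.

Lemma mul_kconj x : x * kconj x = kreal k (ksq x).
Proof.
rewrite /ksq; move: x; case: k => /= [//|[? ?]|[????]].
  by congr Complex => /=; ring.
by apply: quat_eq => /=; ring.
Qed.

Lemma ksqE x : ksq x = \sum_c kcoord x c ^+ 2.
Proof.
rewrite /ksq /kcoord /kimcoord; move: x; case: k => /=.
- move=> x; rewrite (bigD1 None)//= big1 ?addr0// => -[[]|] //.
- move=> [a b]; rewrite (bigD1 None)//= (bigD1 (Some ord0))//= big1 ?addr0; first by ring.
  by move=> -[j|] //=; rewrite (ord1 j).
- move=> [a b e f]; rewrite (bigD1 None)//=.
  rewrite (bigD1 (Some (@Ordinal 3 0 isT)))//= (bigD1 (Some (@Ordinal 3 1 isT)))//=.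
  rewrite (bigD1 (Some (@Ordinal 3 2 isT)))//= big1 ?addr0; first by ring.
  by move=> -[[[|[|[|j]]] ij]|] //=.
Qed.

Lemma ksq_ge0 x : 0 <= ksq x.
Proof. by rewrite ksqE sumr_ge0// => c _; exact: sqr_ge0. Qed.

Lemma ksq_kreal a : ksq (kreal k a) = a ^+ 2.
Proof. by rewrite /ksq kconj_kreal -krealM kre_kreal. Qed.

Lemma ksqM x y : ksq (x * y) = ksq x * ksq y.
Proof.
rewrite /ksq kconjM mulrA -(mulrA (kconj y)) kconj_mul -kreal_comm -mulrA kconj_mul.
by rewrite -krealM !kre_kreal.
Qed.

Lemma ksq_kconj x : ksq (kconj x) = ksq x.
Proof. by rewrite {1}/ksq kconjK mul_kconj kre_kreal. Qed.

Lemma kcoord0 c : kcoord (0 : K1) c = 0.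
Proof. by have := kcoordZ 0 0 c; rewrite mulr0 mul0r. Qed.

Lemma kcoordN x c : kcoord (- x) c = - kcoord x c.
Proof. by apply/eqP; rewrite -addr_eq0 -kcoordD addNr kcoord0. Qed.

Lemma kcoord_sum (J : Type) (s : seq J) (F : J -> K1) c :
  kcoord (\sum_(j <- s) F j) c = \sum_(j <- s) kcoord (F j) c.
Proof.
elim: s => [|j s IH]; first by rewrite !big_nil kcoord0.
by rewrite !big_cons kcoordD IH.
Qed.

Definition kunit c : K1 := kmk (fun c' => (c' == c)%:R).

Lemma kcoord_decomp x : x = \sum_c kreal k (kcoord x c) * kunit c.
Proof.
apply: kcoord_ext => c; rewrite kcoord_sum (bigD1 c)//= big1 ?addr0.
  by rewrite kcoordZ kmkK eqxx mulr1.
by move=> c' c'c; rewrite kcoordZ kmkK eq_sym (negbTE c'c) mulr0.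
Qed.

Lemma ksqN x : ksq (- x) = ksq x.
Proof. by rewrite !ksqE; apply: eq_bigr => c _; rewrite kcoordN sqrrN. Qed.

Lemma kconj0 : kconj (0 : K1) = 0.
Proof. by have := kconj_kreal 0; rewrite kreal0. Qed.

Lemma kconj1 : kconj (1 : K1) = 1.
Proof. by have := kconj_kreal 1; rewrite kreal1. Qed.

Lemma kconjN x : kconj (- x) = - kconj x.
Proof. by apply/eqP; rewrite -addr_eq0 -kconjD addNr kconj0. Qed.

Lemma kconj_sum (J : Type) (s : seq J) (F : J -> K1) :
  kconj (\sum_(j <- s) F j) = \sum_(j <- s) kconj (F j).
Proof.
elim: s => [|j s IH]; first by rewrite !big_nil kconj0.
by rewrite !big_cons kconjD IH.
Qed.

Lemma krealN a : kreal k (- a) = - kreal k a.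
Proof. by apply/eqP; rewrite -addr_eq0 -krealD addNr kreal0. Qed.

Lemma knorm_ge0 x : 0 <= knorm x.
Proof. exact: sqrtr_ge0. Qed.

Lemma knorm_sq x : knorm x ^+ 2 = ksq x.
Proof. by rewrite sqr_sqrtr// ksq_ge0. Qed.

Lemma knormM x y : knorm (x * y) = knorm x * knorm y.
Proof. by rewrite /knorm -sqrtrM ?ksq_ge0// -!/(ksq _) ksqM. Qed.

Lemma knormN x : knorm (- x) = knorm x.
Proof. by rewrite /knorm -!/(ksq _) ksqN. Qed.

Lemma knorm_kconj x : knorm (kconj x) = knorm x.
Proof. by rewrite /knorm -!/(ksq _) ksq_kconj. Qed.

Lemma knorm_kreal a : knorm (kreal k a) = `|a|.
Proof. by rewrite /knorm -!/(ksq _) ksq_kreal sqrtr_sqr. Qed.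

Lemma knorm0 : knorm (0 : K1) = 0.
Proof. by rewrite -kreal0 knorm_kreal normr0. Qed.

Lemma knorm1 : knorm (1 : K1) = 1.
Proof. by rewrite -kreal1 knorm_kreal normr1. Qed.

Lemma kcoord_sq_le x c : kcoord x c ^+ 2 <= ksq x.
Proof.
by rewrite ksqE (bigD1 c)//= lerDl sumr_ge0// => c' _; exact: sqr_ge0.
Qed.

Lemma kcoord_le x c : `|kcoord x c| <= knorm x.
Proof. by rewrite -sqrtr_sqr ler_wsqrtr// kcoord_sq_le. Qed.

Lemma ksq_eq0 x : ksq x = 0 -> x = 0.
Proof.
move=> x0; apply: kcoord_ext => c; rewrite kcoord0.
have := kcoord_sq_le x c; rewrite x0 => c0.
by apply/eqP; rewrite -sqrf_eq0; apply/eqP/le_anti; rewrite c0 sqr_ge0.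
Qed.

Lemma knorm_eq0 x : knorm x = 0 -> x = 0.
Proof. by move=> x0; apply: ksq_eq0; rewrite -knorm_sq x0 expr0n. Qed.

Lemma knorm_gt0 x : x != 0 -> 0 < knorm x.
Proof.
move=> x0; rewrite lt_neqAle knorm_ge0 andbT eq_sym.
by apply: contraNneq x0 => /knorm_eq0 ->.
Qed.

Lemma kre_le x : kre x <= knorm x.
Proof. exact: le_trans (ler_norm _) (kcoord_le x None). Qed.

Lemma ksqD x y : ksq (x + y) = ksq x + ksq y + 2 * kre (kconj x * y).
Proof.
rewrite {1}/ksq kconjD mulrDl !mulrDr !kreD -!/(ksq _).
have -> : kre (kconj y * x) = kre (kconj x * y).
  by rewrite -kre_kconj kconjM kconjK.
by ring.
Qed.

Lemma knormD x y : knorm (x + y) <= knorm x + knorm y.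
Proof.
rewrite -(@ler_pXn2r _ 2)// ?nnegrE ?knorm_ge0 ?addr_ge0 ?knorm_ge0//.
rewrite knorm_sq ksqD sqrrD !knorm_sq.
have := kre_le (kconj x * y); rewrite knormM knorm_kconj; lra.
Qed.

Lemma knorm_sum (J : Type) (s : seq J) (F : J -> K1) :
  knorm (\sum_(j <- s) F j) <= \sum_(j <- s) knorm (F j).
Proof.
elim: s => [|j s IH]; first by rewrite !big_nil knorm0.
by rewrite !big_cons (le_trans (knormD _ _))// lerD2l.
Qed.

(** A scalar has at most four real coordinates, whence the factor 2. *)
Lemma knorm_le_coord x (e : R) : 0 <= e -> (forall c, `|kcoord x c| <= e) -> knorm x <= 2 * e.
Proof.
move=> e0 xe; rewrite -(@ler_pXn2r _ 2)// ?nnegrE ?knorm_ge0 ?mulr_ge0//.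
rewrite knorm_sq ksqE; apply: (@le_trans _ _ (\sum_(c : option 'I_(imdim k)) e ^+ 2)).
  apply: ler_sum => c _; rewrite -real_normK ?num_real//.
  by rewrite lerXn2r// nnegrE.
rewrite sumr_const card_option card_ord exprMn -[leLHS]mulr_natl.
rewrite ler_wpM2r ?sqr_ge0//.
by rewrite -natrX ler_nat; case: k.
Qed.

Lemma kinv_ex x : x != 0 -> exists2 y, x * y = 1 & y * x = 1.
Proof.
move=> x0; have k0 : ksq x != 0 by apply: contraNneq x0 => /ksq_eq0 ->.
exists (kconj x * kreal k (ksq x)^-1).
  by rewrite mulrA mul_kconj -krealM mulfV ?kreal1.
by rewrite -mulrA kreal_comm mulrA kconj_mul -krealM mulfV ?kreal1.
Qed.

Lemma kim_coord x j : kcoord (kim x) (Some j) = kcoord x (Some j).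
Proof.
rewrite /kim kcoordD kcoordN.
have := kcoordZ (kre x) 1 (Some j); rewrite mulr1 => ->.
suff -> : kcoord (1 : K1) (Some j) = 0 by rewrite mulr0 subr0.
by rewrite /kcoord; move: j; case: k => //= -[[|[|[|j]]] ij].
Qed.

Lemma kim_re x : kre (kim x) = 0.
Proof. by rewrite /kim kreD kreN kre_kreal subrr. Qed.

Lemma kre_kim x : x = kreal k (kre x) + kim x.
Proof. by rewrite /kim addrC subrK. Qed.

Lemma kim_id x : kre x = 0 -> kim x = x.
Proof. by move=> x0; rewrite /kim x0 kreal0 subr0. Qed.

Lemma kimD x y : kim (x + y) = kim x + kim y.
Proof. by rewrite /kim kreD krealD opprD addrACA. Qed.

Lemma kimN x : kim (- x) = - kim x.
Proof. by rewrite /kim kreN krealN opprB addrC opprK. Qed.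

Lemma kconj_im x : kre x = 0 -> kconj x = - x.
Proof.
move=> x0; apply: kcoord_ext => c; rewrite kcoordN; case: c => [j|].
  rewrite /kcoord; move: x x0 j; case: k => [? _ []//|[? ?] _ j//|].
  by move=> [????] _ [[|[|[|j]]] ij].
by rewrite [LHS]kre_kconj [kcoord _ _]x0 oppr0.
Qed.

Lemma kim_kreal a : kim (kreal k a) = 0.
Proof. by rewrite /kim kre_kreal subrr. Qed.

Lemma kim0 : kim (0 : K1) = 0.
Proof. by rewrite /kim kre0 kreal0 subrr. Qed.

Lemma kconj_kim x : kconj (kim x) = - kim x.
Proof. by apply: kconj_im; exact: kim_re. Qed.

Lemma ksq_re_im a x : kre x = 0 -> ksq (kreal k a + x) = a ^+ 2 + ksq x.
Proof.
move=> x0; rewrite ksqD ksq_kreal kconj_kreal.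
by have := kcoordZ a x None; rewrite [kcoord x _]x0 mulr0 => E; rewrite [kre _]E mulr0 addr0.
Qed.

End ScalarAlgebra.

(** * The Cygan metric *)

Section CyganMetric.
Variables (R : realType) (k : scalar_kind) (n : nat).
Notation K1 := (scalars R k).
Notation pt := ('cV[K1]_n * K1)%type.
Implicit Types (z : 'cV[K1]_n) (p q r : pt).

Lemma hermdotDl z1 z2 z : hermdot (z1 + z2) z = hermdot z1 z + hermdot z2 z.
Proof.
by rewrite /hermdot -big_split; apply: eq_bigr => i _; rewrite mxE kconjD mulrDl.
Qed.

Lemma hermdotDr z z1 z2 : hermdot z (z1 + z2) = hermdot z z1 + hermdot z z2.
Proof. by rewrite /hermdot -big_split; apply: eq_bigr => i _; rewrite mxE mulrDr. Qed.

Lemma hermdotNl z z' : hermdot (- z) z' = - hermdot z z'.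
Proof. by rewrite /hermdot -sumrN; apply: eq_bigr => i _; rewrite mxE kconjN mulNr. Qed.

Lemma hermdotNr z z' : hermdot z (- z') = - hermdot z z'.
Proof. by rewrite /hermdot -sumrN; apply: eq_bigr => i _; rewrite mxE mulrN. Qed.

Lemma hermdot_kconj z z' : kconj (hermdot z z') = hermdot z' z.
Proof. by rewrite kconj_sum; apply: eq_bigr => i _; rewrite kconjM kconjK. Qed.

Lemma hermdot_sqnorm z : hermdot z z = kreal k (sqnorm z).
Proof.
rewrite /hermdot /sqnorm; elim/big_rec2: _ => [|i y1 y2 _ ->]; first by rewrite kreal0.
by rewrite krealD kconj_mul knorm_sq.
Qed.

Lemma sqnorm_ge0 z : 0 <= sqnorm z.
Proof. by apply: sumr_ge0 => i _; exact: sqr_ge0. Qed.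

Lemma sqnormN z : sqnorm (- z) = sqnorm z.
Proof. by apply: eq_bigr => i _; rewrite mxE knormN. Qed.

Lemma kreal_mul2 (a : R) : kreal k (2 * a) = kreal k a *+ 2.
Proof. by rewrite mulr_natl !mulr2n krealD. Qed.

Lemma sqnormD z z' : sqnorm (z + z') = sqnorm z + sqnorm z' + 2 * kre (hermdot z z').
Proof.
apply: (can_inj (kre_kreal k)).
rewrite -hermdot_sqnorm hermdotDl !hermdotDr !hermdot_sqnorm !krealD kreal_mul2.
have -> : kreal k (kre (hermdot z z')) *+ 2 = hermdot z z' + hermdot z' z.
  rewrite -[hermdot z' z]hermdot_kconj [in RHS](kre_kim (hermdot z z')).
  by rewrite kconjD kconj_kreal kconj_kim addrACA subrr addr0 mulr2n.
by rewrite -!addrA; congr (_ + _); rewrite addrA addrC.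
Qed.

Lemma cauchy_schwarz_sum (J : finType) (a b : J -> R) :
  (forall j, 0 <= a j) -> (forall j, 0 <= b j) ->
  \sum_j a j * b j <= Num.sqrt (\sum_j a j ^+ 2) * Num.sqrt (\sum_j b j ^+ 2).
Proof.
move=> a0 b0; set A2 := \sum_j a j ^+ 2; set B2 := \sum_j b j ^+ 2.
have A0 : 0 <= A2 by apply: sumr_ge0 => j _; exact: sqr_ge0.
have B0 : 0 <= B2 by apply: sumr_ge0 => j _; exact: sqr_ge0.
set A := Num.sqrt A2; set B := Num.sqrt B2.
have AE : A ^+ 2 = A2 by exact: sqr_sqrtr.
have BE : B ^+ 2 = B2 by exact: sqr_sqrtr.
have vanish (f g : J -> R) : \sum_j f j ^+ 2 = 0 -> \sum_j f j * g j = 0.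
  move=> f0; apply: big1 => j _; have /eqP := f0.
  rewrite psumr_eq0; last by move=> i _; exact: sqr_ge0.
  by move=> /allP/(_ j (mem_index_enum _))/=; rewrite sqrf_eq0 => /eqP ->; rewrite mul0r.
have [A20|A2n] := eqVneq A2 0.
  by rewrite vanish// mulr_ge0// sqrtr_ge0.
have [B20|B2n] := eqVneq B2 0.
  under eq_bigr do rewrite mulrC.
  by rewrite vanish// mulr_ge0// sqrtr_ge0.
have Ap : 0 < A by rewrite sqrtr_gt0 lt_neqAle eq_sym A2n.
have Bp : 0 < B by rewrite sqrtr_gt0 lt_neqAle eq_sym B2n.
have AB : 0 < 2 * (A * B) by rewrite !mulr_gt0.
rewrite -(ler_pM2l AB).
have -> : 2 * (A * B) * (A * B) = \sum_j (B ^+ 2 * a j ^+ 2 + A ^+ 2 * b j ^+ 2).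
  by rewrite big_split/= -!mulr_sumr -/A2 -/B2 -AE -BE; ring.
rewrite mulr_sumr; apply: ler_sum => j _.
have := sqr_ge0 (B * a j - A * b j); lra.
Qed.

Lemma hermdot_le z z' : knorm (hermdot z z') <= Num.sqrt (sqnorm z) * Num.sqrt (sqnorm z').
Proof.
apply: le_trans (knorm_sum _ _) _.
rewrite (eq_bigr (fun i => knorm (z i 0) * knorm (z' i 0))).
  by apply: cauchy_schwarz_sum => i; exact: knorm_ge0.
by move=> i _; rewrite knormM knorm_kconj.
Qed.

(** On the boundary its norm is the square of the gauge, and its value at h^-1 h' is, up to sign,
    the Hermitian product of the lifts of h and h'. *)
Definition heis p : K1 := kreal k (sqnorm p.1) + p.2.

Lemma gauge_ge0 p : 0 <= gauge p.
Proof. exact: sqrtr_ge0. Qed.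

Lemma gauge_heis p : kre p.2 = 0 -> gauge p = Num.sqrt (knorm (heis p)).
Proof. by move=> p0; rewrite /gauge /heis p0 normr0 addr0 kim_id. Qed.

Lemma gauge_sq p : kre p.2 = 0 -> gauge p ^+ 2 = knorm (heis p).
Proof. by move=> p0; rewrite gauge_heis// sqr_sqrtr// knorm_ge0. Qed.

Lemma gauge_4 p : kre p.2 = 0 -> gauge p ^+ 4 = sqnorm p.1 ^+ 2 + ksq p.2.
Proof.
by move=> p0; rewrite (exprM _ 2 2) gauge_sq// knorm_sq ksq_re_im.
Qed.

Lemma heis_mul p q : kre p.2 = 0 -> kre q.2 = 0 ->
  heis (iw_mul p q) = heis p + heis q + hermdot p.1 q.1 *+ 2.
Proof.
move=> p0 q0; rewrite /heis /= sqnormD !krealD kreal_mul2.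
have -> : hermdot p.1 q.1 *+ 2 =
    kreal k (kre (hermdot p.1 q.1)) *+ 2 + kim (hermdot p.1 q.1) *+ 2.
  by rewrite -mulrnDl -kre_kim.
by rewrite addrACA; congr (_ + _); rewrite addrACA.
Qed.

Lemma iw_mul_re p q : kre (iw_mul p q).2 = kre p.2 + kre q.2.
Proof. by rewrite /= kreD mulr2n [X in _ + X]kreD kim_re !addr0 kreD. Qed.

(** The squared gauge of a product is the norm of heis p + heis q + 2 <z, z'>. By Cauchy-Schwarz and
    the bound of the norm of z by the gauge, it is at most the square of the sum of the gauges. *)
Lemma gauge_mul p q : kre p.2 = 0 -> kre q.2 = 0 -> gauge (iw_mul p q) <= gauge p + gauge q.
Proof.
move=> p0 q0; have pq0 : kre (iw_mul p q).2 = 0 by rewrite iw_mul_re p0 q0 addr0.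
rewrite -(@ler_pXn2r _ 2)// ?nnegrE ?gauge_ge0 ?addr_ge0 ?gauge_ge0//.
rewrite gauge_sq// heis_mul// sqrrD !gauge_sq//.
apply: le_trans (knormD _ _) _.
have h1 := knormD (heis p) (heis q).
suff H2 : knorm (hermdot p.1 q.1) <= gauge p * gauge q.
  have := knormD (hermdot p.1 q.1) (hermdot p.1 q.1); rewrite -mulr2n; lra.
apply: le_trans (hermdot_le _ _) _.
have H r : kre r.2 = 0 -> Num.sqrt (sqnorm r.1) <= gauge r.
  move=> r0; rewrite gauge_heis// ler_wsqrtr//.
  have := kre_le (heis r); rewrite /heis kreD kre_kreal r0 addr0; exact.
by apply: ler_pM; rewrite ?sqrtr_ge0 ?H.
Qed.

Lemma kim_mul2D (x y : K1) : kim (x + y) *+ 2 = kim x *+ 2 + kim y *+ 2.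
Proof. by rewrite kimD [LHS]mulrnDl. Qed.

Lemma iw_mulA p q r : iw_mul p (iw_mul q r) = iw_mul (iw_mul p q) r.
Proof.
rewrite /iw_mul /= addrA hermdotDr hermdotDl 2!kim_mul2D; congr pair.
move: (kim (hermdot p.1 q.1) *+ 2) (kim (hermdot p.1 r.1) *+ 2) => a b.
move: (kim (hermdot q.1 r.1) *+ 2) => e.
by rewrite !addrA [LHS](ACl (1*2*5*3*6*4))/=.
Qed.

Lemma kim_hermdot_self z : kim (hermdot z z) = 0.
Proof. by rewrite hermdot_sqnorm kim_kreal. Qed.

Definition iw_inv p : pt := (- p.1, - p.2).

Lemma iw_mul0 p : iw_mul (0, 0) p = p.
Proof.
rewrite /iw_mul /= !add0r /hermdot big1 => [|i _]; last by rewrite mxE kconj0 mul0r.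
by rewrite kim0 mul0rn addr0; case: p.
Qed.

Lemma iw_mulV p : iw_mul (iw_inv p) p = (0, 0).
Proof. by rewrite /iw_mul /= !addNr hermdotNl kimN kim_hermdot_self oppr0 mul0rn addr0. Qed.

Lemma iw_mulVr p q : iw_mul (iw_inv p) (iw_mul p q) = q.
Proof. by rewrite iw_mulA iw_mulV iw_mul0. Qed.

Lemma iw_mulrV p q : iw_mul p (iw_mul (iw_inv p) q) = q.
Proof.
rewrite iw_mulA (_ : iw_mul p (iw_inv p) = (0, 0)) ?iw_mul0//.
by rewrite /iw_mul /= !subrr hermdotNr kimN kim_hermdot_self oppr0 mul0rn addr0.
Qed.

Lemma iw_inv_re p : kre p.2 = 0 -> kre (iw_inv p).2 = 0.
Proof. by move=> p0; rewrite /= kreN p0 oppr0. Qed.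

Lemma gauge_inv p : kre p.2 = 0 -> gauge (iw_inv p) = gauge p.
Proof.
move=> p0; rewrite !gauge_heis ?iw_inv_re//; congr Num.sqrt.
rewrite -knorm_kconj /heis kconjD kconj_kreal kconj_im ?iw_inv_re//=.
by rewrite sqnormN opprK.
Qed.

Lemma cyganE p q : cygan p q = gauge (iw_mul (iw_inv p) q).
Proof. by []. Qed.

Lemma kim_hermdotC z z' : kim (hermdot z' z) = - kim (hermdot z z').
Proof.
rewrite -hermdot_kconj {1}(kre_kim (hermdot z z')) kconjD kconj_kreal kconj_kim.
by rewrite kimD kim_kreal add0r kimN (kim_id (kim_re _)).
Qed.

Lemma iw_inv_mul p q : iw_inv (iw_mul p q) = iw_mul (iw_inv q) (iw_inv p).
Proof.
rewrite /iw_inv /iw_mul /= hermdotNl hermdotNr opprK (kim_hermdotC q.1).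
move: (kim (hermdot q.1 p.1)) => a.
congr pair; first by rewrite opprD addrC.
by rewrite mulNrn opprD opprK (addrC (- q.2)) -(opprD p.2).
Qed.

Lemma iw_invK p : iw_inv (iw_inv p) = p.
Proof. by rewrite /iw_inv /= !opprK; case: p. Qed.

Lemma cyganC p q : kre p.2 = 0 -> kre q.2 = 0 -> cygan p q = cygan q p.
Proof.
move=> p0 q0; rewrite !cyganE -gauge_inv; last by rewrite iw_mul_re iw_inv_re// add0r.
by rewrite iw_inv_mul iw_invK.
Qed.

Lemma cyganD p q r : kre p.2 = 0 -> kre q.2 = 0 -> kre r.2 = 0 ->
  cygan p r <= cygan p q + cygan q r.
Proof.
move=> p0 q0 r0; rewrite !cyganE.
apply: le_trans (gauge_mul _ _); rewrite ?iw_mul_re ?iw_inv_re ?q0 ?r0 ?addr0//.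
by rewrite -iw_mulA iw_mulrV.
Qed.

Lemma sqnorm_eq0 z : sqnorm z = 0 -> z = 0.
Proof.
move=> /eqP; rewrite psumr_eq0; last by move=> i _; exact: sqr_ge0.
move=> /allP z0; apply/matrixP => i j; rewrite mxE (ord1 j).
by apply: knorm_eq0; apply/eqP; rewrite -sqrf_eq0; exact: z0 (mem_index_enum _).
Qed.

Lemma gauge_eq0 p : kre p.2 = 0 -> gauge p = 0 -> p = (0, 0).
Proof.
move=> p0 g0; have := gauge_4 p0; rewrite g0 expr0n/= => /esym/eqP.
rewrite paddr_eq0 ?sqr_ge0 ?ksq_ge0// sqrf_eq0 => /andP[/eqP/sqnorm_eq0 z0 /eqP/ksq_eq0 t0].
by move: z0 t0; case: (p) => ? ? /= -> ->.
Qed.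

Lemma gauge0 : gauge ((0, 0) : pt) = 0.
Proof.
rewrite gauge_heis ?kre0// /heis /= addr0 /sqnorm big1 => [|i _].
  by rewrite kreal0 knorm0 sqrtr0.
by rewrite mxE knorm0 expr0n.
Qed.

Lemma cygan_eq0 p q : kre p.2 = 0 -> kre q.2 = 0 -> cygan p q = 0 -> p = q.
Proof.
move=> p0 q0 /gauge_eq0; rewrite iw_mul_re/= !kreN p0 q0 oppr0 addr0 => /(_ erefl) E.
have := iw_mulrV p q; rewrite [iw_mul (iw_inv p) q]E => <-.
rewrite /iw_mul /= !addr0 /hermdot big1 => [|i _]; last by rewrite mxE mulr0.
by rewrite kim0 mul0rn addr0; case: (p).
Qed.

End CyganMetric.

(** * Real coordinates *)

Arguments kcoord {R k} x c : simpl never.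

Section Coordinates.
Variables (R : realType) (k : scalar_kind) (n : nat) (i0 : 'I_n).
Notation K1 := (scalars R k).
Notation pt := ('cV[K1]_n * K1)%type.
Implicit Types (p q r : pt).

Definition coords : finType := ('I_n * option 'I_(imdim k) + 'I_(imdim k))%type.
Implicit Types (x y z : coords -> R).

Definition dec x : pt := (\col_i kmk (fun c => x (inl (i, c))),
  kmk (fun c => if c is Some j then x (inr j) else 0)).

Definition enc p : coords -> R := fun c =>
  match c with inl (i, c) => kcoord (p.1 i 0) c | inr j => kcoord p.2 (Some j) end.

Lemma decK x : enc (dec x) = x.
Proof. by apply/funext => -[[i c]|j]; rewrite /enc /dec /= ?mxE kmkK. Qed.

Lemma encK p : kre p.2 = 0 -> dec (enc p) = p.
Proof.
case: p => z t /= t0; congr pair.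
  by apply/matrixP => i j; rewrite mxE (ord1 j); apply: kcoord_ext => c; rewrite kmkK.
by apply: kcoord_ext => -[j|]; rewrite kmkK//= [RHS]t0.
Qed.

Lemma dec_re x : kre (dec x).2 = 0.
Proof. exact: (kmkK (fun c => if c is Some j then x (inr j) else 0) None). Qed.

Definition dS x y := cygan (dec x) (dec y).

(** Matrix of the term 2 Im <z, z'> of the group law. It feeds coordinates of z' into the central
    coordinates only, so left translations are affine maps of the kind that preserves the outer
    measure. *)
Definition mul_coeff x (a b : coords) : R :=
  match a, b with
  | inr j, inl (i, c) => 2 * kcoord (kconj ((dec x).1 i 0) * kunit R c) (Some j)
  | _, _ => 0
  end.

Definition trans x := affine x (mul_coeff x).

Lemma kcoord_mul (a b : K1) c :
  kcoord (a * b) c = \sum_e kcoord (a * kunit R e) c * kcoord b e.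
Proof.
rewrite {1}(kcoord_decomp b) mulr_sumr kcoord_sum; apply: eq_bigr => e _.
by rewrite mulrA -kreal_comm -mulrA kcoordZ mulrC.
Qed.

Lemma enc_mul x y : enc (iw_mul (dec x) (dec y)) = trans x y.
Proof.
apply/funext => -[[i c]|j]; rewrite /trans /affine /enc.
  rewrite big1 => [|b _]; last by rewrite mul0r.
  by rewrite addr0 /= mxE kcoordD !mxE !kmkK.
rewrite /iw_mul [LHS]/= 2!kcoordD !kmkK -addrA; congr (_ + (_ + _)).
rewrite mulr2n kcoordD kim_coord big_sumType/= [X in _ = _ + X]big1 => [|b _]; last first.
  by rewrite mul0r.
rewrite addr0 /hermdot kcoord_sum -big_split/=.
rewrite (eq_bigr (fun b => mul_coeff x (inr j) (inl (b.1, b.2)) * y (inl (b.1, b.2)))); last by case.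
rewrite -(pair_bigA _ (fun i c => mul_coeff x (inr j) (inl (i, c)) * y (inl (i, c))))/=.
apply: eq_bigr => i _; rewrite kcoord_mul -big_split; apply: eq_bigr => c _ /=.
by rewrite !mxE !kmkK; ring.
Qed.

Lemma dec_trans x y : dec (trans x y) = iw_mul (dec x) (dec y).
Proof. by rewrite -enc_mul encK// iw_mul_re !dec_re addr0. Qed.

Definition opp x : coords -> R := fun c => - x c.

Lemma dec_opp x : dec (opp x) = iw_inv (dec x).
Proof.
rewrite -[RHS]encK ?iw_inv_re ?dec_re//; congr dec; apply/funext => -[[i c]|j].
  by rewrite /enc /= !mxE kcoordN kmkK.
by rewrite /enc /= kcoordN kmkK.
Qed.

Lemma dec_inj : injective dec.
Proof. exact: can_inj decK. Qed.

Lemma transK x : cancel (trans x) (trans (opp x)).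
Proof. by move=> y; apply: dec_inj; rewrite !dec_trans dec_opp iw_mulVr. Qed.

Lemma transVK x : cancel (trans (opp x)) (trans x).
Proof. by move=> y; apply: dec_inj; rewrite !dec_trans dec_opp iw_mulrV. Qed.

Lemma dS_gauge x y : dS x y = gauge (dec (trans (opp x) y)).
Proof. by rewrite dec_trans dec_opp. Qed.

(** Weights of the Heisenberg dilations, for which central coordinates scale quadratically; [hdim]
    is the homogeneous dimension, and left translates of the boxes [qbox] replace the Cygan
    balls. *)
Definition weight (c : coords) : nat := if c is inl _ then 1%N else 2%N.
Definition hdim := (\sum_c weight c)%N.

Definition qbox (s : R) : set (coords -> R) :=
  box (fun c => - s ^+ weight c) (fun c => s ^+ weight c).

Definition cell x (s : R) : set (coords -> R) := trans x @` qbox s.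

Local Notation c0 := (inl (i0, None) : coords).
Local Notation mu := (leb c0 : set (coords -> R) -> \bar R).

Lemma trans_le x A : (mu (trans x @` A) <= mu A)%E.
Proof.
apply: (@louter_affine_le _ _ c0 _ _ (fun c : coords => if c is inr _ then true else false)).
by move=> [?|?] [[? ?]|?] //=; rewrite eqxx.
Qed.

Lemma cell_caratheodory x s : mu.-caratheodory (cell x s).
Proof.
apply: caratheodory_image; first exact: transK.
- exact: transVK.
- by move=> A; exact: trans_le.
- by move=> A; exact: trans_le.
- exact: caratheodory_box.
Qed.

Lemma cell_measure x (s : R) : 0 <= s -> mu (cell x s) = (2 ^+ #|coords| * s ^+ hdim)%:E.
Proof.
move=> s0; rewrite /cell (louter_image_eq (transK x)).
- rewrite louter_box => [|c]; last by rewrite ge0_cp ?exprn_ge0.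
  congr EFin; rewrite /vol (eq_bigr (fun c => 2 * s ^+ weight c)); last by move=> c _; ring.
  by rewrite big_split/= prodr_const prodrXr.
- by move=> A; exact: trans_le.
- by move=> A; exact: trans_le.
Qed.

Lemma sqrt_sqnorm_le p : kre p.2 = 0 -> Num.sqrt (sqnorm p.1) <= gauge p.
Proof.
move=> p0; rewrite gauge_heis// ler_wsqrtr//.
have := kre_le (heis p); rewrite /heis kreD kre_kreal p0 addr0; exact.
Qed.

Lemma coord_le_gauge x c : `|x c| <= gauge (dec x) ^+ weight c.
Proof.
have x0 := dec_re x; have g0 := gauge_ge0 (dec x).
rewrite -{1}[x]decK; case: c => [[i c]|j].
  apply: le_trans (kcoord_le _ _) _; apply: le_trans (sqrt_sqnorm_le x0).
  rewrite -[knorm _]ger0_norm ?knorm_ge0// -sqrtr_sqr ler_wsqrtr//.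
  by rewrite /sqnorm (bigD1 i)//= lerDl sumr_ge0// => ? _; exact: sqr_ge0.
apply: le_trans (kcoord_le _ _) _.
rewrite -(@ler_pXn2r _ 2)// ?nnegrE ?knorm_ge0 ?exprn_ge0//.
by rewrite -exprM knorm_sq gauge_4// lerDr sqr_ge0.
Qed.

(** The fourth power of the gauge is at most (M^2 + M) s^4, where M is the number of coordinates,
    and (1 + M)^4 exceeds M^2 + M. With the previous lemma, this makes cells comparable to balls. *)
Lemma gauge_le_coord x (s : R) : 0 <= s -> (forall c, `|x c| <= s ^+ weight c) ->
  gauge (dec x) <= (1 + #|coords|%:R) * s.
Proof.
move=> s0 xs; have x0 := dec_re x.
set M : R := #|coords|%:R; have M0 : 0 <= M by rewrite ler0n.
have sq c : x c ^+ 2 <= (s ^+ weight c) ^+ 2.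
  by rewrite -real_normK ?num_real// lerXn2r ?nnegrE ?exprn_ge0.
have sum_le (P : pred coords) (v : R) : 0 <= v -> (forall c, P c -> (s ^+ weight c) ^+ 2 = v) ->
    \sum_(c | P c) x c ^+ 2 <= M * v.
  move=> v0 Pv; apply: (@le_trans _ _ (\sum_(c : coords) v)).
    rewrite [leRHS](bigID P)/= -[leLHS]addr0; apply: lerD; last by apply: sumr_ge0.
    by apply: ler_sum => c Pc; rewrite -(Pv _ Pc).
  by rewrite sumr_const -mulr_natl.
have z_le : sqnorm (dec x).1 <= M * s ^+ 2.
  apply: le_trans (sum_le (fun c => if c is inl _ then true else false) _ (sqr_ge0 s) _).
    rewrite big_sumType/= [X in _ + X]big_pred0// addr0.
    rewrite (eq_bigr (fun b => x (inl (b.1, b.2)) ^+ 2)); last by case.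
    rewrite -(pair_bigA _ (fun i c => x (inl (i, c)) ^+ 2))/= /sqnorm.
    apply: ler_sum => i _; rewrite knorm_sq ksqE; apply: ler_sum => c _.
    by rewrite mxE kmkK.
  by case.
have t_le : ksq (dec x).2 <= M * s ^+ 4.
  have s40 : 0 <= s ^+ 4 by rewrite exprn_ge0.
  apply: le_trans (sum_le (fun c => if c is inr _ then true else false) _ s40 _).
    rewrite big_sumType/= [X in X + _]big_pred0 ?add0r; last by case.
    rewrite ksqE (bigID (fun c => c == None))/= big_pred1_eq [kcoord _ None]x0 expr0n add0r.
    rewrite (reindex_omap Some id)/=; last by case.
    by rewrite le_eqVlt; apply/orP; left; apply/eqP; apply: eq_big => [j|j _]; rewrite ?eqxx// kmkK.
  by case=> // j _; rewrite -exprM.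
rewrite -(@ler_pXn2r _ 4)// ?nnegrE ?gauge_ge0 ?mulr_ge0 ?addr_ge0//.
rewrite gauge_4// exprMn.
have zz : sqnorm (dec x).1 ^+ 2 <= (M * s ^+ 2) ^+ 2.
  by rewrite lerXn2r ?nnegrE ?sqnorm_ge0 ?mulr_ge0 ?sqr_ge0.
apply: (@le_trans _ _ ((M ^+ 2 + M) * s ^+ 4)).
  by rewrite mulrDl; apply: lerD => //; rewrite exprMn -exprM in zz.
rewrite ler_wpM2r ?exprn_ge0//.
have M2 : 0 <= M ^+ 2 by rewrite sqr_ge0.
have M3 : 0 <= M ^+ 3 by rewrite exprn_ge0.
have M4 : 0 <= M ^+ 4 by rewrite exprn_ge0.
have -> : (1 + M) ^+ 4 = 1 + 4 * M + 6 * M ^+ 2 + 4 * M ^+ 3 + M ^+ 4 by ring.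
by lra.
Qed.

Lemma finite_min_gt0 (J : finType) (f : J -> R) : (forall j, 0 < f j) ->
  exists2 e : R, 0 < e & forall j, e <= f j.
Proof.
move=> f0; suff [e e0 ef] : exists2 e : R, 0 < e & forall j, j \in enum J -> e <= f j.
  by exists e => // j; apply: ef; rewrite mem_enum.
elim: (enum J) => [|j s [e e0 ef]]; first by exists 1.
exists (Num.min e (f j)); first by rewrite lt_min e0 f0.
by move=> i; rewrite inE => /orP[/eqP ->|/ef le]; rewrite ge_min ?lexx ?orbT// le.
Qed.

(** Write y as x times u. Once d(x, y) <= 1, all coordinates of u are at most d(x, y), those of
    weight 2 included; left translation by x then changes coordinate c by at most (1 + M c) d(x, y),
    where M c sums a row of the translation matrix. *)
Lemma open_box_nbhs x a b : (forall c, a c < x c < b c) ->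
  exists2 s : R, 0 < s & forall y, dS x y < s -> forall c, a c < y c < b c.
Proof.
move=> xab.
pose M c : R := \sum_b `|mul_coeff x c b|.
have M0 c : 0 <= M c by apply: sumr_ge0.
have [e e0 ef] : exists2 e : R, 0 < e & forall c,
    e <= Num.min (x c - a c) (b c - x c) / (1 + M c).
  apply: finite_min_gt0 => c; have /andP[h1 h2] := xab c.
  by rewrite divr_gt0 ?lt_min ?subr_gt0 ?h1//; have := M0 c; lra.
exists (Num.min 1 e); first by rewrite lt_min ltr01.
move=> y xy; set u := trans (opp x) y.
have yE : y = trans x u by rewrite transVK.
set g := dS x y in xy; have g0 : 0 <= g by exact: gauge_ge0.
have g1 : g <= 1 by apply/ltW/(lt_le_trans xy); rewrite ge_min lexx.
have ge : g < e by apply: lt_le_trans xy _; rewrite ge_min lexx orbT.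
have ug c : `|u c| <= g.
  apply: le_trans (coord_le_gauge _ _) _; rewrite -dS_gauge -/g.
  by case: c => [a0|a0]; rewrite /weight ?expr1// expr2 ler_piMr.
move=> c; have M1 : 0 < 1 + M c by have := M0 c; lra.
have yc : `|y c - x c| < Num.min (x c - a c) (b c - x c).
  rewrite yE /trans /affine addrC addKr.
  apply: (@le_lt_trans _ _ (g * (1 + M c))); last first.
    by rewrite -ltr_pdivlMr//; exact: lt_le_trans ge (ef c).
  apply: le_trans (ler_normD _ _) _; rewrite mulrDr mulr1; apply: lerD => //.
  apply: le_trans (ler_norm_sum _ _ _) _; rewrite /M mulr_sumr; apply: ler_sum => j _.
  by rewrite normrM mulrC ler_wpM2r.
move: yc; rewrite lt_min !ltr_norml => /andP[/andP[h1 h2] /andP[h3 h4]].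
by apply/andP; split; lra.
Qed.

Lemma cell_regular : regular_measure dS (leb c0 : {outer_measure set (coords -> R) -> \bar R})
  cell (2 ^+ #|coords|) (1 + #|coords|%:R) hdim.
Proof.
have re0 x := dec_re x.
have M0 : (0 : R) <= #|coords|%:R by rewrite ler0n.
split.
- by move=> x; rewrite /dS cyganE iw_mulV gauge0.
- by move=> x y; exact: cyganC.
- by move=> x y z; exact: cyganD.
- by move=> x y /cygan_eq0 => /(_ (re0 x) (re0 y)) /dec_inj.
- by rewrite exprn_gt0.
- by rewrite lerDl.
- move=> x; rewrite -subset0 => v [u us _]; have := us c0.
  by rewrite /= expr1 oppr0 => /andP[/le_lt_trans h /h]; rewrite ltxx.
- exact: cell_caratheodory.
- exact: cell_measure.
- move=> x y s xy; exists (trans (opp x) y); last exact: transVK.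
  have g0 : 0 <= dS x y by exact: gauge_ge0.
  have s0 : 0 <= s by apply: le_trans (ltW xy).
  move=> c; have := coord_le_gauge (trans (opp x) y) c; rewrite -dS_gauge ler_norml.
  have : dS x y ^+ weight c < s ^+ weight c.
    by rewrite ltrXn2r//; case: c.
  by move=> h /andP[h1 h2]; apply/andP; split; lra.
- move=> x _ s [u us <-]; have := us c0; rewrite /= expr1 => /andP[h1 h2].
  have s0 : 0 <= s by lra.
  rewrite dS_gauge transK; apply: gauge_le_coord => // c.
  by rewrite ler_norml; have /andP[-> /ltW] := us c.
- move=> A e e0 Afin.
  have [ab [AO le]] := louter_open_cover (i0 := c0) e0 Afin.
  exists (open_boxes ab); split => // x [m xm].
  have [s s0 sP] := open_box_nbhs xm.
  by exists s => // y xy; exists m => i; exact: sP.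
Qed.

Lemma hdim_gt0 : (0 < hdim)%N.
Proof. by rewrite /hdim (bigD1 c0). Qed.

(** A point of the first real axis: its translates supply points at any prescribed distance. *)
Definition axis (s : R) : coords -> R := fun c => if c == c0 then s else 0.

Lemma gauge_axis (s : R) : gauge (dec (axis s)) = `|s|.
Proof.
rewrite gauge_heis ?dec_re// /heis.
have -> : (dec (axis s)).2 = 0.
  by apply: kcoord_ext => c; rewrite kmkK kcoord0; case: c.
have -> : (dec (axis s)).1 = \col_i (if i == i0 then kreal k s else 0).
  apply/matrixP => i j; rewrite !mxE; apply: kcoord_ext => c; rewrite kmkK /axis.
  have [->|ii0] := eqVneq i i0.
    have := kcoordZ s (1 : K1) c; rewrite mulr1 => ->.
    case: c => [c|]; last by rewrite eqxx /kcoord -(kreal1 R k) kre_kreal mulr1.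
    rewrite -(kim_coord (1 : K1)) -(kreal1 R k) kim_kreal kcoord0 mulr0.
    by case: eqP.
  by rewrite kcoord0; case: eqP => // -[] E; rewrite E eqxx in ii0.
have -> : sqnorm (\col_i (if i == i0 then kreal k s else 0) : 'cV[K1]_n) = s ^+ 2.
  rewrite /sqnorm (bigD1 i0)//= big1 => [|i ii0].
    by rewrite mxE eqxx knorm_kreal real_normK ?num_real// addr0.
  by rewrite mxE (negbTE ii0) knorm0 expr0n.
by rewrite addr0 knorm_kreal ger0_norm ?sqr_ge0// sqrtr_sqr.
Qed.

Lemma dS_axis x (s : R) : dS x (trans x (axis s)) = `|s|.
Proof. by rewrite dS_gauge transK gauge_axis. Qed.

End Coordinates.

(** * The unitary group of J *)

Section QuaternionMatrices.
Variable R : realType.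

Definition cpart1 (x : quat R) : R[i] := Complex (qre x) (qi x).
Definition cpart2 (x : quat R) : R[i] := Complex (qj x) (qk x).

Lemma cpart1_sum (J : Type) (s : seq J) (F : J -> quat R) :
  cpart1 (\sum_(j <- s) F j) = \sum_(j <- s) cpart1 (F j).
Proof. by elim: s => [|j s IH]; rewrite ?big_nil// !big_cons -IH. Qed.

Lemma cpart2_sum (J : Type) (s : seq J) (F : J -> quat R) :
  cpart2 (\sum_(j <- s) F j) = \sum_(j <- s) cpart2 (F j).
Proof. by elim: s => [|j s IH]; rewrite ?big_nil// !big_cons -IH. Qed.

Lemma cpart1M x y : cpart1 (x * y) =
  cpart1 x * cpart1 y - cpart2 x * conjc (cpart2 y).
Proof. by case: x y => [????] [????]; congr Complex => /=; ring. Qed.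

Lemma cpart2M x y : cpart2 (x * y) =
  cpart1 x * cpart2 y + cpart2 x * conjc (cpart1 y).
Proof. by case: x y => [????] [????]; congr Complex => /=; ring. Qed.

Variable m : nat.
Implicit Types A B : 'M[quat R]_m.

(* Provides the determinants by which one-sided inverses of quaternionic
   matrices are two-sided. *)
Definition complexify A : 'M[R[i]]_(m + m) :=
  block_mx (map_mx cpart1 A) (map_mx cpart2 A)
    (- map_mx conjc (map_mx cpart2 A)) (map_mx conjc (map_mx cpart1 A)).

Lemma map_cpart1M A B : map_mx cpart1 (A *m B) =
  map_mx cpart1 A *m map_mx cpart1 B - map_mx cpart2 A *m map_mx conjc (map_mx cpart2 B).
Proof.
apply/matrixP => i j; rewrite !mxE cpart1_sum -sumrB.
by apply: eq_bigr => l _; rewrite cpart1M !mxE.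
Qed.

Lemma map_cpart2M A B : map_mx cpart2 (A *m B) =
  map_mx cpart1 A *m map_mx cpart2 B + map_mx cpart2 A *m map_mx conjc (map_mx cpart1 B).
Proof.
apply/matrixP => i j; rewrite !mxE cpart2_sum -big_split.
by apply: eq_bigr => l _; rewrite cpart2M !mxE.
Qed.

Lemma map_conjcK (X : 'M[R[i]]_m) : map_mx conjc (map_mx conjc X) = X.
Proof. by apply/matrixP => i j; rewrite !mxE conjcK. Qed.

Lemma complexifyM A B : complexify (A *m B) = complexify A *m complexify B.
Proof.
rewrite /complexify mulmx_block map_cpart1M map_cpart2M; congr block_mx.
- by rewrite mulmxN.
- rewrite map_mxD !map_mxM /= map_conjcK mulNmx mulmxN opprD addrC.
  by [].
- by rewrite map_mxB !map_mxM /= map_conjcK mulNmx addrC.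
Qed.

Lemma complexify_inj : injective complexify.
Proof.
move=> A B /eq_block_mx[/matrixP E1 /matrixP E2 _ _]; apply/matrixP => i j.
have := E1 i j; have := E2 i j; rewrite !mxE => -[? ?] [? ?].
exact: quat_eq.
Qed.

Lemma complexify1 : complexify 1%:M = 1%:M.
Proof.
rewrite /complexify scalar_mx_block.
have E1 : map_mx cpart1 (1%:M : 'M[quat R]_m) = 1%:M.
  by apply/matrixP => i j; rewrite !mxE; case: (i == j).
have E2 : map_mx cpart2 (1%:M : 'M[quat R]_m) = 0.
  by apply/matrixP => i j; rewrite !mxE; case: (i == j).
by rewrite E1 E2 map_mx1 map_mx0 oppr0.
Qed.

Lemma quat_mulmx1C A B : A *m B = 1%:M -> B *m A = 1%:M.
Proof.
move=> AB; apply: complexify_inj.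
by rewrite complexifyM complexify1; apply: mulmx1C; rewrite -complexifyM AB complexify1.
Qed.

End QuaternionMatrices.

Lemma scalars_mulmx1C (R : realType) (k : scalar_kind) (m : nat)
  (A B : 'M[scalars R k]_m) : A *m B = 1%:M -> B *m A = 1%:M.
Proof.
move: A B; case: k => A B /=; [exact: (@mulmx1C R)|exact: (@mulmx1C R[i])|].
exact: quat_mulmx1C.
Qed.

(** * The form J on lifts of points *)

Section HermitianForm.
Variables (R : realType) (k : scalar_kind) (n : nat).
Notation K1 := (scalars R k).
Notation dim := (1 + (n + 1))%N.
Notation J := (formJ R k n).
Implicit Types (p q : option (siegel R k n)) (A B : 'M[K1]_dim).

Definition adj (m1 m2 : nat) (A : 'M[K1]_(m1, m2)) : 'M[K1]_(m2, m1) :=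
  map_mx (@kconj R k) A^T.

Lemma adjM m1 m2 m3 (A : 'M[K1]_(m1, m2)) (B : 'M[K1]_(m2, m3)) :
  adj (A *m B) = adj B *m adj A.
Proof.
apply/matrixP => i j; rewrite !mxE kconj_sum; apply: eq_bigr => l _.
by rewrite kconjM !mxE.
Qed.

Lemma adjK m1 m2 (A : 'M[K1]_(m1, m2)) : adj (adj A) = A.
Proof. by apply/matrixP => i j; rewrite !mxE kconjK. Qed.

Lemma adj_scalar m (c : K1) : adj (c%:M : 'M[K1]_m) = (kconj c)%:M.
Proof.
apply/matrixP => i j; rewrite !mxE eq_sym; case: (i == j); first by rewrite !mulr1n.
by rewrite !mulr0n kconj0.
Qed.

Lemma adj_col m1 m2 m3 (A : 'M[K1]_(m1, m3)) (B : 'M[K1]_(m2, m3)) :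
  adj (col_mx A B) = row_mx (adj A) (adj B).
Proof. by rewrite /adj tr_col_mx map_row_mx. Qed.

Definition vec (a : K1) (b : 'cV[K1]_n) (c : K1) : 'cV[K1]_dim :=
  col_mx a%:M (col_mx b c%:M).

Lemma vecP (v : 'cV[K1]_dim) : exists a b c, v = vec a b c.
Proof.
exists (usubmx v 0 0), (usubmx (dsubmx v)), (dsubmx (dsubmx v) 0 0).
rewrite /vec -[LHS]vsubmxK; congr col_mx.
  by apply/matrixP => i j; rewrite !ord1 !mxE mulr1n.
rewrite -[LHS]vsubmxK; congr col_mx.
by apply/matrixP => i j; rewrite !ord1 !mxE mulr1n.
Qed.

Lemma mulJ_vec a b c : J *m vec a b c = vec (- c) b (- a).
Proof.
rewrite /formJ /vec mul_block_col mul0mx add0r mul_row_col mul0mx add0r.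
rewrite mulNmx mul1mx mul_col_mx mul0mx mulNmx mul1mx mul_block_col.
rewrite mul1mx !mul0mx !addr0 add_col_mx add0r addr0.
by congr col_mx; [|congr col_mx]; apply/matrixP => i j; rewrite !ord1 !mxE !mulr1n.
Qed.

Lemma mx_eq_cols m1 m2 (A B : 'M[K1]_(m1, m2)) :
  (forall v : 'cV[K1]_m2, A *m v = B *m v) -> A = B.
Proof.
move=> AB; apply/matrixP => i j.
by have /matrixP/(_ i 0) := AB (delta_mx j 0); rewrite -!colE !mxE.
Qed.

Lemma mulJJ : J *m J = 1%:M.
Proof.
apply: mx_eq_cols => v; have [a [b [c ->]]] := vecP v.
by rewrite -mulmxA !mulJ_vec !opprK mul1mx.
Qed.

Definition jform (v w : 'cV[K1]_dim) : K1 := (adj v *m (J *m w)) 0 0.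

Lemma jform_vec a b c a' b' c' :
  jform (vec a b c) (vec a' b' c') = hermdot b b' - kconj a * c' - kconj c * a'.
Proof.
rewrite /jform mulJ_vec /vec !adj_col mul_row_col mul_row_col !adj_scalar.
have S (x y : K1) : ((x%:M : 'M[K1]_1) *m (y%:M : 'M[K1]_1)) 0 0 = x * y.
  by rewrite !mxE big_ord1 !mxE /= !mulr1n.
rewrite mxE [X in _ + X]mxE !S addrA [_ + (adj b *m b') 0 0]addrC !mulrN.
by congr (_ - _ - _); rewrite mxE; apply: eq_bigr => i _; rewrite !mxE.
Qed.

Lemma mulmx_scalar11 m (v : 'cV[K1]_m) (c : K1) i : (v *m (c%:M : 'M[K1]_1)) i 0 = v i 0 * c.
Proof. by rewrite !mxE big_ord1 !mxE /= mulr1n. Qed.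

Lemma mul_scalar11mx (v : 'M[K1]_1) (c : K1) : ((c%:M : 'M[K1]_1) *m v) 0 0 = c * v 0 0.
Proof. by rewrite !mxE big_ord1 !mxE /= mulr1n. Qed.

Lemma vecZ a b c (e : K1) : vec a b c *m (e%:M : 'M[K1]_1) =
  vec (a * e) (b *m (e%:M : 'M[K1]_1)) (c * e).
Proof.
rewrite /vec !mul_col_mx; congr col_mx; last congr col_mx.
  by apply/matrixP => i j; rewrite !ord1 mulmx_scalar11 !mxE !mulr1n.
by apply/matrixP => i j; rewrite !ord1 mulmx_scalar11 !mxE !mulr1n.
Qed.

Lemma vec_inj a b c a' b' c' : vec a b c = vec a' b' c' -> [/\ a = a', b = b' & c = c'].
Proof.
move=> /eq_col_mx[/matrixP/(_ 0 0) + /eq_col_mx[-> /matrixP/(_ 0 0)]].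
by rewrite !mxE !mulr1n.
Qed.

Lemma jformZ v w (a b : K1) :
  jform (v *m (a%:M : 'M[K1]_1)) (w *m (b%:M : 'M[K1]_1)) = kconj a * jform v w * b.
Proof.
rewrite /jform adjM adj_scalar !mulmxA mulmx_scalar11; congr (_ * _).
by rewrite -!mulmxA mul_scalar11mx.
Qed.

Lemma jform_unitary A v w : unitaryJ A -> jform (A *m v) (A *m w) = jform v w.
Proof.
move=> UA; rewrite /jform adjM -[in RHS]UA !mulmxA.
by [].
Qed.

Lemma scalars_mulf_neq0 (a b : K1) : a != 0 -> b != 0 -> a * b != 0.
Proof.
move=> a0 b0; apply/eqP => ab; have := knormM a b; rewrite ab knorm0 => /esym/eqP.
by rewrite mulf_eq0 !gt_eqF ?knorm_gt0.
Qed.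

Definition unitary_inv (A : 'M[K1]_dim) := J *m adj A *m J.

Lemma unitary_invK A : unitaryJ A -> unitary_inv A *m A = 1%:M.
Proof. by move=> UA; rewrite /unitary_inv -!mulmxA [adj A *m _]mulmxA UA mulJJ. Qed.

Lemma unitary_invVK A : unitaryJ A -> A *m unitary_inv A = 1%:M.
Proof. by move=> UA; apply: scalars_mulmx1C; exact: unitary_invK. Qed.

Lemma unitaryJM A B : unitaryJ A -> unitaryJ B -> unitaryJ (A *m B).
Proof.
move=> UA UB; rewrite /unitaryJ -/(adj _) adjM -!mulmxA (mulmxA J) (mulmxA (adj A)).
by rewrite (mulmxA (adj A)) [adj A *m _ *m _]UA mulmxA.
Qed.

Lemma unitaryJ1 : unitaryJ (1%:M : 'M[K1]_dim).
Proof. by rewrite /unitaryJ -/(adj _) adj_scalar kconj1 mul1mx mulmx1. Qed.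

Lemma adj0 m1 m2 : adj (0 : 'M[K1]_(m1, m2)) = 0.
Proof. by apply/matrixP => i j; rewrite !mxE kconj0. Qed.

Lemma adjN m1 m2 (X : 'M[K1]_(m1, m2)) : adj (- X) = - adj X.
Proof. by apply/matrixP => i j; rewrite !mxE kconjN. Qed.

Lemma adjJ : adj J = J.
Proof.
have adjB m1 m2 m3 m4 (X : 'M[K1]_(m1, m3)) (Y : 'M[K1]_(m1, m4))
    (U : 'M[K1]_(m2, m3)) (V : 'M[K1]_(m2, m4)) :
    adj (block_mx X Y U V) = block_mx (adj X) (adj U) (adj Y) (adj V).
  by rewrite /adj tr_block_mx map_block_mx.
have adjR m1 m2 m3 (X : 'M[K1]_(m1, m2)) (Y : 'M[K1]_(m1, m3)) :
    adj (row_mx X Y) = col_mx (adj X) (adj Y).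
  by rewrite /adj tr_row_mx map_col_mx.
by rewrite /formJ !adjB adj_col adjR !adj0 !adjN !adj_scalar kconj1.
Qed.

Lemma unitaryJV A : unitaryJ A -> unitaryJ (unitary_inv A).
Proof.
move=> UA; have E := unitary_invVK UA.
rewrite /unitaryJ -/(adj _) {1}/unitary_inv !adjM adjJ adjK.
rewrite -[_ *m J *m unitary_inv A]mulmxA -!mulmxA (mulmxA J J) mulJJ mul1mx.
by rewrite [A *m _]E mulmx1.
Qed.

Definition lift_pt (h : 'cV[K1]_n * K1) : 'cV[K1]_dim :=
  vec 1 (kreal k (Num.sqrt 2) *: h.1) (h.2 + kreal k (sqnorm h.1)).

Lemma phiE p : phi p = if p is Some h then lift_pt (\val h) else vec 0 0 1.
Proof. by case: p => [h|] //=; rewrite /vec raddf0. Qed.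

Lemma jform_lift_pt h h' : jform (lift_pt h) (lift_pt h') =
  hermdot h.1 h'.1 *+ 2 - (h'.2 + kreal k (sqnorm h'.1)) -
  kconj (h.2 + kreal k (sqnorm h.1)).
Proof.
rewrite jform_vec kconj1 mul1r mulr1; congr (_ - _ - _).
have E : kreal k (Num.sqrt 2) * kreal k (Num.sqrt 2) = kreal k (2 * 1) :> K1.
  by rewrite -krealM -expr2 sqr_sqrtr ?mulr1// ler0n.
rewrite /hermdot -[RHS]sumrMnl; apply: eq_bigr => i _; rewrite !mxE kconjM kconj_kreal.
rewrite -mulrA (mulrA (kreal _ _)) E kreal_comm mulrA -kreal_comm kreal_mul2 kreal1.
by rewrite mulrnAl mul1r.
Qed.

(** Lifts are thus nonpositive vectors, and null exactly on the boundary; this is how unitary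
    matrices are seen to preserve both. *)
Lemma jform_lift_pt_self h : jform (lift_pt h) (lift_pt h) = kreal k (- 2 * kre h.2).
Proof.
rewrite jform_lift_pt hermdot_sqnorm kconjD kconj_kreal.
set s := kreal k _; rewrite mulNr krealN kreal_mul2.
have -> : kreal k (kre h.2) *+ 2 = h.2 + kconj h.2.
  rewrite [in RHS](kre_kim h.2) kconjD kconj_kreal kconj_kim addrACA subrr addr0.
  by rewrite mulr2n.
move: (kconj h.2) => b; rewrite mulr2n -!addrA; move: s => s.
rewrite !opprD !addrA [LHS](ACl (1*4*2*6*3*5))/= !subrr !add0r.
by rewrite subrr add0r.
Qed.

(** The link between the form and the metric: the right-hand side has norm the squared Cygan
    distance. *)
Lemma jform_lift_pt_boundary h h' : kre h.2 = 0 -> kre h'.2 = 0 ->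
  jform (lift_pt h) (lift_pt h') = - heis (iw_mul (iw_inv h) h').
Proof.
move=> h0 h'0; rewrite jform_lift_pt heis_mul ?iw_inv_re// hermdotNl mulNrn.
rewrite kconjD kconj_kreal kconj_im// /heis /= sqnormN.
move: (hermdot _ _ *+ 2) (kreal k (sqnorm h.1)) (kreal k (sqnorm h'.1)) => x a b.
by rewrite !opprD !opprK !addrA [RHS](ACl (5*4*3*2*1))/=.
Qed.

End HermitianForm.

(** * Moebius transformations *)

Section MoebiusGroup.
Variables (R : realType) (k : scalar_kind) (n : nat).
Notation K1 := (scalars R k).
Notation dim := (1 + (n + 1))%N.
Notation point := (option (siegel R k n)).
Implicit Types (p q : point) (A B : 'M[K1]_dim) (g h : point -> point).

Definition bdry p := if p is Some u then XX u else True.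

Lemma hermdot0l (z : 'cV[K1]_n) : hermdot 0 z = 0.
Proof. by rewrite /hermdot big1// => i _; rewrite mxE kconj0 mul0r. Qed.

Lemma hermdot0r (z : 'cV[K1]_n) : hermdot z 0 = 0.
Proof. by rewrite /hermdot big1// => i _; rewrite mxE mulr0. Qed.

Lemma vec0 : vec (0 : K1) 0 0 = 0 :> 'cV[K1]_dim.
Proof. by rewrite /vec !raddf0 !col_mx0. Qed.

Lemma phi_neq0 p : phi p <> 0.
Proof.
rewrite phiE -vec0; case: p => [u|] /vec_inj[] E1 _ E2.
  by move/eqP: E1; rewrite oner_eq0.
by move/eqP: E2; rewrite oner_eq0.
Qed.

Lemma scalar_cancel (x y c : K1) : c != 0 -> x * c = y * c -> x = y.
Proof.
by move=> /kinv_ex[d cd _] E; rewrite -[x]mulr1 -[y]mulr1 -cd !mulrA E.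
Qed.

Lemma phi_inj p q (c c' : K1) : c != 0 -> c' != 0 ->
  phi p *m (c%:M : 'M[K1]_1) = phi q *m (c'%:M : 'M[K1]_1) -> p = q.
Proof.
move=> c0 c'0; rewrite !phiE; case: p => [u|]; case: q => [v|] //=.
- rewrite /lift_pt !vecZ => /vec_inj[]; rewrite !mul1r => <- E1 E2; congr Some; apply: val_inj.
  have E : (\val u).1 = (\val v).1.
    apply/matrixP => i j; rewrite !ord1.
    have /matrixP/(_ i 0) := E1; rewrite !mulmx_scalar11 !mxE => /(scalar_cancel c0).
    move=> /(congr1 (fun x => kreal k (Num.sqrt 2)^-1 * x)).
    by rewrite !mulrA -!krealM mulVf ?kreal1 ?mul1r// gt_eqF// sqrtr_gt0 ltr0n.
  move: E2 => /(scalar_cancel c0); rewrite E => /addIr E2.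
  by apply: injective_projections.
- rewrite /lift_pt !vecZ => /vec_inj[]; rewrite mul1r mul0r => E.
  by rewrite E eqxx in c0.
- rewrite /lift_pt !vecZ => /vec_inj[]; rewrite mul1r mul0r => E.
  by rewrite -E eqxx in c'0.
Qed.

(** The image vector is nonzero and the form is nonpositive on it. If its first entry vanishes, the
    form is the squared norm of the middle entries, which must be 0: the point is infinity.
    Otherwise, scaling on the right makes the first entry 1, and the sign of the form says that the
    real part is nonnegative. Applied to inverse matrices, this inverts Moebius maps. *)
Lemma unitary_point A q : unitaryJ A -> exists p, exists2 c : K1, c != 0 &
  A *m phi q = phi p *m (c%:M : 'M[K1]_1).
Proof.
move=> UA; have [a [b [e E]]] := vecP (A *m phi q).
have [s s0 fs] : exists2 s : R, s <= 0 & jform (vec a b e) (vec a b e) = kreal k s.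
  rewrite -E jform_unitary// phiE; case: (q) => [[h h0]|]; last first.
    by exists 0 => //; rewrite jform_vec hermdot0l kconj0 mul0r mulr0 !subr0 kreal0.
  by exists (- 2 * kre h.2); [rewrite mulNr oppr_le0 mulr_ge0|rewrite jform_lift_pt_self].
have [a0|a0] := eqVneq a 0.
  exists None, e; last by rewrite E phiE vecZ a0 mul0r mul1r mul0mx; congr vec;
    move: fs; rewrite jform_vec a0 kconj0 mul0r mulr0 !subr0 hermdot_sqnorm;
    move=> /(congr1 (@kre R k)); rewrite !kre_kreal => bs;
    apply: sqnorm_eq0; apply: le_anti; rewrite sqnorm_ge0 bs s0.
  apply/eqP => e0.
  have b0 : b = 0.
    move: fs; rewrite jform_vec a0 kconj0 mul0r mulr0 !subr0 hermdot_sqnorm.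
    move=> /(congr1 (@kre R k)); rewrite !kre_kreal => bs.
    by apply: sqnorm_eq0; apply: le_anti; rewrite sqnorm_ge0 bs s0.
  apply: (phi_neq0 (p := q)); rewrite -[phi q]mul1mx -(unitary_invK UA) -mulmxA E.
  by rewrite a0 b0 e0 vec0 mulmx0.
have [a' aa' a'a] := kinv_ex a0.
pose z : 'cV[K1]_n := kreal k (Num.sqrt 2)^-1 *: (b *m (a'%:M : 'M[K1]_1)).
pose w := e * a' - kreal k (sqnorm z).
have s2 : Num.sqrt 2 * (Num.sqrt 2)^-1 = 1 :> R.
  by rewrite mulfV// gt_eqF// sqrtr_gt0 ltr0n.
have vE : vec a b e = lift_pt (z, w) *m (a%:M : 'M[K1]_1).
  rewrite /lift_pt vecZ /= mul1r /w subrK -mulrA a'a mulr1; congr vec.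
  apply/matrixP => i j; rewrite !ord1 mulmx_scalar11 !mxE big_ord1 !mxE /= mulr1n.
  by rewrite mulrA -krealM s2 kreal1 mul1r -mulrA a'a mulr1.
have w0 : 0 <= kre w.
  move: fs; rewrite vE jformZ jform_lift_pt_self -kreal_comm -mulrA kconj_mul -krealM.
  move=> /(congr1 (@kre R k)); rewrite !kre_kreal /= => ws.
  have ka : 0 < ksq a by rewrite -knorm_sq exprn_gt0// knorm_gt0.
  rewrite -(pmulr_lge0 _ ka); lra.
by exists (Some (exist _ (z, w) w0)), a => //; rewrite E vE phiE.
Qed.

Lemma induces_comp A B g h : induces A g -> induces B h -> induces (A *m B) (g \o h).
Proof.
move=> Ag Bh p; have [c c0 E] := Bh p; have [c' c'0 E'] := Ag (h p).
exists (c' * c); first exact: scalars_mulf_neq0.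
rewrite -mulmxA E mulmxA E' -mulmxA; congr (_ *m _).
by apply/matrixP => i j; rewrite !ord1 mulmx_scalar11 !mxE /= !mulr1n.
Qed.

Lemma induces1 : induces (1%:M : 'M[K1]_dim) idfun.
Proof. by move=> p; exists 1; [exact: oner_neq0|rewrite mul1mx mulmx1]. Qed.

Lemma induces_inv A g : unitaryJ A -> induces A g ->
  exists gi, [/\ induces (unitary_inv A) gi, cancel g gi & cancel gi g].
Proof.
move=> UA ind; have UV := unitaryJV UA.
have [gi giP] := choice (fun q => unitary_point q UV).
have ind' : induces (unitary_inv A) gi by exact: giP.
have c1 : induces 1%:M (gi \o g) by rewrite -(unitary_invK UA); exact: induces_comp.
have c2 : induces 1%:M (g \o gi) by rewrite -(unitary_invVK UA); exact: induces_comp.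
have id_of (f : point -> point) : induces 1%:M f -> f =1 id.
  move=> F p; have [c c0] := F p; rewrite mul1mx -[LHS]mulmx1 => E.
  exact: esym (phi_inj (oner_neq0 K1) c0 E).
by exists gi; split => // p; [exact: (id_of _ c1)|exact: (id_of _ c2)].
Qed.

Lemma minvE g gi : cancel g gi -> cancel gi g -> minv g = gi.
Proof.
move=> gK giK; apply/funext => p; apply: (can_inj gK); rewrite giK.
by apply: (@pinvK _ _ _ setT); rewrite inE; exists (gi p).
Qed.

Lemma moebius_inv g : moebius g ->
  [/\ moebius (minv g), cancel g (minv g) & cancel (minv g) g].
Proof.
move=> [A UA ind]; have [gi [ind' gK giK]] := induces_inv UA ind.
rewrite (minvE gK giK); split => //.
by exists (unitary_inv A) => //; exact: unitaryJV.
Qed.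

Lemma moebius_subgroup : is_subgroup (@moebius R k n).
Proof.
split => //.
- by exists 1%:M; [exact: unitaryJ1|exact: induces1].
- move=> g h [A UA Ag] [B UB Bh]; exists (A *m B); [exact: unitaryJM|exact: induces_comp].
- by move=> g /moebius_inv[].
Qed.

Lemma generated_subgroup (S : set (point -> point)) : S `<=` @moebius R k n ->
  is_subgroup (generated S) /\ S `<=` generated S.
Proof.
move=> Sm; split; last exact: sub_smallest.
have sub H : is_subgroup H -> S `<=` H -> generated S `<=` H.
  by move=> sH SH g; apply.
split.
- exact: sub moebius_subgroup Sm.
- by move=> H [[_ ? _ _] _].
- move=> g h gg gh H [sH SH]; case: (sH) => _ _ HM _.
  by apply: HM; [exact: gg|exact: gh].
- move=> g gg H [sH SH]; case: (sH) => _ _ _ HV.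
  by apply: HV; exact: gg.
Qed.

(** A choice of lift to [U(J)]; the default 0 concerns only maps that are not Moebius. *)
Definition mat g : 'M[K1]_dim := xget 0 [set A | unitaryJ A /\ induces A g].

Lemma matP g : moebius g -> unitaryJ (mat g) /\ induces (mat g) g.
Proof.
by move=> [A UA ind]; rewrite /mat; case: xgetP => [B _ //|/(_ A)[]].
Qed.

Definition coef g p : K1 :=
  xget 0 [set c : K1 | c != 0 /\ mat g *m phi p = phi (g p) *m (c%:M : 'M[K1]_1)].

Lemma coefP g p : moebius g -> coef g p != 0 /\
  mat g *m phi p = phi (g p) *m ((coef g p)%:M : 'M[K1]_1).
Proof.
move=> /matP[_ /(_ p)[c c0 E]]; rewrite /coef; case: xgetP => [d _ //|/(_ c)].
by case.
Qed.

(** Invariance of the form reads d(p, q)^2 = |c_p| |c_q| d(g p, g q)^2, with the scalars c given by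
    [coef]; hence the power -1 / 2. *)
Definition lam g p : R := (Num.sqrt (knorm (coef g p)))^-1.

Lemma lam_gt0 g p : moebius g -> 0 < lam g p.
Proof. by move=> /(coefP p)[c0 _]; rewrite invr_gt0 sqrtr_gt0 knorm_gt0. Qed.

Lemma lam_coef g p : moebius g -> lam g p ^+ 2 * knorm (coef g p) = 1.
Proof.
move=> /(coefP p)[c0 _]; rewrite exprVn sqr_sqrtr ?knorm_ge0//.
by rewrite mulVf// gt_eqF// knorm_gt0.
Qed.

Lemma moebius_bdry g p : moebius g -> bdry p -> bdry (g p).
Proof.
move=> Mg; have [UA ind] := matP Mg.
case E : (g p) => [u|] // bp; have [c c0 Ec] := ind p.
have := jform_unitary (phi p) (phi p) UA; rewrite Ec jformZ E [phi (Some u)]phiE.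
rewrite jform_lift_pt_self -kreal_comm -mulrA kconj_mul -krealM.
have -> : jform (phi p) (phi p) = kreal k 0.
  rewrite phiE; case: (p) bp => [h /= h0|_].
    by rewrite jform_lift_pt_self h0 mulr0.
  by rewrite jform_vec hermdot0l kconj0 mul0r mulr0 !subr0 kreal0.
move=> /(congr1 (@kre R k)); rewrite !kre_kreal => /eqP.
rewrite mulf_eq0 [ksq c == 0]gt_eqF ?orbF; last by rewrite -knorm_sq exprn_gt0// knorm_gt0.
by rewrite mulf_eq0 oppr_eq0 pnatr_eq0/= => /eqP.
Qed.

Definition dhs p q : R :=
  match p, q with
  | Some u, Some v => cygan (\val u) (\val v)
  | None, None => 0
  | _, _ => 1
  end.

Lemma dhs_ge0 p q : 0 <= dhs p q.
Proof. by case: p; case: q => // *; exact: gauge_ge0. Qed.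

(** The origin of the convention that infinity is at distance 1 from every point: the form takes the
    value -1 on the vector (0, 0, 1) and any lift. *)
Lemma jform_phi p q : bdry p -> bdry q -> knorm (jform (phi p) (phi q)) = dhs p q ^+ 2.
Proof.
rewrite !phiE; case: p => [u|]; case: q => [v|] //= bu bv.
- by rewrite jform_lift_pt_boundary// knormN cyganE gauge_sq// iw_mul_re iw_inv_re// bv addr0.
- by rewrite jform_vec hermdot0r kconj1 mul1r mulr0 subr0 sub0r knormN knorm1 expr1n.
- by rewrite jform_vec hermdot0l kconj0 mul0r kconj1 mul1r subr0 sub0r knormN knorm1 expr1n.
- by rewrite jform_vec hermdot0r kconj0 mul0r mulr0 !subr0 knorm0 expr0n.
Qed.

Lemma lamP g p q : moebius g -> bdry p -> bdry q ->
  dhs (g p) (g q) = lam g p * lam g q * dhs p q.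
Proof.
move=> Mg bp bq; have [UA _] := matP Mg.
have [cp0 Ep] := coefP p Mg; have [cq0 Eq] := coefP q Mg.
have lp := lam_gt0 p Mg; have lq := lam_gt0 q Mg.
apply/eqP; rewrite -(@eqrXn2 _ 2)// ?dhs_ge0 ?mulr_ge0 ?dhs_ge0 ?ltW//; apply/eqP.
rewrite -jform_phi; [|exact: moebius_bdry|exact: moebius_bdry].
rewrite !exprMn -(jform_phi bp bq) -(jform_unitary (phi p) (phi q) UA) Ep Eq jformZ !knormM knorm_kconj.
have := lam_coef p Mg; have := lam_coef q Mg.
move: (knorm (coef g p)) (knorm (coef g q)) (knorm (jform _ _)) => x y f hy hx.
rewrite -[LHS]mul1r -{1}hx -[LHS]mul1r -{1}hy; ring.
Qed.

End MoebiusGroup.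

(** * Discreteness *)

Definition pick_or (T : Type) (x0 : T) (P : set T) : T :=
  if pselect (exists x, P x) is left H then projT1 (cid H) else x0.

Lemma pick_orP (T : Type) (x0 : T) (P : set T) x : P x -> P (pick_or x0 P).
Proof.
by move=> Px; rewrite /pick_or; case: pselect => [H|[]]; [case: (cid H)|exists x].
Qed.

Section Discreteness.
Variables (R : realType) (k : scalar_kind) (n : nat).
Notation K1 := (scalars R k).
Notation dim := (1 + (n + 1))%N.
Notation point := (option (siegel R k n)).
Implicit Types (p q : point) (A B : 'M[K1]_dim) (g h : point -> point).

Definition mxle (m1 m2 : nat) (X : 'M[K1]_(m1, m2)) (a : R) :=
  forall i j, knorm (X i j) <= a.

Lemma mxle_mul m1 m2 m3 (X : 'M[K1]_(m1, m2)) (Y : 'M[K1]_(m2, m3)) (a b : R) :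
  mxle X a -> mxle Y b -> mxle (X *m Y) (m2%:R * (a * b)).
Proof.
move=> Xa Yb i j; rewrite mxE; apply: le_trans (knorm_sum _ _) _.
apply: (@le_trans _ _ (\sum_(l < m2) (a * b))); last by rewrite sumr_const card_ord -(mulr_natl (a * b)).
by apply: ler_sum => l _; rewrite knormM ler_pM ?knorm_ge0.
Qed.

Lemma mxle_ex m1 m2 (X : 'M[K1]_(m1, m2)) : exists2 a : R, 0 <= a & mxle X a.
Proof.
exists (\sum_i \sum_j knorm (X i j)).
  by apply: sumr_ge0 => i _; apply: sumr_ge0 => j _; exact: knorm_ge0.
move=> i j; rewrite (bigD1 i)//= (bigD1 j)//= -addrA lerDl addr_ge0//.
  by apply: sumr_ge0 => l _; exact: knorm_ge0.
by apply: sumr_ge0 => l _; apply: sumr_ge0 => m _; exact: knorm_ge0.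
Qed.

Lemma mxle_adj m1 m2 (X : 'M[K1]_(m1, m2)) a : mxle X a -> mxle (adj X) a.
Proof. by move=> Xa i j; rewrite !mxE knorm_kconj. Qed.

Lemma mxle_vec (a : K1) (b : 'cV[K1]_n) (c : K1) (x : R) : knorm a <= x ->
  (forall i, knorm (b i 0) <= x) -> knorm c <= x -> mxle (vec a b c) x.
Proof.
move=> ax bx cx i j; rewrite /vec !mxE; case: splitP => i' _.
  by rewrite !ord1 mxE mulr1n.
by rewrite !mxE; case: splitP => i'' _; rewrite ?ord1 ?mxE ?mulr1n.
Qed.

Lemma delta_vec (j : 'I_dim) : (delta_mx j 0 : 'cV[K1]_dim) = vec 1 0 0 \/
  (exists i, (delta_mx j 0 : 'cV[K1]_dim) = vec 0 (delta_mx i 0) 0) \/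
  (delta_mx j 0 : 'cV[K1]_dim) = vec 0 0 1.
Proof.
rewrite /vec !raddf0 -[delta_mx j 0]vsubmxK -[dsubmx _]vsubmxK.
case: (split_ordP j) => j' ->.
  left; rewrite ord1; congr col_mx; last congr col_mx;
    by apply/matrixP => a b; rewrite !mxE ?ord1 ?(eq_lrshift, eq_rlshift) ?mulr1n.
case: (split_ordP j') => j'' ->.
  right; left; exists j''; congr col_mx; last congr col_mx;
    by apply/matrixP => a b; rewrite !mxE ?ord1
      !(eq_rshift, eq_lshift, eq_lrshift, eq_rlshift) ?eqxx ?mulr1n.
right; right; rewrite ord1; congr col_mx; last congr col_mx;
  by apply/matrixP => a b; rewrite !mxE ?ord1
      !(eq_rshift, eq_lshift, eq_lrshift, eq_rlshift) ?eqxx ?mulr1n.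
Qed.

Definition horizontal (z : 'cV[K1]_n) : siegel R k n :=
  exist _ (z, 0) (eq_ind_r (fun r => 0 <= r) (lexx 0) (kre0 R k)).

Lemma gauge_horizontal z : gauge (\val (horizontal z)) = Num.sqrt (sqnorm z).
Proof.
rewrite gauge_heis /heis /= ?kre0// addr0 knorm_kreal ger0_norm//.
exact: sqnorm_ge0.
Qed.

Lemma sqnorm_delta (s : R) i : sqnorm (kreal k s *: delta_mx i 0 : 'cV[K1]_n) = s ^+ 2.
Proof.
rewrite /sqnorm (bigD1 i)//= big1 => [|j ji].
  by rewrite !mxE !eqxx mulr1 knorm_sq ksq_kreal addr0.
by rewrite !mxE (negbTE ji) /= mulr0 knorm0 expr0n.
Qed.

Variable i0 : 'I_n.

(** On the lift of a point u of the unit ball, [mat g] gives the lift of u', which is bounded, times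
    a scalar of norm lam^-2 <= L^2. The lifts of the origin and of the unit horizontal points +e_l
    and -e_l suffice to bound every column: the lift of the origin is the first basis vector,
    differences of the lifts of +e_l and -e_l give the middle ones, and half their sum minus the
    lift of the origin gives the last one. *)
Lemma near_origin_bounded (L : R) : 0 < L -> exists2 b : R, 0 <= b & forall g, moebius g ->
  (forall u, XX u -> gauge (\val u) <= 1 -> exists u',
    [/\ g (Some u) = Some u', gauge (\val u') <= L & L^-1 <= lam g (Some u)]) ->
  mxle (mat g) b.
Proof.
(* [P] dominates the entries of a lift of gauge at most L, namely 1, sqrt 2 times L and L^2. *)
move=> L0; pose P := 1 + 2 * L + L ^+ 2.
have L20 : 0 < L ^+ 2 by rewrite exprn_gt0.
pose b1 := P * L ^+ 2.
have P0 : 0 <= P by rewrite /P; lra.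
have b10 : 0 <= b1 by rewrite mulr_ge0// ltW.
exists (2 * b1) => [|g Mg near]; first by rewrite mulr_ge0.
have s20 : 0 < Num.sqrt 2 :> R by rewrite sqrtr_gt0.
have s22 : Num.sqrt 2 ^+ 2 = 2 :> R by rewrite sqr_sqrtr.
have s2a : 1 <= Num.sqrt (2 : R).
  by rewrite -(@ler_pXn2r _ 2) ?nnegrE ?(ltW s20)// s22 expr1n; lra.
have s2b : Num.sqrt (2 : R) <= 2.
  by rewrite -(@ler_pXn2r _ 2) ?nnegrE ?(ltW s20)// s22 expr2; lra.
have img u : XX u -> gauge (\val u) <= 1 -> mxle (mat g *m lift_pt (\val u)) b1.
  move=> Xu u1 i j; have [u' [gu u'L lu]] := near u Xu u1.
  have Xu' : XX u' by have := moebius_bdry (p := Some u) Mg Xu; rewrite gu.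
  have [c0 Ec] := coefP (Some u) Mg; rewrite gu !phiE in Ec.
  rewrite Ec !ord1 mulmx_scalar11 knormM.
  have cL : knorm (coef g (Some u)) <= L ^+ 2.
    have := lam_coef (Some u) Mg; set c := knorm _ => E.
    have l0 := lam_gt0 (Some u) Mg.
    have : 1 <= L * lam g (Some u) by rewrite -ler_pdivrMl// mulr1.
    move=> /(ler_wpM2r) H; have cc0 : 0 <= c by exact: knorm_ge0.
    have l2 : 1 <= (L * lam g (Some u)) ^+ 2.
      by apply: exprn_ege1; rewrite -ler_pdivrMl// mulr1.
    have := ler_wpM2r cc0 l2; rewrite mul1r exprMn -mulrA E mulr1.
    exact.
  apply: ler_pM; rewrite ?knorm_ge0//.
  have g0 := gauge_ge0 (\val u').
  have gg : gauge (\val u') ^+ 2 <= L ^+ 2 by rewrite lerXn2r ?nnegrE// ltW.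
  apply: mxle_vec.
  - by rewrite knorm1 /P; lra.
  - move=> l; rewrite !mxE knormM knorm_kreal (ger0_norm (ltW s20)).
    apply: (@le_trans _ _ (2 * L)); last by rewrite /P; lra.
    apply: ler_pM; rewrite ?knorm_ge0 ?(ltW s20)//.
    apply: le_trans u'L; rewrite gauge_heis//.
    rewrite -[knorm _]ger0_norm ?knorm_ge0// -sqrtr_sqr ler_wsqrtr//.
    apply: (@le_trans _ _ (sqnorm (\val u').1)).
      by rewrite /sqnorm (bigD1 l)//= lerDl sumr_ge0// => ? _; exact: sqr_ge0.
    by have := kre_le (heis (\val u')); rewrite /heis kreD kre_kreal [kre _.2]Xu' addr0.
  - rewrite addrC -/(heis _) -gauge_sq//; apply: le_trans gg _; rewrite /P; lra.
have imgz z : sqnorm z <= 1 -> mxle (mat g *m lift_pt (z, 0)) b1.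
  move=> z1; apply: (img (horizontal z)); first exact: kre0.
  by rewrite gauge_horizontal -sqrtr1 ler_wsqrtr.
have sq0 : sqnorm (0 : 'cV[K1]_n) = 0.
  by rewrite /sqnorm big1// => i _; rewrite mxE knorm0 expr0n.
have l0 : lift_pt (0, 0) = vec 1 0 0 :> 'cV[K1]_dim.
  by rewrite /lift_pt /= sq0 kreal0 addr0 scaler0.
have bnd (s : R) i : s ^+ 2 = 1 -> mxle (mat g *m vec 1 (kreal k (Num.sqrt 2 * s) *: delta_mx i 0) 1) b1.
  move=> s1; have := imgz (kreal k s *: delta_mx i 0).
  rewrite sqnorm_delta s1 => /(_ (lexx _)).
  by rewrite /lift_pt /= sqnorm_delta s1 kreal1 add0r scalerA -krealM.
have addl (v w : 'cV[K1]_dim) x y : mxle (mat g *m v) x -> mxle (mat g *m w) y ->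
    mxle (mat g *m (v + w)) (x + y).
  move=> vx wy i j; rewrite mulmxDr mxE; apply: le_trans (knormD _ _) _.
  exact: lerD.
have scl (v : 'cV[K1]_dim) (c : R) x : mxle (mat g *m v) x ->
    mxle (mat g *m (v *m ((kreal k c)%:M : 'M[K1]_1))) (x * `|c|).
  move=> vx i j; rewrite mulmxA !ord1 mulmx_scalar11 knormM knorm_kreal.
  by rewrite ler_wpM2r.
have vecD a b e a' b' e' : vec a b e + vec a' b' e' = vec (a + a') (b + b') (e + e') :> 'cV[K1]_dim.
  by rewrite /vec !add_col_mx !raddfD.
have one2 : (- 1) ^+ 2 = 1 :> R by rewrite sqrrN expr1n.
have Nsq i : kreal k (Num.sqrt 2 * -1) *: delta_mx i 0 =
    - (kreal k (Num.sqrt 2 * 1) *: delta_mx i 0) :> 'cV[K1]_n.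
  by rewrite mulrN krealN scaleNr.
move=> i j; have -> : mat g i j = (mat g *m (delta_mx j 0 : 'cV[K1]_dim)) i 0 by rewrite -colE mxE.
suff : mxle (mat g *m (delta_mx j 0 : 'cV[K1]_dim)) (2 * b1) by exact.
have [->|[[l ->]|->]] := delta_vec j.
- move=> a b; rewrite -l0; apply: le_trans (imgz 0 _ a b) _; first by rewrite sq0.
  by rewrite ler_peMl//; lra.
- have := scl _ (2 * Num.sqrt 2)^-1 _ (addl _ _ _ _ (bnd 1 l (expr1n _ _))
     (scl _ (-1) _ (bnd (-1) l one2))).
  rewrite [vec 1 _ 1 *m _]vecZ vecD vecZ.
  have -> : (1 + 1 * kreal k (- 1)) * kreal k (2 * Num.sqrt 2)^-1 = 0 :> K1.
    by rewrite mul1r krealN kreal1 subrr mul0r.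
  have -> : (kreal k (Num.sqrt 2 * 1) *: delta_mx l 0 +
     (kreal k (Num.sqrt 2 * -1) *: delta_mx l 0) *m ((kreal k (- 1))%:M : 'M[K1]_1)) *m
     ((kreal k (2 * Num.sqrt 2)^-1)%:M : 'M[K1]_1) = delta_mx l 0 :> 'cV[K1]_n.
    apply/matrixP => a b; rewrite !ord1 mulmx_scalar11 mxE mulmx_scalar11 !mxE.
    case: (_ && _); last by rewrite !mulr0 mul0r add0r mul0r.
    rewrite !mulr1 -!krealM -krealD -krealM -[RHS]kreal1; congr (kreal k _).
    by field; rewrite gt_eqF.
  move=> H a b; apply: le_trans (H a b) _.
  rewrite normrN1 mulr1 gtr0_norm ?invr_gt0 ?mulr_gt0//.
  rewrite ler_pdivrMr ?mulr_gt0//.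
  have : 0 <= b1 * (Num.sqrt 2 - 1) by rewrite mulr_ge0// subr_ge0.
  by lra.
- have := addl _ _ _ _ (scl _ (2^-1) _ (addl _ _ _ _ (bnd 1 i0 (expr1n _ _)) (bnd (-1) i0 one2)))
    (scl _ (-1) _ (imgz 0 _)).
  rewrite sq0 => /(_ ler01); rewrite l0 vecD !vecZ vecD.
  have -> : (1 + 1) * kreal k 2^-1 + 1 * kreal k (-1) = 0 :> K1.
    rewrite -kreal1 -krealD -!krealM -krealD -kreal0; congr (kreal k _); lra.
  have -> : (1 + 1) * kreal k 2^-1 + 0 * kreal k (-1) = 1 :> K1.
    rewrite mul0r addr0 -kreal1 -krealD -!krealM; congr (kreal k _); lra.
  rewrite Nsq subrr !mul0mx addr0 => H a b; apply: le_trans (H a b) _.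
  by rewrite normrN1 mulr1 gtr0_norm ?invr_gt0//; lra.
Qed.

Variable G : set (point -> point).
Hypothesis sG : is_subgroup G.
Hypothesis dG : discrete_subset G.

Let GM : G `<=` @moebius R k n. Proof. by case: sG. Qed.

(** The matrix of g^-1 h differs from the identity by A_g^-1 (A_h - A_g), where A_g^-1 = J A_g^* J
    is bounded in terms of [b]; discreteness isolates the identity in [G]. *)
Lemma close_matrices_eq (b : R) : 0 <= b -> exists2 e : R, 0 < e & forall g h, G g -> G h ->
  mxle (mat g) b -> mxle (mat h - mat g) e -> h = g.
Proof.
move=> b0; have [_ G1 Gcomp GV] := sG.
have [W [ O mO WO] W1] := dG G1.
have [e0 e0p eO] : exists2 e : R, 0 < e & forall B : 'M[K1]_dim,
    (forall i j, knorm (B i j - (1%:M : 'M[K1]_dim) i j) < e) -> O B.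
  apply: mO; apply/(WO _ _ (@unitaryJ1 R k n) (@induces1 R k n)).
  suff : (W `&` G) idfun by case.
  by rewrite W1.
have [bJ bJ0 JbJ] := mxle_ex (formJ R k n).
pose D : R := dim%:R; have D0 : 0 <= D by rewrite ler0n.
pose be := D * (D * (bJ * b) * bJ); have be0 : 0 <= be by rewrite !mulr_ge0.
have Dbe : 0 <= D * be by rewrite mulr_ge0.
exists (e0 / (2 * (D * be + 1))); first by rewrite divr_gt0// mulr_gt0//; lra.
set e := e0 / _; move=> g h Gg Gh gb hg.
have [Ug ig] := matP (GM Gg); have [Uh ih] := matP (GM Gh).
have [Mg gK gVK] := moebius_inv (GM Gg).
have [gi [iV gK' giK']] := induces_inv Ug ig.
have giE : minv g = gi by exact: minvE.
have UV := unitaryJV Ug.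
have iX := induces_comp iV ih; rewrite -giE in iX.
have UX := unitaryJM UV Uh.
have be_le : mxle (unitary_inv (mat g)) be.
  by apply: mxle_mul => //; apply: mxle_mul => //; exact: mxle_adj.
have XO : O (unitary_inv (mat g) *m mat h).
  apply: eO => i j.
  have -> : (unitary_inv (mat g) *m mat h) i j - (1%:M : 'M[K1]_dim) i j =
      (unitary_inv (mat g) *m (mat h - mat g)) i j.
    by rewrite mulmxBr (unitary_invK Ug) !mxE.
  apply: le_lt_trans (mxle_mul be_le hg i j) _.
  rewrite /e mulrA mulrA ltr_pdivrMr ?mulr_gt0//; [|lra].
  have : e0 * (D * be) >= 0 by rewrite mulr_ge0// ltW.
  by rewrite -/D; lra.
have : (W `&` G) (minv g \o h).
  by split; [apply/(WO _ _ UX iX)|apply: Gcomp => //; exact: GV].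
rewrite W1 => /(congr1 (fun f => g \o f)) E; apply/funext => p.
by have := congr1 (fun f => f p) E; rewrite /= gVK.
Qed.

(** The code records, for each real coordinate of each entry, an interval of length e / 2 that
    contains it. Equal codes give entries at distance at most 2 (e / 2), hence equal elements. So
    only finitely many elements have matrices bounded by [b]. *)
Lemma bounded_code (b : R) : 0 <= b -> exists (f : (point -> point) -> nat) (M : nat),
  (forall g, G g -> mxle (mat g) b -> (f g < M)%N) /\
  (forall g h, G g -> G h -> mxle (mat g) b -> mxle (mat h) b -> f g = f h -> g = h).
Proof.
move=> b0; have [e e0 eP] := close_matrices_eq b0.
pose de := e / 2; have de0 : 0 < de by rewrite divr_gt0.
pose cell (r : R) := Num.truncn ((r + b) / de).
pose M0 := Num.truncn ((b + b) / de).
have cell_lt r : `|r| <= b -> (cell r < M0.+1)%N.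
  rewrite ler_norml => /andP[_ r2]; rewrite ltnS; apply: le_truncn.
  by rewrite ler_pM2r ?invr_gt0// lerD2r.
have cell_eq (r s : R) : `|r| <= b -> `|s| <= b -> cell r = cell s -> `|r - s| <= de.
  rewrite !ler_norml => /andP[r1 r2] /andP[s1 s2] rs.
  have rp : 0 <= (r + b) / de by rewrite divr_ge0 ?(ltW de0)//; lra.
  have sp : 0 <= (s + b) / de by rewrite divr_ge0 ?(ltW de0)//; lra.
  have /andP[a1 a2] := truncn_itv rp; have /andP[b1 b2] := truncn_itv sp.
  rewrite -/(cell r) in a1 a2; rewrite -/(cell s) -rs in b1 b2.
  rewrite -natr1 in a2 b2.
  move: a1 a2 b1 b2; rewrite ler_pdivlMr// ltr_pdivrMr// ler_pdivlMr// ltr_pdivrMr//.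
  by rewrite !mulrDl mul1r; lra.
pose F := {ffun 'I_dim * 'I_dim * option 'I_(imdim k) -> 'I_M0.+1}.
pose fF g : F := [ffun t => inord (cell (kcoord (mat g t.1.1 t.1.2) t.2))].
exists (fun g => enum_rank (fF g) : nat), #|F|; split => [g _ _|]; first exact: ltn_ord.
move=> g h Gg Gh gb hb /ord_inj/enum_rank_inj/ffunP E.
apply/esym; apply: eP => // i j; rewrite !mxE.
have -> : e = 2 * de by rewrite /de; field.
apply: knorm_le_coord => [|c]; first exact: ltW.
rewrite kcoordD kcoordN; apply: cell_eq.
- exact: le_trans (kcoord_le _ _) (hb i j).
- exact: le_trans (kcoord_le _ _) (gb i j).
have := E (i, j, c); rewrite !ffunE /= => /(congr1 (@nat_of_ord _)).
by rewrite !inordK// cell_lt//; [exact: le_trans (kcoord_le _ _) (hb i j)|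
  exact: le_trans (kcoord_le _ _) (gb i j)].
Qed.

(** [G] is the union over the naturals b of its elements with matrix bounded by b; the pair of b and
    the code determines the element. *)
Lemma subgroup_enum : exists e : nat -> point -> point, forall g, G g -> exists m, e m = g.
Proof.
have code (b : nat) : exists f : (point -> point) -> nat,
    forall g h, G g -> G h -> mxle (mat g) b%:R -> mxle (mat h) b%:R -> f g = f h -> g = h.
  by have [f [M [_ fP]]] := bounded_code (ler0n R b); exists f.
have [f fP] := choice code.
pose e m := if unpickle m is Some (b, j) then
  pick_or idfun [set g | [/\ G g, mxle (mat g) (b : nat)%:R & f b g = j]] else idfun.
exists e => g Gg; have [a a0 ga] := mxle_ex (mat g).
pose b := (Num.truncn a).+1.
have gb : mxle (mat g) b%:R.
  by move=> i j; apply: le_trans (ga i j) _; apply/ltW/truncnS_gt.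
exists (pickle (b, f b g)); rewrite /e pickleK.
have [] := @pick_orP _ idfun [set h | [/\ G h, mxle (mat h) b%:R & f b h = f b g]] g.
  by split.
by move=> Gh hb hg; exact: fP hb gb hg.
Qed.

(** Finitely many elements are concerned: sum over their codes. *)
Lemma bounded_lam_oo (b : R) : 0 <= b -> exists C : R, forall g, G g ->
  mxle (mat g) b -> lam g None <= C.
Proof.
move=> b0; have [f [M [fM fP]]] := bounded_code b0.
pose rep (m : nat) := pick_or idfun [set g | [/\ G g, mxle (mat g) b & f g = m]].
exists (\sum_(m < M) `|lam (rep m) None|) => g Gg gb.
have repE : rep (f g) = g.
  have [] := @pick_orP _ idfun [set h | [/\ G h, mxle (mat h) b & f h = f g]] g.
    by split.
  by move=> Gh hb hg; exact: fP hb gb hg.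
rewrite (bigD1 (Ordinal (fM _ Gg gb)))//= repE.
apply: le_trans (ler_norm _) _; rewrite lerDl.
by apply: sumr_ge0.
Qed.

End Discreteness.

(** * Ergodic components *)

Section Decoding.
Variables (R : realType) (k : scalar_kind) (n : nat).
Notation K1 := (scalars R k).
Notation S := (coords k n -> R).
Notation point := (option (siegel R k n)).
Implicit Types (x y : S) (h : siegel R k n) (p q : option S).

Definition decS x : siegel R k n :=
  exist _ (dec x) (eq_ind_r (fun r => 0 <= r) (lexx 0) (dec_re x)).

Definition encS h : S := coordX h.

Lemma encSE h : encS h = enc (\val h).
Proof.
by apply/funext => -[[i [j|]]|j].
Qed.

Lemma decSK x : encS (decS x) = x.
Proof. by rewrite encSE /= decK. Qed.

Lemma encSK h : XX h -> decS (encS h) = h.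
Proof. by move=> hX; apply: val_inj; rewrite encSE /= encK. Qed.

Lemma decS_XX x : XX (decS x).
Proof. exact: dec_re. Qed.

Lemma omap_decK p : omap encS (omap decS p) = p.
Proof. by case: p => //= x; rewrite decSK. Qed.

Lemma omap_encK (u : point) : bdry u -> omap decS (omap encS u) = u.
Proof. by case: u => //= h hX; rewrite encSK. Qed.

Lemma omap_dec_bdry p : bdry (omap decS p).
Proof. by case: p => //= x; exact: decS_XX. Qed.

Lemma dh_dec p q : dh (@dS R k n) p q = dhs (omap decS p) (omap decS q).
Proof. by case: p; case: q. Qed.

(** [decS] takes values in the boundary, so this is the boundary action read in real coordinates. *)
Definition actC (g : point -> point) p : option S := omap encS (g (omap decS p)).

Lemma omap_act g p : moebius g -> omap decS (actC g p) = g (omap decS p).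
Proof. by move=> Mg; rewrite omap_encK//; apply: moebius_bdry => //; exact: omap_dec_bdry. Qed.

Lemma encS_image_XX (A : set (siegel R k n)) : A `<=` @XX R k n ->
  encS @` A = [set x | A (decS x)].
Proof.
move=> AX; apply/seteqP; split => [_ [h Ah <-]|x Ax].
  by rewrite /= encSK//; exact: AX.
by exists (decS x) => //; exact: decSK.
Qed.

Lemma decS_origin x : decS x = origin R k n <-> x = encS (origin R k n).
Proof. by split => [<-|->]; rewrite ?decSK ?encSK//; exact: kre0. Qed.

Lemma decS_enc_origin : decS (encS (origin R k n)) = origin R k n.
Proof. by rewrite encSK//; exact: kre0. Qed.

Lemma dS_origin x : dS (encS (origin R k n)) x = gauge (dec x).
Proof.
have := congr1 sval decS_enc_origin; rewrite /= /dS => ->.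
by rewrite cyganE /iw_inv !oppr0 iw_mul0.
Qed.

End Decoding.

(** * The algorithm as a conformal system *)

Section ContinuedFraction.
Variables (R : realType) (k : scalar_kind) (n n0 : nat) (C : iwasawa_cf R k n).
Variable i0 : 'I_n.
Notation S := (coords k n -> R).
Notation point := (option (siegel R k n)).
Notation O := (origin R k n).
Notation G := (modular_group C).
Notation Z := (cf_Z C).
Notation iota := (cf_iota C).
Notation K := (cf_K C).
Implicit Types (p q : option S) (g : point -> point).

Lemma inversion_moebius : moebius iota.
Proof. by case: (cf_iotaP C). Qed.

Lemma lattice_isom : Z `<=` @isomX R k n.
Proof. by case: (cf_ZP C). Qed.

Lemma lattice_subgroup : is_subgroup Z.
Proof. by case: (cf_ZP C). Qed.

Lemma isom_moebius g : isomX g -> moebius g.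
Proof. by case=> -[]. Qed.

Lemma isom_infty g : isomX g -> g None = None.
Proof. by case=> -[]. Qed.

Lemma modular_subgroup : is_subgroup G /\ iota |` Z `<=` G.
Proof.
apply: generated_subgroup => g [->|/lattice_isom]; [exact: inversion_moebius|].
exact: isom_moebius.
Qed.

Lemma modular_moebius : G `<=` @moebius R k n.
Proof. by case: modular_subgroup => -[]. Qed.

Lemma isom_mapp g u : isomX g -> g (Some u) = Some (mapp g u).
Proof.
move=> ig; rewrite /mapp; case E : (g (Some u)) => //=.
have [_ gK _] := moebius_inv (isom_moebius ig).
by have := can_inj gK (etrans E (esym (isom_infty ig))).
Qed.

Lemma isom_dhs g (u v : point) : isomX g -> bdry u -> bdry v -> dhs (g u) (g v) = dhs u v.
Proof.
move=> ig; case: u => [u|]; case: v => [v|] bu bv;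
  rewrite ?(isom_infty ig) ?(isom_mapp _ ig)//=.
by case: ig => _; apply.
Qed.

Lemma dS_far (x : S) : exists y, dS x y = 10.
Proof.
by exists (trans x (axis i0 10)); rewrite dS_axis ger0_norm.
Qed.

(** [lam] is built on an arbitrary lift, but the distances determine it, and the constant 1
    satisfies the same rule. *)
Lemma lam_eq1 g p : moebius g ->
  (forall u v : point, bdry u -> bdry v -> dhs (g u) (g v) = dhs u v) ->
  lam g (omap (@decS R k n) p) = 1.
Proof.
move=> Mg iso.
apply: (lam_uniq (fun=> 0) (cell_regular R k i0) dS_far
  (L1 := fun p => lam g (omap (@decS R k n) p)) (L2 := fun=> 1)) => [q|//|q r].
  exact: lam_gt0.
have bd := @omap_dec_bdry R k n.
by rewrite dh_dec -lamP// iso// !mul1r.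
Qed.

Lemma stab_decomposition : cf_incomplete C n0 -> exists s : 'I_n0 -> point -> point,
  forall g, G g -> g None = None -> exists a r, [/\ Z a, isomX (s r) & g = a \o s r].
Proof.
case=> D [[DI /card_set_bijP[f [fD fI _]]] _ _ _ dec].
pose s (r : 'I_n0) := pick_or idfun [set g | D g /\ f g = r].
exists s => g Gg goo; have [|_ [[a r] [[/= Za Dr ->] _]]] := dec g; first by split.
have rn : (f r < n0)%N := fD _ Dr; exists a, (Ordinal rn).
suff -> : s (Ordinal rn) = r by split => //; exact: DI.
have [|Ds fs] := @pick_orP _ idfun [set g | D g /\ f g = Ordinal rn] r; first by split.
by apply: fI; rewrite ?inE.
Qed.

(** Take u of gauge 1; its image has gauge 1 too. The pairs formed by infinity, the origin and u are
    at distance 1 before and after the inversion, so the three factors have pairwise products 1. *)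
Lemma lam_inversion : lam iota None = 1.
Proof.
have [_ [iO ioo] gi _] := cf_iotaP C; have Mi := inversion_moebius.
pose u : siegel R k n := decS (axis i0 1).
have gu : gauge (\val u) = 1 by rewrite gauge_axis normr1.
have uO : u <> O by move=> E; move/eqP: gu; rewrite E gauge0 eq_sym oner_eq0.
have g1 := gi _ uO; rewrite gu invr1 in g1.
have [v iu] : exists v, iota (Some u) = Some v.
  case E : (iota (Some u)) => [v|]; first by exists v.
  have [_ iK _] := moebius_inv Mi.
  by have /Some_inj := can_inj iK (etrans E (esym iO)).
have vE : mapp iota u = v by rewrite /mapp iu.
rewrite vE in g1.
have bu : @bdry R k n (Some u) by exact: decS_XX.
have bv : XX v by have := moebius_bdry Mi bu; rewrite iu.
have bO : @bdry R k n (Some O) by exact: kre0.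
have l0 := lam_gt0 None Mi; have lu := lam_gt0 (Some u) Mi; have lO := lam_gt0 (Some O) Mi.
have dO h : dhs (Some O) (Some h) = gauge (\val h).
  by rewrite /= cyganE /iw_inv !oppr0 iw_mul0.
have := lamP Mi bu (I : @bdry R k n None).
rewrite iu ioo mulr1; have -> : dhs (Some v) (Some O) = 1.
  by rewrite /= cyganC ?kre0// -[LHS]/(dhs (Some O) (Some v)) dO.
move=> E1.
have := lamP Mi bO bu; rewrite iu iO dO gu mulr1 /= => E2.
have := lamP Mi bO (I : @bdry R k n None); rewrite iO ioo /= mulr1 => E3.
have e : lam iota None = lam iota (Some O).
  by apply: (@mulIf _ (lam iota (Some u))); rewrite ?gt_eqF// -E2 mulrC -E1.
have : lam iota None ^+ 2 = 1 by rewrite expr2 {2}e mulrC -E3.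
by move=> /eqP; rewrite -[X in _ == X](expr1n _ 2) eqrXn2// ?ltW// => /eqP.
Qed.

Lemma proper_rho : cf_proper C ->
  exists2 rho : R, 0 < rho < 1 & forall x, K x -> gauge (\val x) <= rho.
Proof.
rewrite /cf_proper; set E := [set _ | _ in _]; move=> pr.
have le x : K x -> ((gauge (\val x))%:E <= ereal_sup E)%E.
  by move=> Kx; apply: ereal_sup_ubound; exists x.
case Es : (ereal_sup E) pr le => [s| |] // pr le.
  (* The maximum with 1 / 2 makes the bound positive, as later divisions require. *)
  exists (Num.max 2^-1 s) => [|x /le]; last by rewrite lee_fin le_max => ->; rewrite orbT.
  by rewrite lt_max gt_max invr_gt0 ltr0n/=; rewrite lte_fin in pr; rewrite pr andbT; lra.
(* A supremum equal to minus infinity means that [K] is empty. *)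
by exists 2^-1 => [|x /le]; [lra|rewrite leNgt ltNye].
Qed.

Lemma domain_XX : K `<=` @XX R k n.
Proof. by case: (cf_KP C) => -[]. Qed.

Lemma inversion_XX x : x <> O -> XX x ->
  iota (Some x) = Some (mapp iota x) /\ XX (mapp iota x).
Proof.
move=> xO bx; have [_ [iO _] _ _] := cf_iotaP C; have Mi := inversion_moebius.
rewrite /mapp; case E : (iota (Some x)) => [v|] /=.
  by split => //; have := moebius_bdry (p := Some x) Mi bx; rewrite E.
by have [_ iK _] := moebius_inv Mi; have /Some_inj := can_inj iK (etrans E (esym iO)).
Qed.

Lemma shift_domain x : K x -> K (shift_map C x).
Proof.
rewrite /shift_map; case: eqP => [<- //|xO Kx].
by apply: cf_roundK; case: (inversion_XX xO (domain_XX Kx)).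
Qed.

Notation TS := (fun x : S => encS (shift_map C (decS x)) : S).
Notation KS := [set x : S | K (decS x)].

Lemma lattice_cover (x : S) : exists a x', [/\ Z a, KS x' & actC a (Some x') = Some x].
Proof.
have [_ cov _] := cf_KP C; have : XX (decS x) by exact: decS_XX.
rewrite cov => -[a Za [h Kh ah]]; exists a, (encS h).
have hX := domain_XX Kh.
split => //; first by rewrite /= encSK.
by rewrite /actC /= encSK// isom_mapp ?ah /= ?decSK//; exact: lattice_isom.
Qed.

Lemma shift_branch (x : S) : KS x -> x <> encS O ->
  KS (TS x) /\ exists2 a, Z a & actC a (Some (TS x)) = actC iota (Some x).
Proof.
move=> Kx xO; have KT := shift_domain Kx.
have xO' : decS x <> O by move=> /decS_origin.
have [iE iX] := inversion_XX xO' (domain_XX Kx).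
split; first by rewrite /= encSK//; exact: domain_XX.
exists (cf_round C (mapp iota (decS x))); first exact: cf_roundZ.
rewrite /actC /= encSK; last exact: domain_XX.
rewrite iE /shift_map; case: eqP => // _; congr omap.
have Zr := cf_roundZ C iX; have [_ _ _ ZV] := lattice_subgroup.
have [_ _ gVK] := moebius_inv (isom_moebius (lattice_isom Zr)).
by rewrite -isom_mapp ?gVK//; apply/lattice_isom/ZV.
Qed.

Notation mu := (leb (inl (i0, None) : coords k n) : set S -> \bar R).

(** Such an x lies in [K] and in the image of [K] by the inverse of a, which is not the identity as
    it moves x' to another point. *)
Lemma overlap_null : mu [set x | KS x /\
  exists a x', [/\ Z a, KS x', actC a (Some x) = Some x' & x' <> x]] = 0%E.
Proof.
have [_ _ ov] := cf_KP C; apply/eqP; rewrite eq_le outer_measure_ge0 andbT -ov.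
apply: le_outer_measure => x [Kx [a [x' [Za Kx' ax xx']]]].
have ia := lattice_isom Za; have [_ aK aVK] := moebius_inv (isom_moebius ia).
have [_ _ _ ZV] := lattice_subgroup.
have ax' : a (Some (decS x)) = Some (decS x').
  by have := omap_act (Some x) (isom_moebius ia); rewrite ax => <-.
have bx' : minv a (Some (decS x')) = Some (decS x) by rewrite -ax' aK.
exists (decS x); last exact: decSK.
split => //; exists (minv a).
  split; [exact: ZV|move=> /= a1]; apply: xx'.
  by move: bx'; rewrite a1 => /Some_inj /(congr1 (@encS R k n)); rewrite !decSK.
by exists (decS x') => //; rewrite /mapp bx'.
Qed.

Lemma few_disjoint_invariant_sets (E : 'I_n0.+1 -> set (siegel R k n)) :
  cf_discrete C -> cf_proper C -> cf_incomplete C n0 ->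
  (forall i, invariant_set K (shift_map C) (E i)) -> (forall i, muX (E i) <> 0%E) ->
  (forall i j, i != j -> E i `&` E j = set0) -> False.
Proof.
move=> dG prop inc invE E0 disE.
have [sG ZiG] := modular_subgroup; have [_ _ Gcomp GV] := sG.
have ZG : Z `<=` G by move=> a Za; apply: ZiG; right.
have Giota : G iota by apply: ZiG; left.
have GM := modular_moebius.
have [_ _ Zcomp ZV] := lattice_subgroup.
have [rho rho01 Krho] := proper_rho prop.
have [enumG enumGP] := subgroup_enum sG dG.
have [s sP] := stab_decomposition inc.
have [_ [iO ioo] _ _] := cf_iotaP C.
have EX i : E i `<=` @XX R k n by case: (invE i) => -[].
have EK i : E i `<=` K by case: (invE i).
have Eenc i := encS_image_XX (EX i).
apply: (few_invariant_sets (mul := fun g h : point -> point => g \o h) (G := G) (inv := @minv R k n)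
  (act := @actC R k n) (lam := fun g p => lam g (omap (@decS R k n) p)) (enumG := enumG)
  (o := encS O) (K := KS) (T := TS) (rho := rho) (iota := iota) (Z := Z)
  (cell_regular R k i0) (hdim_gt0 k i0) _ _ _ _ _ _ _ _ _ dS_far
  _ ZG _ _ _ Giota _ _ lam_inversion rho01 _ lattice_cover shift_branch
  (n0 := n0) (sym := fun r => actC (s r)) (A := fun i => @encS R k n @` E i)) => //=.
- by move=> g h p Gg Gh; rewrite {2}/actC omap_act//; exact: GM.
- by move=> g p /GM Mg; rewrite {1}/actC omap_act//; have [_ -> _] := moebius_inv Mg; exact: omap_decK.
- move=> g p /GM Mg; have [MV _ gVK] := moebius_inv Mg.
  by rewrite {1}/actC omap_act// gVK; exact: omap_decK.
- by move=> g p /GM; exact: lam_gt0.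
- move=> g p q /GM Mg; have bd := @omap_dec_bdry R k n.
  by rewrite !dh_dec !omap_act// lamP.
- move=> g p Gg goo; have Mg := GM _ Gg; apply: lam_eq1 => // u v bu bv.
  have [|a [r [Za ir gE]]] := sP g Gg.
    by have := omap_act None Mg; rewrite goo.
  have ia := lattice_isom Za.
  by rewrite gE /= !isom_dhs//; apply: moebius_bdry => //; exact: isom_moebius.
(* Discreteness enters: the maps in question have bounded matrices, so they are finitely many. *)
- move=> L L0; have [b b0 bP] := near_origin_bounded k i0 L0.
  have [B BP] := bounded_lam_oo sG dG b0; exists B => g Gg near.
  apply: BP => //; apply: bP => [|u uX u1]; first exact: GM.
  have [|u' [gu du lu]] := near (encS u).
    by have := dS_origin (encS u); rewrite [dec _](congr1 sval (encSK uX)) => ->.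
  rewrite encSK// in lu; exists (decS u'); split => //; last by rewrite -dS_origin.
  by have := omap_act (Some (encS u)) (GM _ Gg); rewrite gu /= encSK.
- by move=> a /lattice_isom ia; rewrite /actC /= isom_infty.
- by rewrite /actC /= decS_enc_origin iO.
- by rewrite /actC /= ioo.
- by move=> x Kx; rewrite dS_origin; exact: Krho Kx.
- exact: overlap_null.
- move=> g Gg goo; have [|a [r [Za ir gE]]] := sP g Gg.
    by have := omap_act None (GM _ Gg); rewrite goo.
  exists a, r; split => // p; rewrite {2}/actC omap_act; last exact: isom_moebius.
  by rewrite {1}gE.
- by move=> i; rewrite Eenc => x /EK.
- by move=> i; case: (invE i) => -[].
- move=> i; case: (invE i) => _ _; rewrite /muX encS_image_XX; last first.
    by move=> x [[[/domain_XX //]]|[/EX //]].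
  move=> <-; rewrite Eenc.
  suff -> : KS `&` TS @^-1` [set x | E i (decS x)] =
      [set x | (K `&` shift_map C @^-1` E i) (decS x)] by [].
  by apply/seteqP; split => x [Kx Tx]; split => //; move: Tx;
    rewrite /= encSK//; exact: domain_XX (shift_domain Kx).
- move=> i j ij; rewrite !Eenc -subset0 => x Ex.
  by have : (E i `&` E j) (decS x) := Ex; rewrite disE.
Qed.
End ContinuedFraction.

(** * Maximal families of disjoint invariant sets *)

Section ErgodicComponents.
Variables (R : realType) (k : scalar_kind) (n : nat) (i0 : 'I_n).
Notation S := (coords k n -> R).
Notation X := (siegel R k n).
Variables (K : set X) (T : X -> X).
Hypothesis mK : Defs.measurableX K.
Hypothesis TK : forall x, K x -> K (T x).
Notation mu := (leb (inl (i0, None) : coords k n) : set S -> \bar R).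
Notation invariant := (invariant_set K T).

Lemma muXE (A : set X) : muX A = mu (@encS R k n @` A).
Proof. by []. Qed.

Lemma muX_gt0 (A : set X) : (0 < muX A)%E <-> muX A <> 0%E.
Proof.
rewrite muXE lt_def outer_measure_ge0 andbT.
by split => [/eqP|H]; [|apply/eqP].
Qed.

Lemma measurableXD (A B : set X) : Defs.measurableX A -> Defs.measurableX B -> Defs.measurableX (A `\` B).
Proof.
move=> [AX mA] [BX mB]; have DX : A `\` B `<=` @XX R k n by move=> x [/AX].
split => //.
have -> : @coordX R k n @` (A `\` B) = (@encS R k n @` A) `\` (@encS R k n @` B).
  by rewrite -[LHS]/(@encS R k n @` (A `\` B)) !encS_image_XX.
exact: (caratheodory_measurable_setD (mu := mu)).
Qed.

Lemma invariant_domain : invariant K.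
Proof.
split => //; rewrite (_ : _ `+` _ = set0) ?muXE ?image_set0 ?outer_measure0//.
rewrite -subset0 => x [[[Kx _]]|[Kx]]; first exact.
by apply; split => //; exact: TK.
Qed.

(** Where [A \ B] fails to be invariant, [A] or [B] already fails. *)
Lemma invariantD (A B : set X) : invariant A -> invariant B -> invariant (A `\` B).
Proof.
move=> [mA AK A0] [mB BK B0]; split; first exact: measurableXD.
  by move=> x [/AK].
move: A0 B0; rewrite !muXE => A0 B0.
apply/eqP; rewrite eq_le outer_measure_ge0 andbT -[leRHS]adde0 -{1}A0 -B0.
apply: le_trans (outer_measureU2 _ _ _).
rewrite -image_setU; apply: le_outer_measure; apply: image_subset => x.
case: (pselect (A x)) => [Ax|nA]; case: (pselect (B x)) => [Bx|nB];
  case: (pselect (A (T x))) => [ATx|nAT]; case: (pselect (B (T x))) => [BTx|nBT];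
  case: (pselect (K x)) => [Kx|nK]; rewrite /setY /=; tauto.
Qed.

Lemma invariant_remainder (m : nat) (E : 'I_m -> set X) : (forall i, invariant (E i)) ->
  invariant (K `\` \bigcup_i E i).
Proof.
move=> invE.
have -> : \bigcup_i E i = \bigcup_(i in [set i | i \in enum 'I_m]) E i.
  by apply: eq_bigcupl; split => i _ //=; rewrite mem_enum.
elim: (enum 'I_m) => [|i s IH].
  rewrite (_ : [set i | i \in [::]] = set0) ?bigcup_set0 ?setD0; first exact: invariant_domain.
  by rewrite -subset0.
have -> : K `\` \bigcup_(j in [set j | j \in i :: s]) E j =
    (K `\` \bigcup_(j in [set j | j \in s]) E j) `\` E i.
  rewrite setDDl setUC; congr (_ `\` _); apply/seteqP; split => x.
    by move=> [j /=]; rewrite inE => /orP[/eqP ->|js]; [left|right; exists j].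
  by move=> [Ex|[j /= js Ex]]; [exists i|exists j]; rewrite //= inE ?eqxx// js orbT.
exact: invariantD.
Qed.

Definition component_family (m : nat) (E : 'I_m -> set X) :=
  (forall i, invariant (E i) /\ (0 < muX (E i))%E) /\
  (forall i j, i != j -> E i `&` E j = set0).

Lemma component_family_add m (E : 'I_m -> set X) (F : set X) : component_family E ->
  invariant F -> (0 < muX F)%E -> (forall i, F `&` E i = set0) ->
  exists E' : 'I_m.+1 -> set X, component_family E'.
Proof.
move=> [invE disE] iF F0 FE.
exists (fun i => if unlift ord0 i is Some j then E j else F); split => [i|i j].
  by case: unliftP.
case: unliftP => [i'|] ->; case: unliftP => [j'|] ->; rewrite ?eqxx//.
- by rewrite (inj_eq lift_inj) => /disE.
- by rewrite setIC.
Qed.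

(** Take a family with the largest number of members. If its complement in [K] were not null, or if
    a member split into two invariant parts of positive measure, there would be a family with one
    more member. *)
Lemma ergodic_components (n0 : nat) :
  (forall E : 'I_n0.+1 -> set X, ~ component_family E) ->
  at_most_ergodic_components K T n0.
Proof.
move=> few; pose P m := `[< exists E : 'I_m -> set X, component_family E >].
have P0 : exists m, P m.
  by exists 0%N; apply/asboolP; exists (fun=> set0); split => -[].
have Ple m : P m -> (m <= n0)%N.
  move=> /asboolP[E [invE disE]]; rewrite leqNgt; apply/negP => lt.
  apply: (few (fun i => E (widen_ord lt i))); split => [i|i j ij]; first exact: invE.
  by apply: disE; apply: contra_neq ij => /(congr1 val) /= /val_inj.
case: (ex_maxnP P0 Ple) => m /asboolP[E famE] mmax; have [invE disE] := famE.
have nP : ~ exists E' : 'I_m.+1 -> set X, component_family E'.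
  by move=> /asboolP/mmax; rewrite ltnn.
exists m, E; split => //.
- by apply: Ple; apply/asboolP; exists E.
- by move=> i j _ _ /set0P ij; apply/eqP/negPn/negP => ne; move: ij; rewrite disE ?eqxx.
- apply: contrapT => /muX_gt0 K0; apply: nP.
  apply: (component_family_add famE _ K0).
    by apply: invariant_remainder => i; case: (invE i).
  by move=> i; rewrite -subset0 => x [[_ nx] Ex]; apply: nx; exists i.
move=> i B BE iB [B0 D0]; apply: nP.
pose E' j := if j == i then E i `\` B else E j.
have E'E j : E' j `<=` E j by rewrite /E'; case: eqP => [->|_] // x [].
apply: (component_family_add (E := E') _ iB B0) => [|j].
  split => [j|j l jl]; rewrite ?/E'.
    case: eqP => // _; split => //; apply: invariantD => //.
    by case: (invE i).
  rewrite -subset0 => x [/E'E Ej /E'E El].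
  by have : (E j `&` E l) x by []; rewrite disE.
rewrite -subset0 /E' => x; case: eqP => [_ [Bx []]//|/eqP ji [/BE Ei Ej]].
by have : (E j `&` E i) x by []; rewrite disE.
Qed.

End ErgodicComponents.

Theorem theorem1p3 (R : realType) (k : scalar_kind) (n n0 : nat)
    (C : iwasawa_cf R k n) :
  (1 <= n)%N -> (1 <= n0)%N ->
  cf_discrete C -> cf_proper C -> cf_incomplete C n0 ->
  at_most_ergodic_components (cf_K C) (shift_map C) n0.
Proof.
move=> n1 _ dG prop inc; pose i0 := Ordinal n1.
apply: (ergodic_components i0); [|exact: shift_domain|].
  by case: (cf_KP C).
move=> E [invE disE]; apply: (few_disjoint_invariant_sets i0 dG prop inc _ _ disE).
  by move=> i; case: (invE i).
by move=> i; case: (invE i) => _ /(muX_gt0 i0).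
Qed.
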